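(* Let $u\in V^{\mathbf p,\mathbf m}$ be a weak solution to $\partial_tu-\sum_{j=1}^N\partial_j(a_j(x,t,u)|\partial_ju^{m_j}|^{p_j-2}\partial_ju^{m_j})=f$ in $\Omega_T$, and suppose that the exponents satisfy $m_j<p_j'\,m$ for all $j\in\{1,\dots,N\}$. Then $u^m$ has a weak gradient and $\partial_ju^m\in L^{p_j}_{\mathrm{loc}}(\Omega_T)$ for all $j\in\{1,\dots,N\}$.
   Context: Setting. $\Omega\subset\mathbb{R}^N$ is open and bounded, $T>0$, $\Omega_T=\Omega\times(0,T)$, $p_j\in(1,\infty)$, $p_j'=p_j/(p_j-1)$, $m_j\ge1$ ($j=1,\dots,N$), $m=\min_jm_j$. The coefficients $a_j:\Omega_T\times\mathbb{R}\to\mathbb{R}$ are measurable in $(x,t)$ and satisfy, for constants $\Lambda,c>0$, $\Lambda^{-1}\le a_j(x,t,u)\le\Lambda$ and $|a_j(x,t,u)-a_j(x,t,v)|\le c|u-v|$ for all $(x,t)\in\Omega_T$, $u,v\in\mathbb{R}$. $f\in L^{\sigma\bar p'}(\Omega_T;[0,\infty))$ where $\bar p=\big(\frac1N\sum_j\frac1{p_j}\big)^{-1}$, $\bar p'=\bar p/(\bar p-1)$, $\sigma>1+\frac N{\bar p}$. $\partial_ju^{m_j}:=\partial_j(u^{m_j})$ (weak derivative); for real $s$ and $\alpha>0$, $s^\alpha:=|s|^{\alpha-1}s$. With $q_*=\max(\{m+1\}\cup\{m_j:1\le j\le N\})$, $V^{\mathbf p,\mathbf m}=\{u\in L^{q_*}(\Omega_T):\partial_ju^{m_j}\in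 L^{p_j}(\Omega_T)\ \forall j\}$ (only the weak derivative of $u^{m_j}$ in the direction $x_j$ is required to exist). Weak solution: $u\in V^{\mathbf p,\mathbf m}$ with $\iint_{\Omega_T}\sum_ja_j(x,t,u)|\partial_ju^{m_j}|^{p_j-2}\partial_ju^{m_j}\partial_j\varphi-u\,\partial_t\varphi\,dx\,dt=\iint_{\Omega_T}f\varphi\,dx\,dt$ for all $\varphi\in C^\infty_{\mathrm o}(\Omega_T)$ (smooth, compactly supported). *)

(* Defs.v *)
From HB Require Import structures.
From mathcomp Require Import all_boot all_order all_algebra.
From mathcomp Require Import all_classical all_reals all_analysis.

Set Implicit Arguments.
Unset Strict Implicit.
Unset Printing Implicit Defensive.
Import Order.TTheory GRing.Theory Num.Theory.
Import numFieldNormedType.Exports.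

Local Open Scope classical_set_scope.
Local Open Scope ring_scope.

(* The Borel sigma-algebra of R^n, generated by the coordinates (as is done in
   MathComp-Analysis for n.-tuple R). *)
Section measurable_rV.
Context (R : realType) (n : nat).

Definition rV_coord (i : 'I_n) (x : 'rV[R]_n) : measurableTypeR R := x 0 i.

Let rV_set0 : g_sigma_preimage rV_coord set0.
Proof. exact: sigma_algebra0. Qed.

Let rV_setC A : g_sigma_preimage rV_coord A -> g_sigma_preimage rV_coord (~` A).
Proof. exact: sigma_algebraC. Qed.

Let rV_bigcup (F : (set 'rV[R]_n)^nat) :
  (forall i, g_sigma_preimage rV_coord (F i)) ->
  g_sigma_preimage rV_coord (\bigcup_i (F i)).
Proof. exact: sigma_algebra_bigcup. Qed.

HB.instance Definition _ :=
  @isMeasurable.Build (measure_tuple_display (R.-ocitv.-measurable).-sigma)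
    'rV[R]_n (g_sigma_preimage rV_coord) rV_set0 rV_setC rV_bigcup.

End measurable_rV.

Section lebesgue_measure_rV.
Context (R : realType).

Lemma measurable_rV_coord n (i : 'I_n) :
  measurable_fun [set: 'rV[R]_n] (@rV_coord R n i).
Proof.
move=> _ Y mY; rewrite setTI; apply: sub_sigma_algebra => /=.
rewrite -bigcup_seq/=; exists i => /=; first by rewrite mem_index_enum.
by exists Y => //; rewrite setTI.
Qed.

Lemma measurable_fun_rVP d (T : measurableType d) n (f : T -> 'rV[R]_n) :
  (forall i, measurable_fun [set: T] (@rV_coord R n i \o f)) ->
  measurable_fun [set: T] f.
Proof.
move=> mf _ A mA; rewrite setTI.
suff : image_set_system setT f measurable A by rewrite /image_set_system /= setTI.
move: A mA; apply: smallest_sub.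
  exact/sigma_algebra_image/sigma_algebra_measurable.
move=> A /=; rewrite -bigcup_seq => -[i _ [B mB]]; rewrite setTI => <-.
by rewrite /image_set_system /= setTI; have := mf i measurableT B mB; rewrite setTI.
Qed.

Definition cons_rV n (xv : measurableTypeR R * 'rV[R]_n) : 'rV[R]_n.+1 :=
  \row_i (if unlift ord0 i is Some j then xv.2 0 j else xv.1).

Lemma measurable_cons_rV n : measurable_fun setT (@cons_rV n).
Proof.
apply: measurable_fun_rVP => i.
case: (unliftP ord0 i) => [j|] ->.
  rewrite (_ : _ \o _ = @rV_coord R n j \o snd).
    exact: measurableT_comp (@measurable_rV_coord n j) measurable_snd.
  by apply/funext => -[x v]; rewrite /rV_coord /= mxE liftK.
rewrite (_ : _ \o _ = fst); first exact: measurable_fst.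
by apply/funext => -[x v]; rewrite /rV_coord /= mxE unlift_none.
Qed.

Section step.
Context n (mu : {measure set 'rV[R]_n -> \bar R}).

Definition lebesgue_rVS : set 'rV[R]_n.+1 -> \bar R :=
  pushforward (@lebesgue_measure R \x^ mu)%E (@cons_rV n).

HB.instance Definition _ := Measure.copy lebesgue_rVS
  (measure_function_pushforward__canonical__measure_function_Measure
     (product_measure2 (@lebesgue_measure R) mu) (@measurable_cons_rV n)).

End step.

Fixpoint lebesgue_rV n : {measure set 'rV[R]_n -> \bar R} :=
  if n is n'.+1 then lebesgue_rVS (lebesgue_rV n') else \d_(0 : 'rV[R]_0).

Lemma lebesgue_rV_box n (A : 'I_n -> set (measurableTypeR R)) :
  (forall i, measurable (A i)) ->
  lebesgue_rV n [set v | forall i, A i (v 0 i)] =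
  (\prod_(i < n) lebesgue_measure (A i))%E.
Proof.
elim: n A => [|n IH] A mA /=.
  by rewrite big_ord0 diracE mem_set// => -[].
rewrite big_ord_recl -IH; last by move=> i; exact: mA.
rewrite /lebesgue_rVS /pushforward -product_measure2E; [|exact: mA|].
  congr product_measure2; apply/seteqP; split=> -[x v] /=.
    move=> Axv; split=> [|i]; first by have := Axv ord0; rewrite mxE unlift_none.
    by have := Axv (lift ord0 i); rewrite mxE liftK.
  move=> [Ax Av] i; rewrite mxE.
  by case: (unliftP ord0 i) => [j|] -> //=; exact: Av.
suff -> : (fun v : 'rV[R]_n => forall i, A (lift ord0 i) (v 0 i)) =
    \bigcap_(i in [set: 'I_n]) (@rV_coord R n i @^-1` A (lift ord0 i)).
  apply: fin_bigcap_measurable => [|i _]; first exact: finite_finset.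
  by rewrite -[X in measurable X]setTI; exact: measurable_rV_coord.
by apply/seteqP; split=> v /= Av i => [_|]; exact: Av.
Qed.

End lebesgue_measure_rV.

(* The space-time R^N x R with the Lebesgue (not just Borel) sigma-algebra: the
   completion of the product of the Lebesgue measures of R^N and R. As a type,
   leb_space R N is ('rV[R]_N * R). *)
Section lebesgue_spacetime.
Context (R : realType) (N : nat).

Definition borel_lebesgue_xt :
    {measure set ('rV[R]_N * measurableTypeR R) -> \bar R} :=
  product_measure1 (lebesgue_rV R N) (@lebesgue_measure R).

Definition lebesgue_xt := @completed_measure_extension _ _ _ borel_lebesgue_xt.

HB.instance Definition _ := Measure.on lebesgue_xt.

End lebesgue_spacetime.
Arguments lebesgue_xt : clear implicits.
Notation leb_space R N := (caratheodory_type (borel_lebesgue_xt R N)^*%mu).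

Section function_spaces.
Context (R : realType) (N : nat).
Local Notation E := ('rV[R]_N * R)%type.
Local Notation mu := (lebesgue_xt R N).
Implicit Types (D : set E) (h g phi : E -> R).

Definition measurable_on D h := measurable_fun (D : set (leb_space R N)) h.

Definition Lp D (q : R) h := (h \_ D : leb_space R N -> R) \in Lfun mu q%:E.

Definition Lp_loc D (q : R) h := forall K, compact K -> K `<=` D -> Lp K q h.

(* The definitions below only integrate functions that are integrable on D, so
   that the convention for non-integrable functions plays no role. *)
Definition integral_on D h : R := (\int[mu]_(z in D) h z)%R.

Definition space_dir (j : 'I_N) : E := (delta_mx 0 j, 0).
Definition time_dir : E := (0, 1).

Definition smooth phi := forall s : seq E,
  let psi := foldr (fun v chi => 'D_v chi) phi s in
  continuous psi /\ forall z v, derivable psi z v.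

(* C_c^infty(D), extended by zero to the whole space *)
Definition test_function D phi :=
  [/\ smooth phi, compact (closure [set z | phi z != 0]) &
      closure [set z | phi z != 0] `<=` D].

Definition is_weak_derivative D (v : E) h g :=
  [/\ Lp_loc D 1 h, Lp_loc D 1 g &
   forall phi, test_function D phi ->
     integral_on D (fun z => h z * 'D_v phi z) =
     - integral_on D (fun z => g z * phi z)].

End function_spaces.
Section doubly_nonlinear_equation.
Context (R : realType) (n : nat).
Local Notation N := n.+1.
Local Notation E := ('rV[R]_N * R)%type.
Implicit Types (Omega : set 'rV[R]_N) (D : set E) (p ms : 'I_N -> R).

Definition spow (s q : R) : R := `|s| `^ (q - 1) * s.

Definition cylinder Omega (T : R) : set E := Omega `*` [set t | 0 < t < T].

Definition conj_exp (q : R) : R := q / (q - 1).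
Definition harm_mean p : R := (N%:R^-1 * \sum_(j < N) (p j)^-1)^-1.
Definition min_exp ms : R := \big[Num.min/ms ord0]_(j < N) ms j.
Definition q_star ms : R := \big[Num.max/min_exp ms + 1]_(j < N) ms j.

Definition admissible_coef D (Lam c : R) (a : 'I_N -> E -> R -> R) :=
  [/\ forall j v, measurable_on D (a j ^~ v),
      forall j z v, D z -> Lam^-1 <= a j z v <= Lam &
      forall j z v w, D z -> `|a j z v - a j z w| <= c * `|v - w|].

Definition weak_partial D (j : 'I_N) (h g : E -> R) :=
  is_weak_derivative D (space_dir R j) h g.

Definition in_V D p ms (u : E -> R) :=
  Lp D (q_star ms) u /\
  forall j, exists2 w, weak_partial D j (fun z => spow (u z) (ms j)) w &
                       Lp D (p j) w.

(* Weak derivatives are unique almost everywhere, so the choice of the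
   functions w j = d_j (u ^ ms j) is immaterial. *)
Definition weak_solution D p ms (a : 'I_N -> E -> R -> R) (f u : E -> R) :=
  in_V D p ms u /\
  exists2 w : 'I_N -> E -> R,
    forall j, weak_partial D j (fun z => spow (u z) (ms j)) (w j) &
    forall phi, test_function D phi ->
      integral_on D (fun z =>
        \sum_(j < N) a j z (u z) * (`|w j z| `^ (p j - 2) * w j z)
                      * 'D_(space_dir R j) phi z
        - u z * 'D_(time_dir R N) phi z) =
      integral_on D (fun z => f z * phi z).

End doubly_nonlinear_equation.

(* Main.v *)
From HB Require Import structures.
Require Import Defs.
From mathcomp Require Import all_boot all_order all_algebra.
From mathcomp Require Import finmap.
From mathcomp Require Import all_classical all_reals all_analysis.
From mathcomp Require Import measurable_realfun.
From mathcomp Require Import ring lra.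
Import Order.TTheory GRing.Theory Num.Theory.
Import numFieldNormedType.Exports.
Local Open Scope classical_set_scope.
Local Open Scope ring_scope.

Set Implicit Arguments.
Unset Strict Implicit.
Unset Printing Implicit Defensive.

(** Put [v j = spow u (ms j)] and let [w j] be its weak derivative in the
    direction [x_j]. As [ms j < p_j' m], there is [be > 0] such that
    [be <= ms j - (ms j - m) * p j] for all [j] ([exists_gap]). Formally, where
    [u] is small, test the equation with [psi * u ^ be] for a cutoff [psi]. The
    derivative of [u ^ be] is a multiple of [|u| ^ (be - ms j) * w j], so the flux
    contributes the integrals of [psi * |u| ^ (be - ms j) * |w j| ^ p j], with a
    positive factor; the parabolic term is the time derivative of a convex
    function of [u] and passes to [psi]; all other terms are bounded. Now the
    derivative of [u ^ m] should be [(m / ms j) * |u| ^ (m - ms j) * w j]. Where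
    [|u| <= 1], the power [p j] of its absolute value is at most a multiple of
    [|u| ^ (be - ms j) * |w j| ^ p j], by the choice of [be]; where [|u| >= 1] it
    is at most a multiple of [|w j| ^ p j]. Hence it is locally integrable to the
    power [p j].

    Three points make this rigorous.

    The power [u ^ be] is neither bounded nor a [C^1] function of [v j]. It is
    replaced by [reg dl 1 M be u], which is bounded, nondecreasing in [u], and,
    by [reg_spow], a [C^1] function with bounded derivative of each [v j] at the
    same time, so that [chain_rule] applies in every direction. The estimate
    does not depend on [dl] ([energy_bound]), and Fatou's lemma gives the
    integrability for [u ^ be] ([energy_dpow]). Regularizing [u ^ m] in the same
    way and passing to the limit by dominated convergence identifies its weak
    derivative ([weak_derive_power]).

    The function [u] has no time derivative, and [psi * h u], where [h] is the
    regularized power, is not a test function. The equation is tested with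
    translates [K (z - z0)] of a smooth kernel, multiplied by [psi * h u] at [z0]
    and integrated in [z0] ([energy_cutoff]). By Fubini's theorem the space
    derivatives of [K] pass to [psi * h u]. The kernels come in pairs
    ([kernel_pair]): the time derivative of [K] is a difference quotient over a
    length [l] of a kernel [k] of much smaller radius. As that radius tends to
    zero with [l] fixed, the parabolic term becomes the integral of
    [psi * h u * (u - u (. - l)) / l], which convexity bounds from below
    ([time_term]). The averages of the flux converge by continuity of
    translations, in mean and in duality ([tcont_integ], [shift_dual_mul]).

    All this is done with Borel functions and the product measure, on which
    translations and Fubini's theorem act. A function measurable for the
    completed measure is Borel off a Borel set of measure zero
    ([borel_off_null]), so the data of the problem may be replaced by Borel
    functions without changing any integral. Weak derivatives being unique
    ([annihilator_null]), those in the equation are those in [L^p]. *)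

(** * Coordinates of space-time *)

Section spacetime.
Context (R : realType) (N : nat).
Local Notation E := ('rV[R]_N * R)%type.
Local Notation X := ('rV[R]_N * measurableTypeR R)%type.

Definition crd (i : option 'I_N) (z : E) : R :=
  if i is Some j then z.1 ord0 j else z.2.

Definition edir (i : option 'I_N) : E :=
  if i is Some j then space_dir R j else time_dir R N.

Lemma crdD i (y z : E) : crd i (y + z) = crd i y + crd i z.
Proof. by case: i => [j|] //=; rewrite mxE. Qed.

Lemma crdN i (y : E) : crd i (- y) = - crd i y.
Proof. by case: i => [j|] //=; rewrite mxE. Qed.

Lemma crdB i (y z : E) : crd i (y - z) = crd i y - crd i z.
Proof. by rewrite crdD crdN. Qed.

Lemma crdZ i (a : R) (y : E) : crd i (a *: y) = a * crd i y.
Proof. by case: i => [j|] //=; rewrite mxE. Qed.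

Lemma crd0 i : crd i 0 = 0.
Proof. by case: i => [j|] //=; rewrite mxE. Qed.

Lemma crd_edir i k : crd k (edir i) = (k == i)%:R.
Proof.
case: i k => [j|] [k|] //=; rewrite mxE// eqxx /=.
Qed.

Lemma ball_crdP (z y : E) (r : R) : 0 < r ->
  ball z r y <-> forall i, `|crd i (y - z)| < r.
Proof.
move=> r0; split.
  move=> [b1 b2] [j|]; rewrite crdB distrC; last exact: b2.
  by have [_ /(_ ord0 j)] := b1.
move=> h; split; last by have := h None; rewrite crdB distrC.
by split=> // i j; rewrite ord1; have := h (Some j); rewrite crdB distrC.
Qed.

Lemma crd_continuous i : continuous (crd i).
Proof.
case: i => [j|] z; last exact: cvg_snd.
apply: (continuous_comp (f := fst) (g := fun v : 'rV[R]_N => v ord0 j)).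
  exact: cvg_fst.
exact: coord_continuous.
Qed.

Lemma measurable_crd i : measurable_fun [set: X] (crd i : X -> measurableTypeR R).
Proof.
case: i => [j|]; last exact: measurable_snd.
exact: measurableT_comp (@measurable_rV_coord R N j) measurable_fst.
Qed.

Lemma measurable_fun_crdP d (T : measurableType d) (f : T -> X) :
  (forall i, measurable_fun [set: T] (crd i \o f : T -> measurableTypeR R)) ->
  measurable_fun [set: T] f.
Proof.
move=> mf; apply/measurable_fun_pairP; split; last exact: (mf None).
by apply: measurable_fun_rVP => j; exact: (mf (Some j)).
Qed.

Lemma measurable_addE :
  measurable_fun [set: X * X] (fun zy : X * X => (zy.1 + zy.2 : E) : X).
Proof.
apply: measurable_fun_crdP => i.
rewrite (_ : _ \o _ = (fun zy : X * X => crd i zy.1 + crd i zy.2)); last first.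
  by apply/funext => -[z y]; rewrite /= crdD.
apply: (@measurable_funD _ _ R setT (fun zy : X * X => crd i zy.1)
  (fun zy : X * X => crd i zy.2)).
- exact: measurableT_comp (measurable_crd i) measurable_fst.
- exact: measurableT_comp (measurable_crd i) measurable_snd.
Qed.

Lemma measurable_shift (y : E) : measurable_fun [set: X] (fun z : X => (z + y : E) : X).
Proof. exact: measurableT_comp measurable_addE (measurable_pair2 y). Qed.

Lemma measurable_oppE : measurable_fun [set: X] (fun z : X => (- z : E) : X).
Proof.
apply: measurable_fun_crdP => i.
rewrite (_ : _ \o _ = (fun z : X => - crd i z)); last first.
  by apply/funext => z; rewrite /= crdN.
exact: (@measurable_funN _ _ R setT _ (measurable_crd i)).
Qed.

(** The sigma-algebra is generated by the coordinates, so boxes are measurable;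
    an open set is a union of boxes with rational data. *)
Lemma open_measurable_xt (U : set E) : open U -> measurable (U : set X).
Proof.
move=> oU.
pose q2r (k : ('rV[rat]_N * rat) * nat) : E :=
  (map_mx ratr k.1.1, ratr k.1.2).
pose B k : set X := [set z | forall i, `|crd i (z - q2r k)| < k.2.+1%:R^-1].
pose C := [set k | B k `<=` U].
have mB k : measurable (B k).
  rewrite (_ : B k = \bigcap_(i in [set: option 'I_N])
      [set z | `|crd i (z - q2r k)| < k.2.+1%:R^-1]).
    apply: fin_bigcap_measurable => [|i _]; first exact: finite_finset.
    have : measurable_fun [set: X] (fun z : X => `|crd i (z - q2r k)|).
      apply: measurableT_comp => //.
      exact: measurableT_comp (measurable_crd i) (measurable_shift (- q2r k)).
    move=> /(_ measurableT `]-oo, k.2.+1%:R^-1[%classic (measurable_itv _)).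
    rewrite setTI; congr (measurable _); apply/seteqP; split => z /=;
      by rewrite in_itv.
  by apply/seteqP; split => z /= Bz i => [_|]; exact: Bz.
rewrite (_ : U = \bigcup_(k in C) B k); last first.
  apply/seteqP; split => [z Uz|z [k Ck Bz]]; last exact: Ck.
  have /nbhs_ballP[r /= r0 zr] : nbhs z U by exact: open_nbhs_nbhs.
  have [m mr] : exists m : nat, m.+1%:R^-1 < r / 2.
    have := @archimedean.Num.Theory.truncnS_gt R (2 / r).
    move=> h; exists (Num.trunc (2 / r)).
    rewrite -[r / 2]invrK ltf_pV2 ?posrE ?invr_gt0 ?divr_gt0// invf_div.
    by rewrite (lt_le_trans h).
  have rq x : exists q : rat, `|x - ratr q| < m.+1%:R^-1 :> R.
    have [q qx] : exists q : rat, ratr q \in `]x - m.+1%:R^-1, x + m.+1%:R^-1[.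
      by apply: rat_in_itvoo; rewrite ltrBlDr -addrA ltrDl addr_gt0// invr_gt0.
    exists q; move: qx; rewrite in_itv/= ltr_distlC => /andP[a b].
    by apply/andP; split.
  have [q qP] := choice rq.
  have Bk : B ((\row_j q (z.1 ord0 j), q z.2), m) z.
    move=> i; rewrite /q2r /=; case: i => [j|] /=; last exact: qP.
    by rewrite !mxE; exact: qP.
  exists ((\row_j q (z.1 ord0 j), q z.2), m) => // y By.
  apply: zr; apply/ball_crdP => // i.
  rewrite (_ : y - z = (y - q2r ((\row_j q (z.1 ord0 j), q z.2), m))
    - (z - q2r ((\row_j q (z.1 ord0 j), q z.2), m))).
    rewrite crdB (le_lt_trans (ler_normB _ _))// [ltRHS]splitr.
    by rewrite ltrD// (lt_trans _ mr).
  by rewrite opprB addrA subrK.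
rewrite bigcup_mkcond; apply: countable_bigcupT_measurable => [|k].
  exact: countableP.
by case: ifP => // _; exact: mB.
Qed.

Lemma compact_measurable (K : set E) : compact K -> measurable (K : set X).
Proof.
move=> cK; rewrite -[K]setCK; apply: measurableC; apply: open_measurable_xt.
by apply: closed_openC; apply: compact_closed => //; exact: norm_hausdorff.
Qed.

End spacetime.

(** * Translation invariance of the measure *)

Section product_preserving.
Context d1 d2 (T1 : measurableType d1) (T2 : measurableType d2) (R : realType).
Variable m1 : {sigma_finite_measure set T1 -> \bar R}.
Variable m2 : {sigma_finite_measure set T2 -> \bar R}.
Variables (f1 : T1 -> T1) (f2 : T2 -> T2).
Hypotheses (mf1 : measurable_fun setT f1) (mf2 : measurable_fun setT f2).
Hypothesis inv1 : forall A, measurable A -> m1 (f1 @^-1` A) = m1 A.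
Hypothesis inv2 : forall A, measurable A -> m2 (f2 @^-1` A) = m2 A.

Let f (z : T1 * T2) := (f1 z.1, f2 z.2).

Let mf : measurable_fun setT f.
Proof.
apply/measurable_fun_pairP; split.
- exact: measurableT_comp mf1 measurable_fst.
- exact: measurableT_comp mf2 measurable_snd.
Qed.

(** Uniqueness of the product measure: the image measure has the right values
    on rectangles. *)
Lemma product_measure1_preserving A : measurable A ->
  (m1 \x m2)%E (f @^-1` A) = (m1 \x m2)%E A.
Proof.
move=> mA; apply/esym; pose m' := pushforward (m1 \x m2)%E f.
pose M' : {measure set (T1 * T2) -> \bar R} :=
  measure_function_pushforward__canonical__measure_function_Measure
    (m1 \x m2)%E mf.
have -> : (m1 \x m2)%E (f @^-1` A) = M' A by [].
apply: (product_measure_unique (m' := M')) => // B C mB mC.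
rewrite /M'/= /pushforward (_ : f @^-1` (B `*` C) = f1 @^-1` B `*` (f2 @^-1` C)) //.
have mp1 : measurable (f1 @^-1` B) by rewrite -[X in measurable X]setTI; exact: mf1.
have mp2 : measurable (f2 @^-1` C) by rewrite -[X in measurable X]setTI; exact: mf2.
rewrite product_measure1E//; congr (_ * _)%E; [exact: inv1|exact: inv2].
Qed.

End product_preserving.

Section lebesgue_translation.
Context (R : realType).

Lemma lebesgue_measure_shift (y : R) (A : set (measurableTypeR R)) :
  measurable A ->
  lebesgue_measure [set x : measurableTypeR R | A (x + y : R)] = lebesgue_measure A.
Proof.
move=> mA; apply/esym.
have mf : measurable_fun [set: measurableTypeR R]
    (fun x : measurableTypeR R => (x + y : R) : measurableTypeR R).
  exact: (@measurable_funD _ _ R setT (fun x : measurableTypeR R => (x : R)) (cst y)).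
pose M' : {measure set (measurableTypeR R) -> \bar R} :=
  measure_function_pushforward__canonical__measure_function_Measure
    (@lebesgue_measure R) mf.
apply: (lebesgue_measure_unique (mu := M')) => // _ [[a b] _ <-].
rewrite /M'/= /pushforward.
rewrite (_ : _ @^-1` _ = `]a - y, b - y]%classic); last first.
  by apply/seteqP; split => x /=; rewrite !in_itv/= ltrBlDr lerBrDr.
rewrite !lebesgue_measure_itv/= !lte_fin ltrD2r.
by case: ifP => // _; rewrite -!EFinD; congr EFin; lra.
Qed.

Lemma lebesgue_rV_sigma_finite n : sigma_finite setT (lebesgue_rV R n).
Proof.
exists (fun k => [set v : 'rV[R]_n | forall i, [set` `]-k%:R, k%:R[ ] (v 0 i)]).
  apply/esym; rewrite -subTset => v _.
  pose r := \big[Num.max/0]_(j < n) `|v ord0 j|.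
  exists (Num.trunc r).+1 => // j /=; rewrite in_itv/= -ltr_norml.
  by rewrite (le_lt_trans _ (truncnS_gt r))//; exact: le_bigmax.
move=> k; have mk : measurable (`]-k%:R, k%:R[%classic : set (measurableTypeR R)).
  exact: measurable_itv.
split.
  have -> : [set v : 'rV[R]_n | forall i, [set` `]-k%:R, k%:R[ ] (v 0 i)] =
      \bigcap_(i in [set: 'I_n])
        (@rV_coord R n i @^-1` [set` `]-k%:R, k%:R[ ]).
    by apply/seteqP; split => z /= Bz i => [_|]; exact: Bz.
  apply: fin_bigcap_measurable => [|i _]; first exact: finite_finset.
  rewrite -[X in measurable X]setTI; exact: measurable_rV_coord.
rewrite (lebesgue_rV_box (A := fun=> [set` `]-k%:R, k%:R[ ]))//.
suff /andP[] : (0 <= \prod_(i < n)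
    lebesgue_measure (`](- k%:R)%R, k%:R[%classic : set R) < +oo)%E by [].
elim/big_ind : _ => [|x y /andP[x0 xy] /andP[y0 yy]|i _].
- by rewrite lee01 ltry.
- by rewrite mule_ge0//= lte_mul_pinfty// ge0_fin_numE.
rewrite lebesgue_measure_itv/=; case: ifP => [|_]; last by rewrite lexx ltry.
by rewrite lte_fin -EFinD lee_fin ltry andbT subr_ge0 => /ltW.
Qed.

End lebesgue_translation.

Section lebesgue_product.
Context (R : realType).

(** A copy of the Lebesgue measure that carries its sigma-finiteness. *)
Definition lebesgue_space n : set 'rV[R]_n -> \bar R := lebesgue_rV R n.

HB.instance Definition _ n := Measure.copy (@lebesgue_space n) (lebesgue_rV R n).

HB.instance Definition _ n := @Measure_isSigmaFinite.Build _ _ _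
  (@lebesgue_space n) (@lebesgue_rV_sigma_finite R n).

Lemma measurable_rV_shift n (y : 'rV[R]_n) :
  measurable_fun setT (fun v : 'rV[R]_n => v + y).
Proof.
apply: measurable_fun_rVP => i.
rewrite (_ : _ \o _ = fun v => rV_coord i v + y 0 i); last first.
  by apply/funext => v; rewrite /rV_coord /= mxE.
exact: (@measurable_funD _ _ R setT (@rV_coord R n i) (cst _)
    (@measurable_rV_coord R n i)).
Qed.

Lemma lebesgue_space_shift n (y : 'rV[R]_n) (A : set 'rV[R]_n) :
  measurable A -> lebesgue_space [set v | A (v + y)] = lebesgue_space A.
Proof.
elim: n y A => [|n IH] y A mA.
  by congr lebesgue_space; apply/seteqP; split => v /=;
    rewrite (_ : v + y = v)//; apply/rowP => -[].
pose y1 : R := y 0 ord0; pose y2 : 'rV[R]_n := \row_j y 0 (lift ord0 j).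
have lebE (B : set 'rV[R]_n.+1) : measurable B ->
    lebesgue_space B = (@lebesgue_measure R \x @lebesgue_space n)%E
      (@cons_rV R n @^-1` B).
  move=> mB; have mcB : measurable (@cons_rV R n @^-1` B).
    by rewrite -[X in measurable X]setTI; exact: measurable_cons_rV.
  have -> : lebesgue_space B = (@lebesgue_measure R \x^ @lebesgue_space n)%E
      (@cons_rV R n @^-1` B) by [].
  apply/esym; apply: (product_measure_unique
    (m' := (@lebesgue_measure R \x^ @lebesgue_space n)%E)) => // C D mC mD.
  exact: product_measure2E.
have mA' : measurable [set v | A (v + y)].
  by rewrite -[X in measurable X]setTI; exact: (measurable_rV_shift y).
rewrite !lebE//.
rewrite -[RHS](@product_measure1_preserving _ _ _ _ _ (@lebesgue_measure R)
  (@lebesgue_space n) (fun x => (x + y1 : R)) (fun v => v + y2)) //.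
- have yE x v : cons_rV (x + y1, v + y2) = cons_rV (x, v) + y.
    apply/rowP => i; rewrite !mxE /=.
    by case: (unliftP ord0 i) => [j|] ->; rewrite ?mxE.
  congr product_measure1; apply/seteqP; split => -[x v] /=; by rewrite yE.
- exact: (@measurable_funD _ _ R setT (fun x : measurableTypeR R => (x : R)) (cst y1)).
- exact: measurable_rV_shift.
- exact: lebesgue_measure_shift.
- exact: IH.
- by rewrite -[X in measurable X]setTI; exact: measurable_cons_rV.
Qed.

End lebesgue_product.

Section lam.
Context (R : realType) (N : nat).
Local Notation E := ('rV[R]_N * R)%type.
Local Notation X := ('rV[R]_N * measurableTypeR R)%type.

(** The measure whose completion is the Lebesgue measure of space-time. *)
Definition lam : set X -> \bar R := borel_lebesgue_xt R N.

HB.instance Definition _ := Measure.copy lam (borel_lebesgue_xt R N).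

Lemma lamE : lam = (@lebesgue_space R N \x @lebesgue_measure R)%E.
Proof. by []. Qed.

Lemma measurable_ball_xt (c : E) (r : R) : measurable (ball c r : set X).
Proof. by apply: open_measurable_xt; exact: ball_open. Qed.

Lemma lam_ball_lty (c : E) (r : R) : 0 < r -> (lam (ball c r) < +oo)%E.
Proof.
move=> r0.
pose A : set 'rV[R]_N := [set v | forall i, `]c.1 ord0 i - r, c.1 ord0 i + r[%classic (v 0 i)].
have mI (x : R) : measurable (`]x - r, x + r[%classic : set (measurableTypeR R)).
  exact: measurable_itv.
have mA : measurable A.
  have -> : A = \bigcap_(i in [set: 'I_N])
        (@rV_coord R N i @^-1` (`]c.1 ord0 i - r, c.1 ord0 i + r[%classic)).
    by apply/seteqP; split => z /= Bz i => [_|]; exact: Bz.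
  apply: fin_bigcap_measurable => [|i _]; first exact: finite_finset.
  by rewrite -[X in measurable X]setTI; exact: measurable_rV_coord.
apply: (@le_lt_trans _ _ (lam (A `*` `]c.2 - r, c.2 + r[%classic))).
  apply: le_measure; rewrite ?inE.
  - exact: measurable_ball_xt.
  - exact: measurableX.
  - move=> z /ball_crdP => /(_ r0) bz; split => /= [i|].
      by have := bz (Some i); rewrite crdB /= in_itv/= distrC ltr_distlC.
    by have := bz None; rewrite crdB /= in_itv/= distrC ltr_distlC.
have intv (x : R) : (lebesgue_measure (`](x - r)%R, (x + r)%R[%classic : set R) < +oo)%E.
  by rewrite lebesgue_measure_itv/=; case: ifP => // _; rewrite -EFinB ltry.
rewrite lamE [ltLHS]product_measure1E// lte_mul_pinfty//; last exact: intv.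
  rewrite ge0_fin_numE// /lebesgue_space /A.
  rewrite (lebesgue_rV_box
    (A := fun i => `]c.1 ord0 i - r, c.1 ord0 i + r[%classic))//.
  suff /andP[] : (0 <= \prod_(i < N) lebesgue_measure
    (`](c.1 ord0 i - r)%R, (c.1 ord0 i + r)%R[%classic : set R) < +oo)%E by [].
  elim/big_ind : _ => [|x y /andP[x0 xy] /andP[y0 yy]|i _].
  - by rewrite lee01 ltry.
  - by rewrite mule_ge0//= lte_mul_pinfty// ge0_fin_numE.
  by rewrite intv andbT measure_ge0.
Qed.

Lemma lam_sigma_finite : sigma_finite setT lam.
Proof.
exists (fun k => ball (0 : E) k.+1%:R).
  apply/esym; rewrite -subTset => z _; exists (Num.trunc `|z|) => //.
  by rewrite -ball_normE /= sub0r normrN truncnS_gt.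
move=> k; split; last exact: lam_ball_lty.
exact: measurable_ball_xt.
Qed.

HB.instance Definition _ := @Measure_isSigmaFinite.Build _ _ _ lam lam_sigma_finite.

Lemma lam_shift (y : E) (A : set X) :
  measurable A -> lam [set z : X | A (z + y : E)] = lam A.
Proof.
move=> mA; rewrite lamE.
rewrite -[RHS](@product_measure1_preserving _ _ _ _ _ (@lebesgue_space R N)
  (@lebesgue_measure R) (fun v => v + y.1) (fun x => (x + y.2 : R))) //.
- exact: measurable_rV_shift.
- exact: (@measurable_funD _ _ R setT (fun x : measurableTypeR R => (x : R)) (cst y.2)).
- exact: lebesgue_space_shift.
- exact: lebesgue_measure_shift.
Qed.

End lam.
Arguments lam : clear implicits.

(** * Integrable functions and their norm in mean *)

Section L1norm.
Context d (T : measurableType d) (R : realType) (mu : {measure set T -> \bar R}).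
Implicit Types f g h : T -> R.

Definition nrm1 f : \bar R := (\int[mu]_z (`|f z|)%:E)%E.

Definition integ f := mu.-integrable setT (EFin \o f).

Lemma measurable_normE f : measurable_fun setT f ->
  measurable_fun setT (fun z => (`|f z|)%:E : \bar R).
Proof. by move=> mf; apply/measurable_EFinP; exact: measurableT_comp. Qed.

Lemma nrm1_ge0 f : (0 <= nrm1 f)%E.
Proof. by apply: integral_ge0 => z _; rewrite lee_fin. Qed.

Lemma nrm1_le f g : measurable_fun setT f -> measurable_fun setT g ->
  (forall z, `|f z| <= `|g z|) -> (nrm1 f <= nrm1 g)%E.
Proof.
move=> mf mg fg; apply: ge0_le_integral => //.
- exact: measurable_normE.
- exact: measurable_normE.
- by move=> z _; rewrite lee_fin.
Qed.

Lemma nrm1_leD f g h : measurable_fun setT f -> measurable_fun setT g ->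
  measurable_fun setT h ->
  (forall z, `|f z| <= `|g z| + `|h z|) -> (nrm1 f <= nrm1 g + nrm1 h)%E.
Proof.
move=> mf mg mh fgh; rewrite -ge0_integralD//; first last.
- exact: measurable_normE.
- exact: measurable_normE.
apply: ge0_le_integral => //.
- exact: measurable_normE.
- by apply: emeasurable_funD; exact: measurable_normE.
- by move=> z _; rewrite -EFinD lee_fin.
Qed.

Lemma nrm1Z (k : R) f : measurable_fun setT f ->
  nrm1 (fun z => k * f z) = (`|k|%:E * nrm1 f)%E.
Proof.
move=> mf; rewrite -ge0_integralZl//; last exact: measurable_normE.
by apply: eq_integral => z _; rewrite normrM.
Qed.

Lemma integP f : integ f <-> measurable_fun setT f /\ (nrm1 f < +oo)%E.
Proof.
split => [/integrableP[/measurable_EFinP mf foo]|[mf foo]]; first by split.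
by apply/integrableP; split => //; exact/measurable_EFinP.
Qed.

Lemma integ_le f g : measurable_fun setT f -> integ g ->
  (forall z, `|f z| <= `|g z|) -> integ f.
Proof.
move=> mf /integP[mg goo] fg; apply/integP; split => //.
exact: le_lt_trans (nrm1_le _ _ fg) goo.
Qed.

Lemma integ_indic (A : set T) : measurable A -> (mu A < +oo)%E ->
  integ (\1_A).
Proof.
move=> mA Aoo; apply/integP; split; first exact: measurable_indic.
rewrite /nrm1 (eq_integral (fun z => (\1_A z)%:E)); last first.
  by move=> z _; rewrite ger0_norm.
by rewrite integral_indic// setIT.
Qed.

Lemma integZ (c : R) f : integ f -> integ (fun z => c * f z).
Proof. by move=> fi; have := integrableZl measurableT c fi. Qed.

Lemma integD f g : integ f -> integ g -> integ (fun z => f z + g z).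
Proof. by move=> fi gi; have := integrableD measurableT fi gi. Qed.

Lemma integB f g : integ f -> integ g -> integ (fun z => f z - g z).
Proof. by move=> fi gi; have := integrableB measurableT fi gi. Qed.

Lemma integ_norm f : integ f -> integ (fun z => `|f z|).
Proof. by move=> /integrable_norm. Qed.

Lemma integM_bdd f g (M : R) : measurable_fun setT f -> integ g ->
  (forall z, `|f z| <= M) -> integ (fun z => f z * g z).
Proof.
move=> mf ig fM; have /integP[mg _] := ig.
have M0 : 0 <= M \/ forall z : T, False.
  have [M0|M0] := leP 0 M; [by left|right => z].
  by have := le_trans (normr_ge0 _) (fM z); rewrite leNgt M0.
apply: (@integ_le _ (fun z => M * g z)).
- exact: measurable_funM.
- by have := integrableZl measurableT M ig.
move=> z; rewrite !normrM; case: M0 => [M0|/(_ z)//].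
by rewrite ler_wpM2r// (le_trans (fM z))// ler_norm.
Qed.

Lemma nrm1_fineK f : integ f -> (fine (nrm1 f))%:E = nrm1 f.
Proof. by move=> /integP[_ fo]; rewrite fineK// ge0_fin_numE ?nrm1_ge0. Qed.

Lemma EFin_RintZ (c : R) f : integ f ->
  ((c * \int[mu]_z f z)%R%:E = \int[mu]_z (c * f z)%:E)%E.
Proof.
move=> fi; rewrite -RintegralZl// /Rintegral fineK//.
by apply: (integrable_fin_num measurableT); exact: (integZ c fi).
Qed.

Lemma Rint_le_nrm1 f : integ f -> (`|\int[mu]_z f z|%:E <= nrm1 f)%E.
Proof.
move=> fi; rewrite EFin_normr_Rintegral//.
by apply: le_abse_integral => //; have /integrableP[] := fi.
Qed.

(** Dominated convergence; the sets [P k] are left abstract because the same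
    argument serves truncations in space and in value. *)
Lemma nrm1_tail f (P : nat -> set T) : integ f -> (forall k, measurable (P k)) ->
  (forall z, exists k0, forall k, (k0 <= k)%N -> ~ P k z) ->
  forall e : R, 0 < e -> exists k0, forall k, (k0 <= k)%N ->
    (nrm1 (fun z => \1_(P k) z * f z)%R <= e%:E)%E.
Proof.
move=> fi mP Pz e e0; have /integP[mf foo] := fi.
have mPf k : measurable_fun setT (fun z => \1_(P k) z * f z).
  exact: measurable_funM (measurable_indic (mP k)) mf.
have := @dominated_convergence _ T R mu setT measurableT
  (fun k z => (`|\1_(P k) z * f z|)%:E) (cst 0%E) (fun z => (`|f z|)%:E).
case.
- by move=> k; exact: measurable_normE.
- exact: measurable_cst.
- apply: aeW => z _; apply: cvg_near_cst; have [k0 k0P] := Pz z.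
  near=> k; rewrite indicE memNset ?mul0r ?normr0//.
  by apply: k0P; near: k; exact: nbhs_infty_ge.
- exact: integrable_norm.
- apply: aeW => z k _ /=; rewrite normr_id lee_fin indicE normrM.
  by case: (_ \in _); rewrite ?normr1 ?mul1r// normr0 mul0r.
move=> _ _; rewrite integral0 => /fine_cvgP[fin /cvgrPdist_le/(_ _ e0) near0].
have [k0 _ k0P] : \forall k \near \oo, (nrm1 (fun z => \1_(P k) z * f z)%R <= e%:E)%E.
  near=> k; rewrite -[nrm1 _]fineK; last by near: k; exact: fin.
  rewrite lee_fin; have : `|0 - fine (nrm1 (fun z => \1_(P k) z * f z))| <= e.
    by near: k; exact: near0.
  by rewrite sub0r normrN => /(le_trans (ler_norm _)).
by exists k0 => k k0k; exact: k0P.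
Unshelve. all: by end_near. Qed.

Lemma nrm1Z_le (c k : R) f : 0 <= c -> 0 <= k -> measurable_fun setT f ->
  (nrm1 f <= (k / (c + 1))%:E)%E -> (nrm1 (fun z => c * f z)%R <= k%:E)%E.
Proof.
move=> c0 k0 mf h; rewrite nrm1Z// ger0_norm//.
have c1 : 0 < c + 1 by rewrite ltr_wpDl.
apply: (@le_trans _ _ (c%:E * (k / (c + 1))%:E)%E); first exact: lee_wpmul2l.
by rewrite -EFinM lee_fin mulrCA ler_piMr// ler_pdivrMr// mul1r lerDl.
Qed.

Lemma nrm1_le_sum (f : T -> R) (s : seq (T -> R)) : measurable_fun setT f ->
  (forall i, measurable_fun setT (nth f s i)) ->
  (forall z, `|f z| <= \sum_(g <- s) `|g z|) ->
  (nrm1 f <= \sum_(g <- s) nrm1 g)%E.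
Proof.
move=> mf ms fs; pose h z := \sum_(g <- s) `|g z|.
have [mh hE] : measurable_fun setT h /\
    (nrm1 h <= \sum_(g <- s) nrm1 g)%E.
  rewrite /h; elim: s ms {fs h} => [|g s IH] ms.
    rewrite big_nil; under [X in measurable_fun _ X]eq_fun do rewrite big_nil.
    split=> //; rewrite /nrm1 integral0_eq// => z _.
    by rewrite big_nil normr0.
  have [mh hE] := IH (fun i => ms i.+1); have mg := ms 0%N.
  under [X in measurable_fun _ X]eq_fun do rewrite big_cons.
  have mgh : measurable_fun setT (fun z => `|g z| + \sum_(j <- s) `|j z|).
    by apply: measurable_funD => //; exact: measurableT_comp.
  split=> //; rewrite big_cons.
  apply: (@le_trans _ _ (nrm1 g + nrm1 (fun z => \sum_(j <- s) `|j z|)%R)%E).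
    apply: nrm1_leD => //.
      by under [X in measurable_fun _ X]eq_fun do rewrite big_cons.
    move=> z; rewrite big_cons; apply: le_trans (ler_normD _ _) _.
    by rewrite normr_id.
  exact: leeD.
apply: le_trans hE; apply: nrm1_le => // z.
by rewrite [leRHS]ger0_norm ?sumr_ge0//; exact: fs.
Qed.

End L1norm.

(** * Continuity of translations in mean *)

Section translation.
Context (R : realType) (N : nat).
Local Notation E := ('rV[R]_N * R)%type.
Local Notation X := ('rV[R]_N * measurableTypeR R)%type.
Local Notation mu := (lam R N).
Implicit Types a b : X -> R.

Import HBSimple.

Definition transl (y : E) : X -> X := fun z : X => (z + y : E).

Definition translate (y : E) a : X -> R := fun z => a (transl y z).

Lemma pushforward_shift (y : E) (f : X -> \bar R) :
  (\int[pushforward mu (transl y)]_z f z = \int[mu]_z f z)%E.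
Proof.
pose M' : {measure set X -> \bar R} :=
  measure_function_pushforward__canonical__measure_function_Measure
    mu (measurable_shift y).
have -> : (\int[pushforward mu (transl y)]_z f z =
  \int[M']_z f z)%E by [].
by apply: eq_measure_integral => A mA _; exact: lam_shift.
Qed.

Lemma ge0_integral_shift (y : E) (f : X -> \bar R) : measurable_fun setT f ->
  (forall z, 0 <= f z)%E -> (\int[mu]_z f (transl y z) = \int[mu]_z f z)%E.
Proof.
move=> mf f0; rewrite -[RHS](pushforward_shift y).
by rewrite ge0_integral_pushforward//; exact: measurable_shift.
Qed.

Lemma measurable_shift_fun (y : E) a : measurable_fun setT a ->
  measurable_fun setT (translate y a).
Proof. by move=> ma; exact: measurableT_comp ma (measurable_shift y). Qed.

Lemma nrm1_shift (y : E) a : measurable_fun setT a ->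
  nrm1 mu (translate y a) = nrm1 mu a.
Proof.
move=> ma; apply: (ge0_integral_shift y (f := fun z => (`|a z|)%:E)).
  exact: measurable_normE.
by move=> z; rewrite lee_fin.
Qed.

Lemma integ_shift (y : E) a : integ mu a -> integ mu (translate y a).
Proof.
move=> /integP[ma aoo]; apply/integP; split; first exact: measurable_shift_fun.
by rewrite nrm1_shift.
Qed.

Lemma Rint_shift (y : E) a : integ mu a ->
  \int[mu]_z translate y a z = \int[mu]_z a z.
Proof.
move=> ia; have /integP[ma _] := ia; rewrite /Rintegral; congr fine.
rewrite -[RHS](pushforward_shift y) integral_pushforward//.
- exact: measurable_shift.
- exact/measurable_EFinP.
- by rewrite preimage_setT; exact: (integ_shift y ia).
Qed.

Definition tcont a := forall e : R, 0 < e -> exists2 d : R, 0 < d &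
  forall y : E, `|y| < d -> (nrm1 mu (fun z => translate y a z - a z)%R <= e%:E)%E.

Let mB y a b : measurable_fun setT a -> measurable_fun setT b ->
  measurable_fun setT (fun z => translate y a z - b z).
Proof.
by move=> ma mb; apply: measurable_funB => //; exact: measurable_shift_fun.
Qed.

(** Translations are isometries in mean. *)
Lemma tcont_lim a : measurable_fun setT a ->
  (forall e : R, 0 < e -> exists b, [/\ measurable_fun setT b, tcont b &
    (nrm1 mu (fun z => a z - b z)%R <= e%:E)%E]) -> tcont a.
Proof.
move=> ma h e e0; have e3 : 0 < e / 3 by rewrite divr_gt0.
have [b [mb tb ab]] := h _ e3; have [d d0 db] := tb _ e3.
exists d => // y yd; have mab := measurable_funB ma mb.
apply: (@le_trans _ _ (nrm1 mu (translate y (fun z => a z - b z)%R) +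
   nrm1 mu (fun z => `|translate y b z - b z| + `|a z - b z|)%R)%E).
  apply: nrm1_leD; [exact: mB|exact: measurable_shift_fun| |].
    by apply: measurable_funD; apply: measurableT_comp => //; exact: mB.
  move=> z; rewrite [X in _ <= _ + X]ger0_norm ?addr_ge0// /translate.
  rewrite (_ : a (z + y) - a z = (a (z + y) - b (z + y)) +
    ((b (z + y) - b z) - (a z - b z))); last by ring.
  by rewrite (le_trans (ler_normD _ _))// lerD2l ler_normB.
have -> : e = e / 3 + (e / 3 + e / 3) by field.
rewrite !EFinD; apply: leeD; first by rewrite nrm1_shift.
apply: (@le_trans _ _ (nrm1 mu (fun z => translate y b z - b z)%R +
   nrm1 mu (fun z => a z - b z)%R)%E); last by apply: leeD => //; exact: db.
apply: nrm1_leD => //; [|exact: mB|].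
  by apply: measurable_funD; apply: measurableT_comp => //; exact: mB.
by move=> z; rewrite ger0_norm ?addr_ge0.
Qed.

Lemma tcont0 : tcont (cst 0).
Proof.
move=> e e0; exists 1 => // y _; rewrite /nrm1 integral0_eq ?lee_fin ?ltW//.
by move=> z _; rewrite /translate subrr normr0.
Qed.

Lemma tcontD a b : measurable_fun setT a -> measurable_fun setT b ->
  tcont a -> tcont b -> tcont (fun z => a z + b z).
Proof.
move=> ma mb ta tb e e0; have e2 : 0 < e / 2 by rewrite divr_gt0.
have [d d0 da] := ta _ e2; have [d' d'0 d'b] := tb _ e2.
exists (Num.min d d'); first by rewrite lt_min d0.
move=> y; rewrite lt_min => /andP[yd yd'].
apply: (@le_trans _ _ (nrm1 mu (fun z => translate y a z - a z)%R +
   nrm1 mu (fun z => translate y b z - b z)%R)%E).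
  apply: nrm1_leD; [|exact: mB|exact: mB|].
    exact: (mB _ (measurable_funD ma mb) (measurable_funD ma mb)).
  move=> z; rewrite /translate opprD addrACA; exact: ler_normD.
by rewrite (splitr e) EFinD; apply: leeD; [exact: da|exact: d'b].
Qed.

Lemma tcontZ (k : R) a : measurable_fun setT a -> tcont a ->
  tcont (fun z => k * a z).
Proof.
move=> ma ta e e0; have k0 : 0 < `|k| + 1 by rewrite ltr_wpDl.
have [d d0 da] := ta _ (divr_gt0 e0 k0).
exists d => // y yd; apply: (@le_trans _ _
  (nrm1 mu (fun z => k * (translate y a z - a z))%R)).
  apply: nrm1_le.
  - by apply: mB; exact: measurable_funM.
  - by apply: measurable_funM => //; exact: mB.
  - by move=> z; rewrite /translate mulrBr.
rewrite nrm1Z; last exact: mB.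
apply: (@le_trans _ _ ((`|k| + 1)%:E * (e / (`|k| + 1))%:E)%E).
  apply: lee_pmul => //; [exact: nrm1_ge0|by rewrite lee_fin lerDl|exact: da].
by rewrite -EFinM mulrCA divff ?mulr1// gt_eqF.
Qed.

Lemma tcont_sum (s : seq nat) (c : nat -> R) (a : nat -> X -> R) :
  (forall i, measurable_fun setT (a i)) -> (forall i, tcont (a i)) ->
  tcont (fun z => \sum_(i <- s) c i * a i z).
Proof.
move=> ma ta; elim: s => [|i s IH].
  by rewrite (_ : (fun _ => _) = cst 0); [exact: tcont0|apply/funext => z; rewrite big_nil].
rewrite (_ : (fun _ => _) = fun z => c i * a i z + \sum_(i <- s) c i * a i z); last first.
  by apply/funext => z; rewrite big_cons.
apply: tcontD => //; [exact: measurable_funM| |exact: tcontZ].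
elim: s {IH} => [|j s IH].
  by rewrite (_ : (fun _ => _) = cst 0)//; apply/funext => z; rewrite big_nil.
rewrite (_ : (fun _ => _) = fun z => c j * a j z + \sum_(i <- s) c i * a i z); last first.
  by apply/funext => z; rewrite big_cons.
by apply: measurable_funD => //; exact: measurable_funM.
Qed.

Lemma measurable_ballX (c : E) (r : R) : measurable (ball c r : set X).
Proof. exact: measurable_ball_xt. Qed.

Lemma indicC1 (A : set X) z : \1_(~` A) z = 1 - \1_A z :> R.
Proof. by rewrite indicC indicE; case: (z \in A); rewrite ?subrr ?subr0. Qed.

(** The indicator of a bounded open set is lower semicontinuous, so little
    of the set is lost under a small translation; as translations preserve
    the measure, equally little is gained. *)
Lemma tcont_open (U : set X) (r : R) : 0 < r -> open (U : set E) ->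
  U `<=` (ball (0 : E) r : set X) -> tcont (\1_U).
Proof.
move=> r0 oU Ur e e0; have mU : measurable U := open_measurable_xt oU.
have Ufin : (mu U < +oo)%E.
  apply: le_lt_trans (lam_ball_lty 0 r0); apply: le_measure => //; rewrite inE//.
  exact: measurable_ballX.
have e2 : 0 < e / 2 by rewrite divr_gt0.
pose V k : set X := ~` [set z | exists2 w, (~` U) w & ball (z : E) k.+1%:R^-1 w].
have mV k : measurable (V k).
  apply: measurableC; apply: open_measurable_xt.
  rewrite (_ : [set z | _] = \bigcup_(w in ~` U) ball (w : E) k.+1%:R^-1).
    by apply: bigcup_open => w _; exact: ball_open.
  by apply/seteqP; split => z [w Uw zw]; exists w => //; exact: ball_sym.
have UV : U = \bigcup_k V k.
  apply/seteqP; split => [z Uz|z [k _ Vz]].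
    have /nbhs_ballP[s /= s0 zs] : nbhs (z : E) U by exact: open_nbhs_nbhs.
    exists (Num.trunc s^-1) => // -[w nUw zw]; apply: nUw; apply: zs.
    apply: le_ball zw; rewrite -[leRHS]invrK lef_pV2 ?posrE ?invr_gt0//.
    exact/ltW/truncnS_gt.
  apply: contrapT => nUz; apply: Vz; exists z => //; exact: ballxx.
pose P k : set X := U `\` V k.
have iU : integ mu (\1_U) by exact: integ_indic.
have := @nrm1_tail _ X R mu (\1_U) P iU _ _ _ e2; case.
- by move=> k; exact: measurableD.
- move=> z; have [Uz|nUz] := pselect (U z); last by exists 0%N => k _ [].
  move: (Uz); rewrite {1}UV => -[k0 _ Vz]; exists k0 => k kk [_]; apply.
  move=> -[w nUw zw]; apply: Vz; exists w => //; apply: le_ball zw.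
  by rewrite lef_pV2 ?posrE// ler_nat ltnS.
move=> k /(_ _ (leqnn _)) ke.
pose p y z : R := \1_U z * (1 - translate y (\1_U) z).
have mU1 : measurable_fun setT (\1_U : X -> R) by exact: measurable_indic.
have mp y : measurable_fun setT (p y).
  apply: measurable_funM => //; apply: measurable_funB => //.
  exact: measurable_shift_fun.
have pe y : `|y| < k.+1%:R^-1 -> (nrm1 mu (p y) <= (e / 2)%:E)%E.
  move=> yk; apply: le_trans ke; apply: nrm1_le => //.
    by apply: measurable_funM => //; apply: measurable_indic; exact: measurableD.
  move=> z; rewrite /p /translate /transl !indicE.
  have [zU|nzU] := boolP (z \in U); last by rewrite mul0r mulr0.
  have [yU|nyU] := boolP (z + y \in U); first by rewrite subrr mulr0 normr0.
  have Pz : P k z.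
    split; first by rewrite inE in zU.
    apply; exists (z + y : E); first by move=> /mem_set; rewrite (negbTE nyU).
    by rewrite -ball_normE /= opprD addNKr normrN.
  by rewrite (mem_set Pz) subr0.
exists k.+1%:R^-1; first by rewrite invr_gt0.
move=> y yk; rewrite (splitr e) EFinD.
apply: (@le_trans _ _ (nrm1 mu (p y) + nrm1 mu (translate y (p (- y)%R)))%E).
  apply: nrm1_leD => //; [exact: mB|exact: measurable_shift_fun|].
  move=> z; rewrite /p /translate /transl addrK !indicE.
  case: (_ \in _); case: (_ \in _);
    by rewrite ?subrr ?subr0 ?sub0r ?mulr0 ?mulr1 ?mul0r ?normrN ?normr0 ?addr0 ?add0r.
by apply: leeD; [exact: pe|rewrite nrm1_shift//; apply: pe; rewrite normrN].
Qed.

(** The class of good sets is a lambda-system containing the open sets, which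
    are stable under intersection; the ball keeps all measures finite. *)
Lemma tcont_bounded_indic (A : set X) (r : R) : measurable A -> 0 < r ->
  tcont (\1_(A `&` ball (0 : E) r)).
Proof.
move=> mA r0; pose B : set X := ball (0 : E) r.
have mB0 : measurable B by exact: measurable_ballX.
have oB : open (B : set E) by exact: ball_open.
have fB : (mu B < +oo)%E by exact: lam_ball_lty.
have BB : B `<=` (ball (0 : E) r : set X) by [].
rewrite -/B; clearbody B.
pose G : set (set X) := [set A | measurable A /\ tcont (\1_(A `&` B))].
pose H : set (set X) := [set U | open (U : set E)].
have GT : G setT.
  by split => //; rewrite setTI; exact: (tcont_open r0).
have GD : setSD_closed G.
  move=> A1 A2 A21 [mA1 tA1] [mA2 tA2]; split; first exact: measurableD.
  rewrite (_ : \1_ _ = fun z => \1_(A1 `&` B) z + (-1) * \1_(A2 `&` B) z).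
    apply: tcontD => //; last apply: tcontZ => //.
    - by apply: measurable_indic; exact: measurableI.
    - apply: measurable_funM => //.
      by apply: measurable_indic; exact: measurableI.
    - by apply: measurable_indic; exact: measurableI.
  apply/funext => z; rewrite setDE !indicI /= indicC1.
  rewrite [in RHS](_ : \1_A2 z = \1_A1 z * \1_A2 z :> R).
    by rewrite mulrBr mulr1 mulrBl mulN1r.
  by rewrite -[in LHS](setIidr A21) indicI.
have Gnd : ndseq_closed G.
  move=> F ndF GF; have mF i : measurable (F i) by have [] := GF i.
  have mUF : measurable (\bigcup_i F i) by exact: bigcupT_measurable.
  split => //.
  have mI i : measurable (F i `&` B) by exact: measurableI.
  apply: tcont_lim; first by apply: measurable_indic; exact: measurableI.
  move=> e e0.
  pose P k := (\bigcup_i F i) `\` F k.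
  have iB : integ mu (\1_B).
    by exact: integ_indic.
  have := @nrm1_tail _ X R mu (\1_B) P iB _ _ _ e0; case.
  - by move=> k; exact: measurableD.
  - move=> z; have [[k0 _ Fz]|nFz] := pselect ((\bigcup_i F i) z).
      exists k0 => k kk [_]; apply; move: Fz; exact/subsetPset/ndF.
    by exists 0%N => k _ [].
  move=> k /(_ _ (leqnn _)) ke; exists (\1_(F k `&` B)); split.
  - exact: measurable_indic.
  - by have [] := GF k.
  apply: le_trans ke; rewrite le_eqVlt; apply/orP; left; apply/eqP.
  congr nrm1; apply/funext => z; rewrite /P setDE !indicI /= indicC1.
  have FU : F k `<=` \bigcup_i F i by move=> x Fx; exists k.
  have e1 : \1_(F k) z = \1_(\bigcup_i F i) z * \1_(F k) z :> R.
    by rewrite -[in LHS](setIidr FU) indicI.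
  by rewrite mulrBr mulr1 -e1 mulrBl.
have lG : lambda_system setT G by split.
have GH : H `<=` G.
  move=> U oU; split; first exact: open_measurable_xt.
  apply: (tcont_open r0) => [|z [_ /BB]//].
  exact: openI.
have HI : setI_closed H by move=> U V; exact: openI.
have /(_ A) [] // := lambda_system_subset HI lG GH (fun _ _ => subsetT _).
have gen : measurable_fun [set: g_sigma_algebraType H]
    (fun z : g_sigma_algebraType H => z : X).
  apply: measurable_fun_crdP => i.
  apply: (measurability _ (RGenOInfty.measurableE R)) => //.
  move=> _ [_ [x ->] <-]; rewrite setTI; apply: sub_sigma_algebra.
  apply: (open_comp (f := crd i) (D := `]x, +oo[%classic)); last first.
    exact: interval_open.
  by move=> z _; exact: crd_continuous.
by have := gen measurableT A mA; rewrite setTI.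
Qed.

(** Simple functions with bounded support are dense in mean. *)
Theorem tcont_integ a : integ mu a -> tcont a.
Proof.
move=> ia; have /integP[ma _] := ia; apply: tcont_lim => // e e0.
have e2 : 0 < e / 2 by rewrite divr_gt0.
have [g [ig _ /fine_cvgP[gfin /cvgrPdist_le/(_ _ e2) gl]]] :=
  approximation_sfun_integrable measurableT ia.
have [n gn] : exists n, (nrm1 mu (fun z => a z - g n z)%R <= (e / 2)%:E)%E.
  near \oo => n; exists n.
  have -> : nrm1 mu (fun z => a z - g n z) = (\int[mu]_z `|(a z)%:E - (g n z)%:E|)%E.
    by apply: eq_integral => z _; rewrite -EFinB.
  rewrite -[X in (X <= _)%E]fineK; last by near: n; exact: gfin.
  rewrite lee_fin; apply: le_trans (ler_norm _) _; rewrite -normrN -sub0r.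
  by near: n; exact: gl.
pose P k : set X := ~` ball (0 : E) k.+1%:R.
have := @nrm1_tail _ X R mu a P ia _ _ _ e2; case.
- by move=> k; apply: measurableC; exact: measurable_ballX.
- move=> z; exists (Num.trunc `|z : E|) => k zk; apply.
  rewrite -ball_normE /= sub0r normrN (lt_le_trans (truncnS_gt _))//.
  by rewrite ler_nat ltnS.
move=> k /(_ _ (leqnn _)) ke; pose B : set X := ball (0 : E) k.+1%:R.
have mB0 : measurable B by exact: measurable_ballX.
have mg : measurable_fun setT (g n) by [].
exists (fun z => \1_B z * g n z); split.
- by apply: measurable_funM => //; exact: measurable_indic.
- pose s := fset_set (g n @` setT).
  rewrite (_ : (fun _ => _) = fun z => \sum_(i <- iota 0 #|` s|)
     (s : seq R)`_i * \1_(g n @^-1` [set (s : seq R)`_i] `&` B) z).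
    apply: (@tcont_sum (iota 0 _) (fun i => (s : seq R)`_i)
      (fun i => \1_(g n @^-1` [set (s : seq R)`_i] `&` B))) => i.
      apply: measurable_indic; apply: measurableI => //.
    by apply: tcont_bounded_indic.
  apply/funext => z; rewrite (fimfunEord (g n) z) mulr_sumr.
  rewrite -[in RHS](subn0 #|` s|) -/(index_iota 0 _) big_mkord.
  apply: eq_bigr => i _; rewrite mulrCA; congr (_ * _).
  by rewrite !indicE in_setI; case: (_ \in _); case: (_ \in _); rewrite /= ?mulr1 ?mulr0.
apply: (@le_trans _ _ (nrm1 mu (fun z => \1_(P k) z * a z)%R +
  nrm1 mu (fun z => a z - g n z)%R)%E); last first.
  by rewrite [in leRHS](splitr e) EFinD; exact: leeD.
apply: nrm1_leD.
- by apply: measurable_funB => //; apply: measurable_funM => //; exact: measurable_indic.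
- by apply: measurable_funM => //; apply: measurable_indic; exact: measurableC.
- exact: measurable_funB.
move=> z; rewrite !indicE /P in_setC; case: (_ \in _) => /=.
  by rewrite mul1r mul0r normr0 add0r.
by rewrite mul0r mul1r subr0 lerDl.
Unshelve. all: by end_near. Qed.

End translation.

(** * Averages over kernels *)

Section approximate_identity.
Context (R : realType) (N : nat).
Local Notation E := ('rV[R]_N * R)%type.
Local Notation X := ('rV[R]_N * measurableTypeR R)%type.
Local Notation mu := (lam R N).
Implicit Types a b K : X -> R.

(** The convolution of [a] with the reflected kernel: with this sign, [conv a K z]
    is the integral of [a] against [K] centred at [z]. *)
Definition conv a K (z : X) : R := \int[mu]_y (translate z a y * K y).

Definition avg_kernel (r : R) K :=
  [/\ measurable_fun setT K, forall y, 0 <= K y,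
      (\int[mu]_y (K y)%:E = 1)%E,
      forall y : E, K y != 0 -> `|y| < r &
      exists M : R, forall y, K y <= M].

Lemma avg_kernel_integ r K : avg_kernel r K -> integ mu K.
Proof.
move=> [mK K0 K1 _ _]; apply/integP; split => //.
rewrite /nrm1 (eq_integral (fun y => (K y)%:E)) ?K1 ?ltry// => y _.
by rewrite ger0_norm.
Qed.

Lemma measurable_shift2 a : measurable_fun setT a ->
  measurable_fun setT (fun zy : X * X => translate zy.2 a zy.1).
Proof. by move=> ma; exact: measurableT_comp ma (@measurable_addE R N). Qed.

Lemma shiftC a (y z : X) : translate y a z = translate z a y.
Proof. by rewrite /translate /transl addrC. Qed.

Lemma integ_shift_mul a K (M : R) z : integ mu a -> measurable_fun setT K ->
  (forall y, `|K y| <= M) -> integ mu (fun y => translate z a y * K y).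
Proof.
move=> ia mK KM.
rewrite (_ : (fun _ => _) = fun y => K y * translate z a y); last first.
  by apply/funext => y; rewrite mulrC.
by apply: integM_bdd KM => //; exact: integ_shift.
Qed.

Lemma integrable_conv2 a K : integ mu a -> integ mu K ->
  (mu \x mu)%E.-integrable setT
    (fun zy : X * X => (translate zy.1 a zy.2 * K zy.2)%:E).
Proof.
move=> /integP[ma afin] /integP[mK Kfin].
have mf : measurable_fun setT (fun zy : X * X => (translate zy.1 a zy.2 * K zy.2)%:E).
  apply/measurable_EFinP; apply: measurable_funM; last first.
    exact: measurableT_comp mK measurable_snd.
  rewrite (_ : (fun _ => _) = fun zy : X * X => translate zy.2 a zy.1); last first.
    by apply/funext => zy; exact: shiftC.
  exact: measurable_shift2.
apply/(@integrable21ltyP _ _ _ _ R mu mu _ mf).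
rewrite (eq_integral (fun y => nrm1 mu a * (`|K y|)%:E)%E); last first.
  move=> y _ /=; rewrite -(nrm1_shift y ma) muleC -ge0_integralZl//.
  - apply: eq_integral => z _; rewrite -EFinM normrM mulrC; congr (_ * _)%:E.
    by rewrite /= shiftC.
  - by apply: measurable_normE; exact: measurable_shift_fun.
rewrite ge0_integralZl ?nrm1_ge0//; last exact: measurable_normE.
by rewrite lte_mul_pinfty ?nrm1_ge0// ge0_fin_numE ?nrm1_ge0.
Qed.

Lemma measurable_conv a K : integ mu a -> integ mu K ->
  measurable_fun setT (conv a K).
Proof.
move=> ia iK; have := measurable_fubini_F (integrable_conv2 ia iK).
by move=> mF; exact: measurableT_comp.
Qed.

(** An average of translates of [a] is as close to [a] as the translates
    are; the weight [b] lets the same estimate serve in mean and in duality. *)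
Lemma approx_identity a b K (r k : R) : integ mu a -> measurable_fun setT b ->
  avg_kernel r K ->
  (forall y : E, `|y| < r ->
    (nrm1 mu (fun z => (translate y a z - a z) * b z)%R <= k%:E)%E) ->
  (nrm1 mu (fun z => (conv a K z - a z) * b z)%R <= k%:E)%E.
Proof.
move=> ia mb aK hk; have iK := avg_kernel_integ aK.
have [mK K0 K1 Kr [M KM]] := aK; have /integP[ma _] := ia.
have KM' y : `|K y| <= M by rewrite ger0_norm.
have IK1 : \int[mu]_y K y = 1 by rewrite /Rintegral K1.
have iaK z : integ mu (fun y => translate z a y * K y) by exact: integ_shift_mul KM'.
have icK c : integ mu (fun y => c * K y) by exact: integZ.
have convE z : conv a K z - a z = \int[mu]_y ((translate z a y - a z) * K y).
  rewrite -[a z]mulr1 -[in LHS]IK1 -RintegralZl// -RintegralB//; [|exact: iaK|exact: icK].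
  by apply: eq_Rintegral => y _; rewrite mulr1 mulrBl.
pose F (zy : X * X) := (`|(translate zy.1 a zy.2 - a zy.1) * b zy.1| * K zy.2)%:E : \bar R.
have mF : measurable_fun setT F.
  apply/measurable_EFinP; apply: measurable_funM; last first.
    exact: measurableT_comp mK measurable_snd.
  apply: measurableT_comp => //; apply: measurable_funM; last first.
    exact: measurableT_comp mb measurable_fst.
  apply: measurable_funB; last exact: measurableT_comp ma measurable_fst.
  rewrite (_ : (fun _ => _) = fun zy : X * X => translate zy.2 a zy.1); last first.
    by apply/funext => zy; exact: shiftC.
  exact: measurable_shift2.
have F0 zy : (0 <= F zy)%E by rewrite lee_fin mulr_ge0.
have mc : measurable_fun setT (fun z => (conv a K z - a z) * b z).
  apply: measurable_funM => //; apply: measurable_funB => //.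
  exact: measurable_conv.
apply: (@le_trans _ _ (\int[mu]_z \int[mu]_y F (z, y))%E).
  apply: ge0_le_integral => //.
  - exact: measurable_normE.
  - exact: measurable_fun_fubini_tonelli_F.
  move=> z _; rewrite normrM convE.
  have iz : integ mu (fun y => (translate z a y - a z) * K y).
    rewrite (_ : (fun _ => _) = fun y => translate z a y * K y - a z * K y).
      exact: integrableB (iaK z) (icK (a z)).
    by apply/funext => y; rewrite mulrBl.
  rewrite (eq_integral (fun y => (`|b z|)%:E * (`|(translate z a y - a z) * K y|)%:E)%E).
    have /integP[miz _] := iz.
    rewrite ge0_integralZl//; last exact: measurable_normE.
    by rewrite muleC EFinM lee_wpmul2r// ?lee_fin//; exact: Rint_le_nrm1.
  move=> y _; rewrite /F /= -EFinM !normrM (ger0_norm (K0 y)); congr EFin; ring.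
rewrite fubini_tonelli//.
apply: (@le_trans _ _ (\int[mu]_y (k%:E * (K y)%:E))%E); last first.
  by rewrite integralZl// K1 mule1.
have k0 : (exists y, K y != 0) -> (0 <= k%:E)%E.
  by move=> [y Ky]; exact: le_trans (nrm1_ge0 _ _) (hk _ (Kr _ Ky)).
apply: ge0_le_integral => //.
- by move=> y _; exact: integral_ge0.
- exact: measurable_fun_fubini_tonelli_G.
- by apply/measurable_EFinP; exact: measurable_funM.
move=> y _; have [Ky|Ky] := eqVneq (K y) 0.
  rewrite Ky mule0 integral0_eq// => z _; rewrite /F/= Ky mulr0//.
rewrite (eq_integral (fun z => (K y)%:E * (`|(translate y a z - a z) * b z|)%:E)%E).
  rewrite ge0_integralZl ?lee_fin//; last first.
    apply: measurable_normE; apply: measurable_funM => //.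
    by apply: measurable_funB => //; exact: measurable_shift_fun.
  by rewrite muleC lee_wpmul2r ?lee_fin//; apply: hk; exact: Kr.
by move=> z _; rewrite /F /= -EFinM mulrC shiftC.
Qed.

Lemma conv_approx a K (r k : R) : integ mu a -> avg_kernel r K ->
  (forall y : E, `|y| < r -> (nrm1 mu (fun z => translate y a z - a z)%R <= k%:E)%E) ->
  (nrm1 mu (fun z => conv a K z - a z)%R <= k%:E)%E.
Proof.
move=> ia aK hk; have := @approx_identity a (cst 1) K r k ia (measurable_cst _) aK.
rewrite (_ : (fun z => _) = fun z => conv a K z - a z); last first.
  by apply/funext => z; rewrite /= mulr1.
apply => y /hk; rewrite (_ : (fun z => (_ - _) * _) = fun z => translate y a z - a z)//.
by apply/funext => z; rewrite /= mulr1.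
Qed.

Lemma conv_kernel a K (M : R) (z0 : X) : integ mu a -> measurable_fun setT K ->
  (forall y, `|K y| <= M) ->
  \int[mu]_z (a z * K (transl (- (z0 : E)) z)) = conv a K z0.
Proof.
move=> ia mK KM; rewrite /conv.
rewrite -(@Rint_shift R N z0 (fun z => a z * K (transl (- (z0 : E)) z))).
  apply: eq_Rintegral => y _; rewrite /translate /transl addrK//.
rewrite (_ : (fun _ => _) = fun z => translate (- (z0 : E)) K z * a z); last first.
  by apply/funext => z; rewrite mulrC.
apply: (@integM_bdd _ _ _ _ _ _ M) => //; first exact: measurable_shift_fun.
by move=> z; exact: KM.
Qed.

(** The symmetric role of [a] and [b] is how a derivative falling on the kernel
    in an equation for [a] is moved to [b]. *)
Lemma kernel_fubini a b K (M : R) : integ mu a -> integ mu b ->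
  measurable_fun setT K -> (forall y, `|K y| <= M) ->
  \int[mu]_z0 (b z0 * \int[mu]_z (a z * K (transl (- (z0 : E)) z))) =
  \int[mu]_z (a z * \int[mu]_z0 (b z0 * K (transl (- (z0 : E)) z))).
Proof.
move=> ia ib mK KM; have /integP[ma afin] := ia; have /integP[mb bfin] := ib.
pose F (w : X * X) : \bar R := (b w.1 * (a w.2 * K (transl (- (w.1 : E)) w.2)))%:E.
have mKd : measurable_fun setT (fun w : X * X => K (transl (- (w.1 : E)) w.2)).
  apply: measurableT_comp mK _.
  rewrite (_ : (fun _ => _) = (fun zy : X * X => (zy.1 + zy.2 : E) : X) \o
      (fun w : X * X => (w.2, (- (w.1 : E) : E) : X))); last by [].
  apply: measurableT_comp (@measurable_addE R N) _.
  apply/measurable_fun_pairP; split; first exact: measurable_snd.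
  exact: measurableT_comp (@measurable_oppE R N) measurable_fst.
have mF : measurable_fun setT F.
  apply/measurable_EFinP; apply: measurable_funM.
    exact: measurableT_comp mb measurable_fst.
  by apply: measurable_funM => //; exact: measurableT_comp ma measurable_snd.
have iF : (mu \x mu)%E.-integrable setT F.
  apply/(@integrable12ltyP _ _ _ _ R mu mu _ mF).
  apply: (@le_lt_trans _ _ (\int[mu]_z ((`|M|%:E * nrm1 mu a) * (`|b z|)%:E))%E).
    apply: ge0_le_integral => //.
    - by move=> z _; exact: integral_ge0.
    - apply: (measurable_fun_fubini_tonelli_F (abse \o F)).
        exact: measurableT_comp.
      by move=> w; exact: abse_ge0.
    - by apply: measurable_funeM; exact: measurable_normE.
    move=> z _; rewrite -nrm1Z// muleC -ge0_integralZl//; last first.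
      by apply: measurable_normE; exact: measurable_funM.
    apply: ge0_le_integral => //.
    - apply: measurableT_comp => //; exact: measurableT_comp mF (measurable_pair1 z).
    - by apply: measurable_funeM; apply: measurable_normE; exact: measurable_funM.
    move=> y _; rewrite /F /= -EFinM lee_fin !normrM ler_wpM2l// mulrC.
    rewrite ler_wpM2r//; exact: le_trans (KM _) (ler_norm _).
  rewrite ge0_integralZl//; [|exact: measurable_normE|by rewrite mule_ge0 ?nrm1_ge0].
  rewrite -/(nrm1 mu b) lte_mul_pinfty//.
  - by rewrite mule_ge0 ?nrm1_ge0.
  - by rewrite fin_numM// ge0_fin_numE ?nrm1_ge0.
have := @Fubini _ _ _ _ R mu mu F iF.
have iaK z0 : integ mu (fun z => a z * K (transl (- (z0 : E)) z)).
  rewrite (_ : (fun _ => _) = fun z => translate (- (z0 : E)) K z * a z); last first.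
    by apply/funext => z; rewrite mulrC.
  apply: (@integM_bdd _ _ _ _ _ _ M) => //; first exact: measurable_shift_fun.
  by move=> z; exact: KM.
have ibK z : integ mu (fun z0 => b z0 * K (transl (- (z0 : E)) z)).
  rewrite (_ : (fun _ => _) = fun z0 => K (transl (- (z0 : E)) z) * b z0); last first.
    by apply/funext => z0; rewrite mulrC.
  apply: (@integM_bdd _ _ _ _ _ _ M) => //.
  exact: measurableT_comp mKd (measurable_pair2 z).
move=> /(congr1 fine) FF; rewrite /Rintegral; transitivity (fine
    (\int[mu]_x \int[mu]_y F (x, y))%E).
  congr fine; apply: eq_integral => z0 _; rewrite /F /=.
  by rewrite (EFin_RintZ _ (iaK z0)).
rewrite FF; congr fine; apply: eq_integral => z _; rewrite /F /=.
rewrite (EFin_RintZ _ (ibK z)).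
by apply: eq_integral => z0 _; rewrite mulrCA.
Qed.

End approximate_identity.

(** * Translations in duality *)

(** Young's inequality for [s / l] and [l * t], with [l ^ p = k]. *)
Lemma young_eps (R : realType) (p q k : R) : 0 < p -> 0 < q -> q^-1 + p^-1 = 1 ->
  0 < k -> exists2 C : R, 0 < C &
  forall s t : R, 0 <= s -> 0 <= t -> s * t <= C * s `^ q + k * t `^ p.
Proof.
move=> p0 q0 pq k0; pose l := k `^ p^-1; have l0 : 0 < l by rewrite powR_gt0.
have lp : l `^ p = k by rewrite /l -powRrM mulVf ?gt_eqF// powRr1// ltW.
have p1 : p^-1 <= 1 by rewrite -pq lerDr invr_ge0 ltW.
have q1 : q^-1 <= 1 by rewrite -pq lerDl invr_ge0 ltW.
exists (l^-1 `^ q); first by rewrite powR_gt0 ?invr_gt0.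
move=> s t s0 t0.
have -> : s * t = (l^-1 * s) * (l * t) by field; rewrite gt_eqF.
have l0' := ltW l0; have il0 : 0 <= l^-1 by rewrite invr_ge0.
apply: le_trans (conjugate_powR _ _ q0 p0 pq) _; rewrite ?mulr_ge0//.
rewrite !powRM// lp.
apply: lerD; rewrite ler_piMr ?mulr_ge0 ?powR_ge0//.
exact: ltW.
Qed.

Section dual_pair.
Context (R : realType) (N : nat).
Local Notation E := ('rV[R]_N * R)%type.
Local Notation X := ('rV[R]_N * measurableTypeR R)%type.
Local Notation mu := (lam R N).
Variables (A g : X -> R) (p q : R).
Hypotheses (p0 : 0 < p) (q0 : 0 < q) (pq : q^-1 + p^-1 = 1).
Hypotheses (iA : integ mu A) (ig : integ mu g).
Hypotheses (iAq : integ mu (fun z => `|A z| `^ q)).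
Hypotheses (igp : integ mu (fun z => `|g z| `^ p)).

Lemma integ_dual_mul : integ mu (fun z => A z * g z).
Proof.
have /integP[mA _] := iA; have /integP[mg _] := ig.
have [C C0 CY] := young_eps p0 q0 pq ltr01.
apply: (@integ_le _ _ _ _ _ (fun z => C * `|A z| `^ q + 1 * `|g z| `^ p)).
- exact: measurable_funM.
- by apply: integD; exact: integZ.
- by move=> z; rewrite normrM (le_trans (CY _ _ _ _))// ler_norm.
Qed.

(** Continuity of translations of [A] in the dual exponent, tested on [g].
    Where [A] and [g] are bounded this is continuity in mean; the part of [A]
    above a large height is absorbed by Young's inequality into a small part
    of its power of exponent [q]. *)
Lemma shift_dual_mul (e : R) : 0 < e -> exists2 d : R, 0 < d &
  forall y : E, `|y| < d ->
    (nrm1 mu (fun z => (translate y A z - A z) * g z)%R <= e%:E)%E.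
Proof.
move=> e0; have /integP[mA _] := iA; have /integP[mg _] := ig.
have e4 : 0 < e / 4 by rewrite divr_gt0.
have /integP[mgp gpoo] := igp; have /integP[mAq Aqoo] := iAq.
pose G := fine (nrm1 mu (fun z => `|g z| `^ p)%R).
have GE : nrm1 mu (fun z => `|g z| `^ p)%R = G%:E.
  exact: (esym (nrm1_fineK igp)).
have G0 : 0 <= G by rewrite -lee_fin -GE nrm1_ge0.
pose k := e / 4 / (2 * (G + 1)).
have k0 : 0 < k by rewrite divr_gt0// mulr_gt0// ltr_wpDl.
have [C C0 CY] := young_eps p0 q0 pq k0.
have tail (f : X -> R) : measurable_fun setT f ->
    (forall m, measurable [set z : X | m%:R < `|f z|]) /\
    (forall z, exists k0, forall k, (k0 <= k)%N -> ~ [set z : X | k%:R < `|f z|] z).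
  move=> mf; split.
    move=> m; have mnf : measurable_fun setT (fun z => `|f z|) by exact: measurableT_comp.
    have := mnf measurableT `]m%:R, +oo[%classic (measurable_itv _).
    by rewrite setTI preimage_itvoy.
  move=> z; exists (Num.trunc `|f z|).+1 => m zm /=; apply/negP; rewrite -leNgt.
  by rewrite (le_trans (ltW (truncnS_gt _)))// ler_nat.
have [mPA PA] := tail _ mA; have [mPg Pg] := tail _ mg.
have [M MA] := nrm1_tail iAq mPA PA (divr_gt0 e4 (mulr_gt0 (ltr0Sn R 1) C0)).
have {MA} := MA _ (leqnn _).
set P := [set z | _] => MA.
have mP : measurable P := mPA M.
have M10 : 0 < 2 * (M%:R + 1) :> R by rewrite mulr_gt0// ltr_wpDl.
have [L Lg] := nrm1_tail ig mPg Pg (divr_gt0 e4 M10).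
have {Lg} := Lg _ (leqnn _).
set Q := [set z | _] => Lg.
have mQ : measurable Q := mPg L.
pose At z : R := \1_P z * A z.
pose Am z : R := \1_(~` P) z * A z.
have mAt : measurable_fun setT At.
  by apply: measurable_funM => //; exact: measurable_indic.
have mAm : measurable_fun setT Am.
  by apply: measurable_funM => //; apply: measurable_indic; exact: measurableC.
have iAm : integ mu Am.
  apply: integ_le mAm iA _ => z; rewrite /Am indicE.
  by case: (_ \in _); rewrite ?mul1r// mul0r normr0.
have AmM z : `|Am z| <= M%:R.
  rewrite /Am indicE; have [zP|] := boolP (z \in ~` P).
    by rewrite mul1r leNgt; apply/negP; move: zP; rewrite inE.
  by rewrite mul0r normr0.
have AE z : A z = Am z + At z.
  by rewrite /Am /At !indicE in_setC; case: (_ \in _); rewrite mul0r mul1r ?add0r ?addr0.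
have L10 : 0 < L%:R + 1 :> R by rewrite ltr_wpDl.
have [d d0 dA] := tcont_integ iAm (divr_gt0 e4 L10).
exists d => // y /dA{}dA.
have msA (f : X -> R) : measurable_fun setT f -> measurable_fun setT (translate y f).
  exact: measurable_shift_fun.
have mAtq : measurable_fun setT (fun z => C * `|At z| `^ q).
  apply: measurable_funM => //.
  by apply: (@measurableT_comp _ _ _ _ _ _ (@powR R ^~ q)) => //; exact: measurableT_comp.
have mB2 f : measurable_fun setT f -> measurable_fun setT (fun z : X => translate y f z - f z).
  by move=> mf; apply: measurable_funB => //; exact: msA.
pose f1 z := (L%:R + 1) * (translate y Am z - Am z).
pose f2 z := 2 * (M%:R + 1) * (\1_Q z * g z).
pose f3 z := C * `|At z| `^ q.
pose f4 z := 2 * k * `|g z| `^ p.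
have mf1 : measurable_fun setT f1 by apply: measurable_funM => //; exact: mB2.
have mf2 : measurable_fun setT f2.
  by apply: measurable_funM => //; apply: measurable_funM => //; exact: measurable_indic.
have mf4 : measurable_fun setT f4 by exact: measurable_funM.
have pwAt z : `|At z| `^ q = `|\1_P z * (`|A z| `^ q)|.
  rewrite /At indicE; case: (_ \in _).
    by rewrite !mul1r [RHS]ger0_norm ?powR_ge0.
  by rewrite !mul0r normr0 powR0// gt_eqF.
have n3 : (nrm1 mu f3 <= (e / 4 / 2)%:E)%E.
  rewrite nrm1Z; last first.
    by apply: (@measurableT_comp _ _ _ _ _ _ (@powR R ^~ q)) => //; exact: measurableT_comp.
  rewrite gtr0_norm//.
  have -> : nrm1 mu (fun z => `|At z| `^ q)%R = nrm1 mu (fun z => \1_P z * (`|A z| `^ q))%R.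
    by apply: eq_integral => z _; rewrite pwAt normr_id.
  apply: (@le_trans _ _ (C%:E * (e / 4 / (2 * C))%:E)%E).
    by apply: lee_wpmul2l; [rewrite lee_fin ltW|exact: MA].
  by rewrite -EFinM lee_fin le_eqVlt; apply/orP; left; apply/eqP; field; rewrite gt_eqF.
have mf3 : measurable_fun setT f3 := mAtq.
have mff : measurable_fun setT (fun z => (translate y A z - A z) * g z).
  by apply: measurable_funM => //; exact: mB2.
apply: le_trans (@nrm1_le_sum _ _ _ mu _ [:: f1; f2; translate y f3; f3; f4] mff _ _) _.
- by move=> [|[|[|[|[|i]]]]] /=; rewrite ?nth_nil//; exact: msA.
- move=> z; rewrite !big_cons big_nil addr0.
  have -> : (translate y A z - A z) * g z = (translate y Am z - Am z) * g z +
     (translate y At z * g z - At z * g z).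
    by rewrite /translate !AE; ring.
  apply: le_trans (ler_normD _ _) _.
  have h1 : `|(translate y Am z - Am z) * g z| <= `|f1 z| + `|f2 z|.
    rewrite /f1 /f2 indicE; have [zQ|zQ] := boolP (z \in Q).
      rewrite mul1r ler_wpDl// !normrM ler_wpM2r//.
      rewrite (le_trans (ler_normB _ _))// -normrM [leRHS]ger0_norm ?mulr_ge0 ?addr_ge0//.
      have h0 := AmM z; have h1 := AmM (transl y z).
      rewrite mulrDr mulr1 ler_wpDr// mulr_natl mulr2n; exact: lerD.
    rewrite mul0r mulr0 normr0 addr0 !normrM mulrC ler_wpM2r//.
    rewrite [leRHS]ger0_norm ?addr_ge0// ler_wpDr//.
    by rewrite leNgt; apply: contra zQ => zQ; rewrite inE.
  have h2 : `|translate y At z * g z - At z * g z| <= `|translate y f3 z| + (`|f3 z| + `|f4 z|).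
    rewrite (le_trans (ler_normB _ _))// (normrM (translate y At z)) (normrM (At z)).
    have y1 := CY _ _ (normr_ge0 (translate y At z)) (normr_ge0 (g z)).
    have y2 := CY _ _ (normr_ge0 (At z)) (normr_ge0 (g z)).
    rewrite (le_trans (lerD y1 y2))//.
    have f30 x : 0 <= f3 x by rewrite /f3 mulr_ge0 ?powR_ge0 ?ltW.
    have f40 : 0 <= f4 z.
      by apply: mulr_ge0; [apply: mulr_ge0 => //; exact: ltW|exact: powR_ge0].
    rewrite (ger0_norm (f30 (transl y z))) (ger0_norm (f30 z)) (ger0_norm f40).
    rewrite /f3 /f4 /translate le_eqVlt; apply/orP; left; apply/eqP; ring.
  by rewrite addrA; exact: lerD.
have -> : e = e / 4 + (e / 4 + (e / 4 / 2 + (e / 4 / 2 + e / 4))) by field.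
rewrite !big_cons big_nil adde0 !EFinD; apply: leeD.
  rewrite nrm1Z; last exact: mB2.
  apply: (@le_trans _ _ (`|L%:R + 1|%:E * (e / 4 / (L%:R + 1))%:E)%E).
    by apply: lee_wpmul2l; rewrite ?lee_fin.
  rewrite -EFinM lee_fin gtr0_norm// le_eqVlt; apply/orP; left; apply/eqP; field.
  by rewrite gt_eqF.
apply: leeD.
  rewrite nrm1Z; last by apply: measurable_funM => //; exact: measurable_indic.
  apply: (@le_trans _ _ (`|2 * (M%:R + 1)|%:E * (e / 4 / (2 * (M%:R + 1)))%:E)%E).
    by apply: lee_wpmul2l; [rewrite lee_fin|exact: Lg].
  rewrite -EFinM lee_fin gtr0_norm// le_eqVlt; apply/orP; left; apply/eqP; field.
  by rewrite gt_eqF// ltr_wpDl.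
apply: leeD; first by rewrite nrm1_shift.
apply: leeD => //.
have k20 : 0 < 2 * k by exact: mulr_gt0.
rewrite nrm1Z// GE -EFinM lee_fin gtr0_norm// /k.
rewrite (_ : 2 * _ * G = e / 4 * (G / (G + 1))); last first.
  by field; rewrite gt_eqF// ltr_wpDl.
have G1 : 0 < G + 1 by rewrite ltr_wpDl.
by apply: ler_piMr; [exact: ltW|rewrite ler_pdivrMr// mul1r lerDl].
Qed.

End dual_pair.

(** * Smooth bumps of one variable *)

Section bump.
Context (R : realType).
Implicit Types (P Q : {poly R}) (t x : R).

(** For [P = 1] this is the exponential of [- 1 / t], continued by zero. *)
Definition flat P t : R := if 0 < t then P.[t^-1] * expR (- t^-1) else 0.

Lemma expRN_le (n : nat) x : 0 < x -> expR (- x) <= n%:R ^+ n / x ^+ n.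
Proof.
move=> x0; case: n => [|n]; first by rewrite !expr0 divr1 expR_le1 oppr_le0 ltW.
rewrite expRN -[leRHS]invrK lef_pV2 ?posrE ?expR_gt0 ?invr_gt0 ?divr_gt0 ?exprn_gt0//.
have -> : expR x = expR (x / n.+1%:R) ^+ n.+1.
  by rewrite -expRM_natl mulrCA divff// mulr1.
rewrite invf_div -expr_div_n lerXn2r ?nnegrE ?divr_ge0 ?expR_ge0// ?ltW//.
by rewrite (lt_le_trans _ (expR_ge1Dx _))// ltrDr.
Qed.

Lemma horner_bound P x : 1 <= x ->
  `|P.[x]| <= (\sum_(i < size P) `|P`_i|) * x ^+ size P.
Proof.
move=> x1; rewrite horner_coef mulr_suml (le_trans (ler_norm_sum _ _ _))//.
apply: ler_sum => i _; rewrite normrM ler_wpM2l// ger0_norm.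
  by rewrite ler_weXn2l// ltnW.
by rewrite exprn_ge0// (le_trans ler01).
Qed.

Lemma flat_le_sqr P : exists C : R, forall t, `|t| <= 1 -> `|flat P t| <= C * t ^+ 2.
Proof.
pose n := size P; pose S := \sum_(i < n) `|P`_i|.
have S0 : 0 <= S by exact: sumr_ge0.
exists (S * n.+2%:R ^+ n.+2) => t t1; rewrite /flat; case: ifPn => [t0|_]; last first.
  by rewrite normr0 mulr_ge0 ?sqr_ge0// mulr_ge0// exprn_ge0.
have it : 1 <= t^-1 by rewrite invf_ge1// (le_trans (ler_norm _)).
have t'0 : 0 < t^-1 by rewrite invr_gt0.
rewrite normrM (ger0_norm (expR_ge0 _)).
apply: le_trans (ler_pM _ _ (horner_bound P it) (expRN_le n.+2 t'0)) _ => //.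
rewrite -/n -/S le_eqVlt; apply/orP; left; apply/eqP.
rewrite !exprVn invrK (exprS t n.+1) (exprS t n); field; rewrite expf_eq0 negb_and.
by rewrite gt_eqF// orbT.
Qed.

Lemma is_derive_inv t : 0 < t -> is_derive t (1 : R) (@GRing.inv R) (- t ^- 2).
Proof.
move=> t0; apply: (@is_derive_eq _ _ _ _ _ _ _ _
  (is_deriveV (f := id) (lt0r_neq0 t0) (is_derive_id t 1))).
by rewrite /GRing.scale/= mulr1.
Qed.

(** All derivatives of [flat P] are of the same form, which is why
    polynomial factors are carried along. *)
Lemma is_derive_flat P t : is_derive t (1 : R) (flat P) (flat ('X^2 * (P - P^`())) t).
Proof.
have [t0|t0|<-] := ltgtP 0 t.
- rewrite [flat _ t]/flat t0.
  apply: (@near_eq_is_derive _ _ _ (fun x => P.[x^-1] * expR (- x^-1))).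
    by near=> x; rewrite /flat ifT//; near: x; exact: lt_nbhsr.
  rewrite (_ : (fun x => _) = (horner P \o @GRing.inv R) * (expR \o (- @GRing.inv R))); last first.
    by apply/funext => x.
  have d1 := is_derive1_comp (g := @GRing.inv R) (is_derive_poly P t^-1) (is_derive_inv t0).
  have d2 := is_derive1_comp (g := - @GRing.inv R) (is_derive_expR (- t^-1))
    (is_deriveN (is_derive_inv t0)).
  apply: (is_derive_eq (is_deriveM d1 d2)).
  rewrite !hornerE /= -!exprVn /GRing.scale/=; ring.
- rewrite [flat _ t]/flat ltNge ltW//=.
  apply: (@near_eq_is_derive _ _ _ (cst (0 : R))).
    by near=> x; rewrite /flat ifF//; apply/negbTE; rewrite -leNgt ltW//; near: x; exact: lt_nbhsl.
have [C CP] := flat_le_sqr P.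
have fP0 Q : flat Q 0 = 0 by rewrite /flat ltxx.
rewrite fP0.
have d0 : h^-1 *: ((flat P \o shift 0) (h *: 1) - flat P 0) @[h --> 0^'] --> (0 : R).
  apply/cvgrPdist_le => e e0; near=> h.
  rewrite /= fP0 subr0 addr0 sub0r normrN /GRing.scale/= mulr1.
  have h1 : `|h| <= 1.
    by near: h; apply: dnbhs0_le.
  have hC : `|h| <= e / (`|C| + 1).
    by near: h; apply: dnbhs0_le; rewrite divr_gt0// ltr_wpDl.
  have h0 : h != 0 by near: h; exact: nbhs_dnbhs_neq.
  rewrite normrM normfV ler_pdivrMl ?normr_gt0// (le_trans (CP _ h1))//.
  rewrite -(real_normK (num_real h)) expr2 mulrCA ler_wpM2l//.
  rewrite ler_pdivlMr ?ltr_wpDl// in hC; rewrite (le_trans _ hC)// mulrC ler_wpM2l//.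
  by rewrite (le_trans (ler_norm C))// lerDl.
apply: DeriveDef; first by apply/cvg_ex; exists 0.
exact: cvg_lim d0.
Unshelve. all: by end_near. Qed.

End bump.

Section bump1D.
Context (R : realType).
Local Notation leb := (@lebesgue_measure R).
Implicit Types (t x r : R).

Lemma flat1_ge0 t : 0 <= flat (1 : {poly R}) t.
Proof. by rewrite /flat; case: ifP => // _; rewrite hornerC mul1r expR_ge0. Qed.

Lemma flat1_le1 t : flat (1 : {poly R}) t <= 1.
Proof.
rewrite /flat; case: ifP => // t0.
by rewrite hornerC mul1r expR_le1 oppr_le0 invr_ge0 ltW.
Qed.

Lemma flat1_eq0 t : t <= 0 -> flat (1 : {poly R}) t = 0.
Proof. by move=> t0; rewrite /flat ltNge t0. Qed.

Lemma flat1_le : {homo flat (1 : {poly R}) : x y / x <= y}.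
Proof.
move=> x y xy; have [x0|x0] := leP x 0; first by rewrite flat1_eq0// flat1_ge0.
have y0 := lt_le_trans x0 xy.
by rewrite /flat x0 y0 !hornerC !mul1r ler_expR lerN2 lef_pV2.
Qed.

Lemma flat1_gt0 t : 0 < t -> 0 < flat (1 : {poly R}) t.
Proof. by move=> t0; rewrite /flat t0 hornerC mul1r expR_gt0. Qed.

Lemma continuous_flat (P : {poly R}) : continuous (flat P).
Proof.
move=> t; apply: differentiable_continuous; apply/derivable1_diffP.
by have [] := is_derive_flat P t.
Qed.

Definition hat r t := flat 1 (1 - r^-1 * t) * flat (1 : {poly R}) (1 + r^-1 * t).

Lemma hat_ge0 r t : 0 <= hat r t.
Proof. by rewrite mulr_ge0 ?flat1_ge0. Qed.

Lemma hat_le1 r t : hat r t <= 1.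
Proof. by rewrite mulr_ile1 ?flat1_ge0 ?flat1_le1. Qed.

Lemma hat_supp r t : 0 < r -> hat r t != 0 -> `|t| < r.
Proof.
move=> r0; rewrite /hat mulf_eq0 negb_or => /andP[h1 h2]; rewrite ltr_norml.
apply/andP; split; rewrite ltNge; apply/negP => tr.
  move: h2; rewrite flat1_eq0 ?eqxx// -lerBrDl sub0r mulrC ler_pdivrMr//.
  by rewrite mulN1r.
by move: h1; rewrite flat1_eq0 ?eqxx// lerBlDl addr0 mulrC ler_pdivlMr// mul1r.
Qed.

Lemma hat_ge r t : 0 < r -> `|t| <= r / 2 ->
  flat (1 : {poly R}) (1 / 2) ^+ 2 <= hat r t.
Proof.
move=> r0; rewrite ler_norml => /andP[t1 t2].
have h1 : r^-1 * t <= 1 / 2 by rewrite (mulrC r^-1) ler_pdivrMr//; lra.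
have h2 : - (1 / 2) <= r^-1 * t by rewrite (mulrC r^-1) ler_pdivlMr//; lra.
by rewrite expr2 ler_pM ?flat1_ge0//; apply: flat1_le; lra.
Qed.

Lemma continuous_hat r : continuous (hat r).
Proof.
have cl (c : R) : continuous (fun t : R => 1 + c * t).
  move=> t; apply: cvgD; first exact: cvg_cst.
  by apply: cvgM; [exact: cvg_cst|exact: cvg_id].
have cf (c : R) : continuous (fun t : R => flat (1 : {poly R}) (1 + c * t)).
  move=> t; apply: (continuous_comp (f := fun t : R => 1 + c * t)); first exact: cl.
  exact: continuous_flat.
rewrite (_ : hat r = fun t => flat 1 (1 + - r^-1 * t) * flat 1 (1 + r^-1 * t)).
  by move=> t; apply: cvgM; exact: cf.
by apply/funext => t; rewrite /hat mulNr.
Qed.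

Lemma integral_itv_indic (a b : R) (x y : bool) : a <= b ->
  (\int[leb]_t (\1_[set` Interval (BSide x a) (BSide y b)] t)%:E = (b - a)%:E)%E.
Proof.
move=> ab; rewrite integral_indic// setIT.
transitivity (leb [set` Interval (BSide x a) (BSide y b)]) => //.
rewrite lebesgue_measure_itv/= lte_fin -EFinB; case: ltP => // ba.
by rewrite (@le_anti _ _ a b) ?ab// subrr.
Qed.

Lemma hat_mass r : 0 < r -> exists2 c : R, 0 < c &
  (\int[leb]_t (c * hat r t)%:E = 1)%E.
Proof.
move=> r0; have mh : measurable_fun setT (hat r : measurableTypeR R -> R).
  exact: continuous_measurable_fun (@continuous_hat r).
have h0 t : (0 <= (hat r t)%:E)%E by rewrite lee_fin hat_ge0.
pose I := (\int[leb]_t (hat r t)%:E)%E.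
pose d := flat (1 : {poly R}) (1 / 2) ^+ 2.
have d0 : 0 < d by rewrite exprn_gt0// flat1_gt0// divr_gt0.
have Igt : (0 < I)%E.
  apply: (@lt_le_trans _ _ (\int[leb]_t (d * \1_(`[- (r / 2), r / 2]%classic) t)%:E)%E).
    under eq_integral do rewrite EFinM.
    rewrite ge0_integralZl ?lee_fin ?ltW//; last exact/measurable_EFinP/measurable_indic.
    rewrite integral_itv_indic; last by lra.
    by rewrite -EFinM lte_fin mulr_gt0//; lra.
  apply: ge0_le_integral => //.
  - by move=> t _; rewrite lee_fin mulr_ge0// ltW.
  - by apply/measurable_EFinP; apply: measurable_funM => //; exact: measurable_indic.
  - exact/measurable_EFinP.
  move=> t _; rewrite lee_fin indicE; case: (boolP (_ \in _)) => [|_].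
    by rewrite inE/= in_itv/= -ler_norml mulr1 => /(hat_ge r0).
  by rewrite mulr0 hat_ge0.
have Ioo : (I < +oo)%E.
  apply: (@le_lt_trans _ _ (\int[leb]_t (\1_(`[- r, r]%classic) t)%:E)%E).
    apply: ge0_le_integral => //.
    - exact/measurable_EFinP.
    - exact/measurable_EFinP/measurable_indic.
    move=> t _; rewrite lee_fin indicE; case: (boolP (_ \in _)) => [_|tr].
      exact: hat_le1.
    have [->//|/(hat_supp r0) tr'] := eqVneq (hat r t) 0.
    by move/negP : tr; case; rewrite inE/= in_itv/= -ler_norml ltW.
  by rewrite integral_itv_indic ?ltry//; lra.
have If : I \is a fin_num by rewrite ge0_fin_numE// ltW.
have fI : 0 < fine I by rewrite fine_gt0// Igt.
exists (fine I)^-1; first by rewrite invr_gt0.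
under eq_integral do rewrite EFinM.
rewrite ge0_integralZl ?lee_fin ?invr_ge0 ?ltW//; last exact/measurable_EFinP.
by rewrite -/I -[X in (_ * X)%E](fineK If) -EFinM mulVf// gt_eqF.
Qed.

(** The function [a] is the mean of [b] over a window of length [l]. Its
    derivative is a difference quotient, so that testing with [a] needs no
    derivative of the unknown. *)
Lemma window_average (b : R -> R) (r l M : R) : 0 < l -> continuous b ->
  (forall t, 0 <= b t <= M) -> (forall t, b t != 0 -> `|t| < r) ->
  (\int[leb]_t (b t)%:E = 1)%E ->
  exists a : R -> R, [/\ forall t, 0 <= a t <= M,
    forall t, a t != 0 -> `|t| < r + l,
    (\int[leb]_t (a t)%:E = 1)%E &
    forall t, is_derive t (1 : R) a ((b (t + l) - b t) / l)].
Proof.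
move=> l0 cb bM br b1.
have mb : measurable_fun setT (b : measurableTypeR R -> R).
  exact: continuous_measurable_fun.
have b0 t : 0 <= b t by have /andP[] := bM t.
have ib : leb.-integrable setT (EFin \o b).
  apply/integrableP; split; first exact/measurable_EFinP.
  rewrite (_ : (\int[leb]_x _)%E = 1%E) ?ltry// -b1.
  by apply: eq_integral => t _ /=; rewrite ger0_norm.
have ibS (A : set (measurableTypeR R)) : measurable A -> leb.-integrable A (EFin \o b).
  by move=> mA; apply: integrableS ib.
pose B x := \int[leb]_(t in `]-oo, x]) b t.
pose a x := (B (x + l) - B x) / l.
have aE x : a x = (\int[leb]_(t in `]x, (x + l)]) b t) / l.
  rewrite /a /B Rintegral_itvB//; last by rewrite bnd_simp lerDl ltW.
  exact: ibS.
have a0 x : 0 <= a x by rewrite aE; apply: divr_ge0; [exact: Rintegral_ge0|exact: ltW].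
have lebI x : leb `]x, (x + l)] = l%:E.
  by rewrite lebesgue_measure_itv/= lte_fin ltrDl l0 -EFinB addrAC subrr add0r.
have dB x : is_derive x (1 : R) B (b x).
  have [//| |//| |dB Bb] := @continuous_FTC1 R b -oo%O x (x + 1).
  - by rewrite ltrDl.
  - exact: ibS.
  - by rewrite ltNyr.
  - exact: cb.
  by apply: (DeriveDef dB); rewrite -derive1E; exact: Bb.
exists a; split.
- move=> x; rewrite a0 aE /= ler_pdivrMr//.
  rewrite -(_ : \int[leb]_(t in `]x, (x + l)]) M = M * l); last first.
    by rewrite Rintegral_cst//= lebI.
  apply: le_Rintegral => //; first exact: ibS.
    have mI : measurable (`]x, (x + l)]%classic : set (measurableTypeR R)).
      exact: measurable_itv.
    apply: (@measurable_bounded_integrable _ _ _ leb (cst M) _ mI).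
    - by rewrite [X in (X < _)%E]lebI ltry.
    - exact: measurable_cst.
    - by exists `|M|; split=> // m Mm t _ /=; exact: ltW.
  by move=> t _; have /andP[] := bM t.
- move=> x; apply: contraNT; rewrite -leNgt => rx; apply/eqP.
  rewrite aE (_ : \int[leb]_(t in _) _ = 0) ?mul0r//.
  rewrite /Rintegral integral0_eq// => t; rewrite /= in_itv/= => /andP[xt tx].
  congr EFin; apply/eqP/negPn/negP => /br; rewrite ltr_norml => /andP[t1 t2].
  have : `|x| < r + l by rewrite ltr_norml; apply/andP; split; lra.
  by rewrite ltNge rx.
- pose D : set (measurableTypeR R * measurableTypeR R) :=
    [set w | (w.1 < w.2) && (w.2 <= w.1 + l)].
  pose F (w : measurableTypeR R * measurableTypeR R) : \bar R :=
    (\1_D w * (b w.2 / l))%:E.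
  have mD : measurable D.
    have m1 : measurable_fun setT (fun w : measurableTypeR R * measurableTypeR R => w.1 : R).
      exact: measurable_fst.
    have m2 : measurable_fun setT (fun w : measurableTypeR R * measurableTypeR R => w.2 : R).
      exact: measurable_snd.
    have m3 : measurable_fun setT (fun w : measurableTypeR R * measurableTypeR R => w.1 + l : R).
      exact: measurable_funD.
    have := measurable_and (measurable_fun_ltr m1 m2) (measurable_fun_ler m2 m3).
    move=> /(_ measurableT [set true]); rewrite setTI; apply => //.
  have mF : measurable_fun setT F.
    apply/measurable_EFinP; apply: measurable_funM; first exact: measurable_indic.
    by apply: measurable_funM => //; exact: measurableT_comp mb measurable_snd.
  have F0 w : (0 <= F w)%E by rewrite lee_fin mulr_ge0// divr_ge0// ltW.
  transitivity (\int[leb]_x \int[leb]_y F (x, y))%E.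
    apply: eq_integral => x _; rewrite aE -RintegralZr//; last exact: ibS.
    rewrite /Rintegral fineK; last first.
      apply: integrable_fin_num => //.
      by apply: (integrableZr _ _ (ibS _ _)).
    rewrite integral_mkcond; apply: eq_integral => y _; rewrite patchE /F indicE.
    have -> : (y \in [set` `]x, (x + l)]]) = ((x, y) \in D).
      by apply/idP/idP => /set_mem h; apply/mem_set; move: h; rewrite /D /= in_itv.
    by case: (_ \in _); rewrite ?mul1r// mul0r.
  rewrite fubini_tonelli// -b1; apply: eq_integral => y _.
  transitivity (\int[leb]_x ((b y / l)%:E * (\1_(`[(y - l)%R, y[%classic) x)%:E))%E.
    apply: eq_integral => x _; rewrite /F /= mulrC -EFinM; congr (_ * _)%:E.
    rewrite !indicE.
    have -> // : ((x, y) \in D) = (x \in (`[(y - l)%R, y[%classic : set R)).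
    by apply/idP/idP => /set_mem h; apply/mem_set; move: h;
      rewrite /D /= in_itv/= lerBlDr andbC.
  have bl0 : (0 <= (b y / l)%:E)%E by rewrite lee_fin divr_ge0// ltW.
  rewrite ge0_integralZl//; last first.
    by apply/measurable_EFinP/measurable_indic; exact: measurable_itv.
  rewrite integral_itv_indic; last by rewrite lerBlDr lerDl ltW.
  by rewrite -EFinM opprB addrC subrK divfK// gt_eqF.
move=> x; have dl : is_derive x (1 : R) (fun t : R => t + l) 1.
  apply: (is_derive_eq (is_deriveD (is_derive_id x 1) (is_derive_cst l x 1))).
  by rewrite addr0.
have d1 := is_derive1_comp (f := B) (g := fun t : R => t + l) (dB (x + l)) dl.
have -> : a = l^-1 \*: ((B \o (fun t : R => t + l)) - B).
  by apply/funext => t; rewrite /a /GRing.scale/= mulrC.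
apply: (is_derive_eq (is_deriveZ l^-1 (is_deriveB d1 (dB x)))).
by rewrite /GRing.scale/= mulr1 mulrC.
Qed.

End bump1D.

(** * A class of smooth functions and its kernels *)

Section smooth_class.
Context (R : realType) (N : nat).
Local Notation E := ('rV[R]_N * R)%type.
Local Notation X := ('rV[R]_N * measurableTypeR R)%type.
Local Notation mu := (lam R N).

(** A class generated by rules that are all stable under directional
    derivatives, so that its members are smooth. The rule [sm_prim] accepts a
    function of one coordinate through its derivative; it is there for the
    window averages of bumps, which have no closed form. *)
Inductive sm : (E -> R) -> Prop :=
| sm_cst c : sm (cst c)
| sm_flat i (P : {poly R}) a b : sm (fun z => flat P (a * crd i z + b))
| sm_prim i (F f : R -> R) : (forall t, is_derive t (1 : R) F (f t)) ->
    sm (fun z => f (crd i z)) -> sm (fun z => F (crd i z))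
| sm_add f g : sm f -> sm g -> sm (fun z => f z + g z)
| sm_mul f g : sm f -> sm g -> sm (fun z => f z * g z).

Lemma diff_crd i z : differentiable (crd i : E -> R) z /\
  forall v, 'd (crd i : E -> R) z v = crd i v.
Proof.
have @L : {linear E -> R}.
  by exists (crd i); do 2![eexists]; do ?[constructor];
    rewrite ?crd0// => ? *; rewrite ?crdZ ?crdD//; move=> ?; rewrite !crdZ.
have cL : continuous L by exact: crd_continuous.
split; first exact: (linear_differentiable z cL).
by move=> v; rewrite (diff_lin z cL).
Qed.

Lemma diff_comp_crd i (F f : R -> R) : (forall t, is_derive t (1 : R) F (f t)) ->
  forall z, differentiable (fun z : E => F (crd i z)) z /\
    forall v, 'D_v (fun z : E => F (crd i z)) z = crd i v * f (crd i z).
Proof.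
move=> dF z; have [dc dcE] := diff_crd i z.
have dFz : differentiable F (crd i z).
  by apply/derivable1_diffP; have [] := dF (crd i z).
have dFc : differentiable (F \o (crd i : E -> R)) z by exact: differentiable_comp.
split; first exact: dFc.
move=> v; rewrite -/(F \o crd i) (deriveE v dFc) (diff_comp dc dFz) /= dcE (diff1E dFz).
by rewrite derive1E; have [_ ->] := dF (crd i z).
Qed.

Lemma is_derive_flat_affine (P : {poly R}) (a b t : R) :
  is_derive t (1 : R) (fun t => flat P (a * t + b))
    (a * flat ('X^2 * (P - P^`())) (a * t + b)).
Proof.
have dl : is_derive t (1 : R) (fun t : R => a * t + b) a.
  rewrite (_ : (fun t => _) = (a \*: (id : R -> R)) + cst b); last by apply/funext.
  apply: (is_derive_eq (is_deriveD (is_deriveZ a (is_derive_id t 1)) (is_derive_cst b t 1))).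
  by rewrite addr0 /GRing.scale/= mulr1.
apply: (is_derive_eq (is_derive1_comp (f := flat P) (g := fun t : R => a * t + b)
  (is_derive_flat P (a * t + b)) dl)).
by rewrite mulrC.
Qed.

Lemma sm_diff phi : sm phi ->
  (forall z, differentiable phi z) /\ forall v, sm ('D_v phi).
Proof.
elim => {phi} [c|i P a b|i F f dF sf IH|f g sf [df Df] sg [dg Dg]|f g sf [df Df] sg [dg Dg]].
- split=> [z|v]; first exact: differentiable_cst.
  rewrite (_ : 'D_v _ = cst 0); first exact: sm_cst.
  by apply/funext => z; exact: derive_cst.
- have h := diff_comp_crd i (is_derive_flat_affine P a b).
  split=> [z|v]; first by have [] := h z.
  rewrite (_ : 'D_v _ = fun z => cst (crd i v * a) z *
     (flat ('X^2 * (P - P^`())) (a * crd i z + b))).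
    by apply: sm_mul; [exact: sm_cst|exact: sm_flat].
  by apply/funext => z; have [_ ->] := h z; rewrite mulrA.
- have h := diff_comp_crd i dF.
  split=> [z|v]; first by have [] := h z.
  rewrite (_ : 'D_v _ = fun z => cst (crd i v) z * f (crd i z)).
    by apply: sm_mul => //; exact: sm_cst.
  by apply/funext => z; have [_ ->] := h z.
- split=> [z|v]; first exact: differentiableD.
  rewrite (_ : 'D_v _ = fun z => 'D_v f z + 'D_v g z); first exact: sm_add.
  by apply/funext => z; apply: (@deriveD _ _ _ f g); exact: diff_derivable.
- split=> [z|v]; first exact: differentiableM.
  rewrite (_ : 'D_v _ = fun z => f z * 'D_v g z + g z * 'D_v f z).
    by apply: sm_add; exact: sm_mul.
  by apply/funext => z; apply: (@deriveM _ _ f g); exact: diff_derivable.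
Qed.

Lemma sm_derivable phi z v : sm phi -> derivable phi z v.
Proof. by move=> /sm_diff[dphi _]; exact: diff_derivable. Qed.

Lemma sm_derive phi v : sm phi -> sm ('D_v phi).
Proof. by move=> /sm_diff[]. Qed.

Lemma sm_continuous phi : sm phi -> continuous phi.
Proof. by move=> /sm_diff[dphi _] z; exact: differentiable_continuous. Qed.

Lemma sm_smooth phi : sm phi -> smooth phi.
Proof.
move=> sphi s /=; set psi := foldr _ _ _.
have spsi : sm psi by rewrite /psi; elim: s {psi} => [//|v s IH] /=; exact: sm_derive.
by split; [exact: sm_continuous|move=> z v; exact: sm_derivable].
Qed.

Lemma sm_affine phi (a : R) (c : E) : sm phi -> sm (fun z => phi (a *: z + c)).
Proof.
elim => {phi} [k|i P a' b|i F f dF sf IH|f g sf IHf sg IHg|f g sf IHf sg IHg].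
- exact: sm_cst.
- rewrite (_ : (fun z => _) = fun z => flat P ((a' * a) * crd i z + (a' * crd i c + b))).
    exact: sm_flat.
  by apply/funext => z; congr flat; rewrite crdD crdZ; ring.
- rewrite (_ : (fun z => _) = fun z => (fun t => F (a * t + crd i c)) (crd i z)).
    apply: (@sm_prim i (fun t => F (a * t + crd i c)) (fun t => a * f (a * t + crd i c))).
      move=> t.
      have dl : is_derive t (1 : R) (fun t : R => a * t + crd i c) a.
        rewrite (_ : (fun t => _) = (a \*: (id : R -> R)) + cst (crd i c)); last by apply/funext.
        apply: (is_derive_eq (is_deriveD (is_deriveZ a (is_derive_id t 1)) (is_derive_cst _ t 1))).
        by rewrite addr0 /GRing.scale/= mulr1.
      apply: (is_derive_eq (is_derive1_comp (f := F) (g := fun t : R => a * t + crd i c)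
        (dF _) dl)).
      by rewrite mulrC.
    apply: (@sm_mul (cst a)); first exact: sm_cst.
    by move: IH; congr sm; apply/funext => z; rewrite crdD crdZ.
  by apply/funext => z; rewrite crdD crdZ.
- exact: sm_add.
- exact: sm_mul.
Qed.

Lemma sm_prod (I : Type) (s : seq I) (Q : pred I) (F : I -> E -> R) :
  (forall i, sm (F i)) -> sm (fun z => \prod_(i <- s | Q i) F i z).
Proof.
move=> sF; elim: s => [|i s IH].
  by rewrite (_ : (fun z => _) = cst 1); [exact: sm_cst|apply/funext => z; rewrite big_nil].
have [Qi|Qi] := boolP (Q i).
  rewrite (_ : (fun z => _) = fun z => F i z * \prod_(i <- s | Q i) F i z).
    exact: sm_mul.
  by apply/funext => z; rewrite big_cons Qi.
rewrite (_ : (fun z => _) = fun z => \prod_(i <- s | Q i) F i z)//.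
by apply/funext => z; rewrite big_cons (negbTE Qi).
Qed.

Lemma continuous_measurable_xt (phi : E -> R) : continuous phi ->
  measurable_fun setT (phi : X -> R).
Proof.
move=> cphi; apply: (measurability _ (RGenOInfty.measurableE R)) => //.
move=> _ [_ [x ->] <-]; rewrite setTI; apply: open_measurable_xt.
apply: (open_comp (f := phi) (D := `]x, +oo[%classic)); last exact: interval_open.
by move=> z _; exact: cphi.
Qed.

Lemma compact_box (c : E) (r : R) : compact [set z : E | forall i, `|crd i (z - c)| <= r].
Proof.
have -> : [set z : E | forall i, `|crd i (z - c)| <= r] =
  [set v : 'rV[R]_N | forall j, `[c.1 ord0 j - r, c.1 ord0 j + r]%classic (v ord0 j)] `*`
  `[c.2 - r, c.2 + r]%classic.
  apply/seteqP; split => -[v t] /=.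
    move=> h; split => [j|]; rewrite in_itv/= -ler_distlC distrC.
      by have := h (Some j); rewrite crdB.
    by have := h None; rewrite crdB.
  move=> [h1 h2] [j|]; rewrite crdB/= distrC ler_distlC.
    by have := h1 j; rewrite in_itv.
  by move: h2; rewrite in_itv.
apply: compact_setX; last exact: segment_compact.
by apply: (@rV_compact _ _ (fun j => `[c.1 ord0 j - r, c.1 ord0 j + r]%classic)) => j;
  exact: segment_compact.
Qed.

Lemma norm_crdP (z : E) (r : R) : 0 < r -> `|z| < r <-> forall i, `|crd i z| < r.
Proof.
move=> r0; have := @ball_crdP R N 0 z r r0.
by rewrite -ball_normE /= sub0r normrN subr0.
Qed.

Lemma test_function_box (D : set E) phi (c : E) (r : R) : sm phi ->
  (forall z, phi z != 0 -> forall i, `|crd i (z - c)| <= r) ->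
  (forall z, (forall i, `|crd i (z - c)| <= r) -> D z) ->
  test_function D phi.
Proof.
move=> sphi supp rD; pose B := [set z : E | forall i, `|crd i (z - c)| <= r].
have cB : compact B by exact: compact_box.
have clB : closed B by apply: compact_closed => //; exact: norm_hausdorff.
have sB : closure [set z | phi z != 0] `<=` B.
  rewrite ((closure_id B).1 clB); apply: closure_subset => z; exact: supp.
split; [exact: sm_smooth| |by move=> z /sB /rD].
by apply: subclosed_compact cB sB; exact: closed_closure.
Qed.

End smooth_class.

Section product_kernels.
Context (R : realType).
Local Notation leb := (@lebesgue_measure R).

Lemma measurable_prod_seq d (T : measurableType d) (I : Type) (s : seq I)
    (F : I -> T -> R) : (forall i, measurable_fun setT (F i)) ->
  measurable_fun setT (fun x => \prod_(i <- s) F i x).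
Proof.
move=> mF; elim: s => [|i s IH].
  by rewrite (_ : (fun x => _) = cst 1)//; apply/funext => x; rewrite big_nil.
rewrite (_ : (fun x => _) = fun x => F i x * \prod_(i <- s) F i x).
  exact: measurable_funM.
by apply/funext => x; rewrite big_cons.
Qed.

Lemma integral_prod_rV n (f : 'I_n -> R -> R) :
  (forall j, measurable_fun setT (f j : measurableTypeR R -> R)) ->
  (forall j t, 0 <= f j t) ->
  (forall j, \int[leb]_t (f j t)%:E = 1)%E ->
  (\int[@lebesgue_space R n]_v (\prod_j f j (v ord0 j))%:E = 1)%E.
Proof.
elim: n f => [|n IH] f mf f0 f1.
  rewrite (eq_integral (cst 1%E)); last by move=> v _; rewrite big_ord0.
  rewrite integral_cst// mul1e.
  transitivity ((\d_(0 : 'rV[R]_0)) [set: 'rV[R]_0] : \bar R); first by [].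
  by rewrite diracT.
have mG m (g : 'I_m -> R -> R) :
    (forall j, measurable_fun setT (g j : measurableTypeR R -> R)) ->
    measurable_fun setT (fun v : 'rV[R]_m => \prod_j g j (v ord0 j)).
  move=> mg; apply: measurable_prod_seq => j.
  exact: measurableT_comp (mg j) (@measurable_rV_coord R m j).
pose G (v : 'rV[R]_n.+1) : \bar R := (\prod_j f j (v ord0 j))%:E.
have mGE : measurable_fun setT G by apply/measurable_EFinP; exact: mG.
have G0 v : (0 <= G v)%E by rewrite lee_fin prodr_ge0.
pose m1 := (@lebesgue_measure R \x @lebesgue_space R n)%E.
transitivity (\int[pushforward m1 (@cons_rV R n)]_v G v)%E.
  pose M' : {measure set 'rV[R]_n.+1 -> \bar R} :=
    measure_function_pushforward__canonical__measure_function_Measure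
      m1 (@measurable_cons_rV R n).
  have -> : (\int[pushforward m1 (@cons_rV R n)]_v G v = \int[M']_v G v)%E by [].
  apply: eq_measure_integral => A mA _.
  have mcA : measurable (@cons_rV R n @^-1` A).
    by rewrite -[X in measurable X]setTI; exact: measurable_cons_rV.
  transitivity ((@lebesgue_measure R \x^ @lebesgue_space R n)%E
      (@cons_rV R n @^-1` A)); first by [].
  transitivity (m1 (@cons_rV R n @^-1` A)); last by [].
  apply/esym; apply: (product_measure_unique
    (m' := (@lebesgue_measure R \x^ @lebesgue_space R n)%E)) => // C D mC mD.
  exact: product_measure2E.
rewrite ge0_integral_pushforward//; last exact: measurable_cons_rV.
rewrite preimage_setT fubini_tonelli1; last 2 first.
- exact: measurableT_comp mGE (@measurable_cons_rV R n).
- by move=> x; exact: G0.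
rewrite -(f1 ord0); apply: eq_integral => t _.
pose g j := f (lift ord0 j).
rewrite /fubini_F (eq_integral (fun v : 'rV[R]_n =>
   (f ord0 t)%:E * (\prod_j g j (v ord0 j))%:E)%E); last first.
  move=> v _; rewrite /G /= big_ord_recl EFinM mxE unlift_none; congr (_ * _%:E)%E.
  by apply: eq_bigr => j _; rewrite mxE liftK.
rewrite ge0_integralZl ?lee_fin//.
- by rewrite IH ?mule1// => j; [exact: mf|exact: f0|exact: f1].
- by apply/measurable_EFinP; apply: mG => j; exact: mf.
- by move=> v _; rewrite lee_fin prodr_ge0// => j _; exact: f0.
Qed.

Context (N : nat).
Local Notation E := ('rV[R]_N * R)%type.
Local Notation X := ('rV[R]_N * measurableTypeR R)%type.
Local Notation mu := (lam R N).

Definition kprod (f : option 'I_N -> R -> R) (z : E) : R :=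
  \prod_i f i (crd i z).

Lemma kprodE f z : kprod f z = f None z.2 * \prod_j f (Some j) (z.1 ord0 j).
Proof.
rewrite /kprod (bigD1 None)//=; congr (_ * _).
by rewrite (reindex_omap Some id)//=; [apply: eq_bigl => j; rewrite eqxx|case].
Qed.

Lemma measurable_kprod f :
  (forall i, measurable_fun setT (f i : measurableTypeR R -> R)) ->
  measurable_fun setT (kprod f : X -> R).
Proof.
move=> mf; apply: measurable_prod_seq => i.
exact: measurableT_comp (mf i) (@measurable_crd R N i).
Qed.

Lemma integral_kprod f :
  (forall i, measurable_fun setT (f i : measurableTypeR R -> R)) ->
  (forall i t, 0 <= f i t) -> (forall i, \int[leb]_t (f i t)%:E = 1)%E ->
  (\int[mu]_z (kprod f z)%:E = 1)%E.
Proof.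
move=> mf f0 f1.
transitivity (\int[@lebesgue_space R N \x leb]_z (kprod f z)%:E)%E; first by [].
rewrite fubini_tonelli1//; last 2 first.
- by apply/measurable_EFinP; exact: measurable_kprod.
- by move=> z; rewrite lee_fin prodr_ge0.
rewrite -(@integral_prod_rV N (fun j => f (Some j)))//.
apply: eq_integral => v _; rewrite /fubini_F.
have p0 : (0 <= (\prod_j f (Some j) (v ord0 j))%:E)%E by rewrite lee_fin prodr_ge0.
rewrite (eq_integral (fun t => (\prod_j f (Some j) (v ord0 j))%:E * (f None t)%:E)%E).
  rewrite ge0_integralZl ?f1 ?mule1//.
  - exact/measurable_EFinP.
  - by move=> t _; rewrite lee_fin.
by move=> t _; rewrite kprodE mulrC EFinM.
Qed.

Lemma kprod_avg f (r M : R) : 0 < r -> 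
  (forall i, measurable_fun setT (f i : measurableTypeR R -> R)) ->
  (forall i t, 0 <= f i t <= M) -> (forall i, \int[leb]_t (f i t)%:E = 1)%E ->
  (forall i t, f i t != 0 -> `|t| < r) -> avg_kernel r (kprod f : X -> R).
Proof.
move=> r0 mf fM f1 fr; have f0 i t : 0 <= f i t by have /andP[] := fM i t.
split.
- exact: measurable_kprod.
- by move=> z; rewrite prodr_ge0.
- exact: integral_kprod.
- move=> z; rewrite prodf_seq_neq0 => /allP h; apply/norm_crdP => // i.
  by apply: (fr i); apply: h; rewrite mem_index_enum.
exists (\prod_(i : option 'I_N) M) => z; apply: ler_prod => i _; exact: fM.
Qed.

(** The kernel [K] averages [k] over a segment of length [l], so that the
    derivative of [K] along the segment is a difference quotient of [k]. *)
Lemma kernel_pair (e : option 'I_N) (r l : R) : 0 < r -> 0 < l ->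
  exists k K : E -> R, [/\ sm k, sm K, avg_kernel r (k : X -> R),
    avg_kernel (r + l) (K : X -> R) &
    forall z, 'D_(edir R e) K z = (k (z + l *: edir R e) - k z) / l].
Proof.
move=> r0 l0; have [c c0 hc] := hat_mass r0.
pose b t := c * hat r t.
have cb : continuous b.
  by move=> t; apply: cvgM; [exact: cvg_cst|exact: continuous_hat].
have bM t : 0 <= b t <= c.
  apply/andP; split; first by rewrite mulr_ge0 ?hat_ge0// ltW.
  by apply: ler_piMr; [exact: ltW|exact: hat_le1].
have br t : b t != 0 -> `|t| < r.
  by rewrite mulf_eq0 negb_or => /andP[_]; exact: hat_supp.
have [a [aM ar a1 da]] := window_average l0 cb bM br hc.
have sb i : sm (fun z : E => b (crd i z)).
  apply: (@sm_mul _ _ (cst c)); first exact: sm_cst.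
  apply: sm_mul.
    rewrite (_ : (fun _ => _) = fun z => flat (1 : {poly R}) (- r^-1 * crd i z + 1)).
      exact: sm_flat.
    by apply/funext => z; rewrite mulNr addrC.
  rewrite (_ : (fun _ => _) = fun z => flat (1 : {poly R}) (r^-1 * crd i z + 1)).
    exact: sm_flat.
  by apply/funext => z; rewrite addrC.
have sa i : sm (fun z : E => a (crd i z)).
  apply: (sm_prim (f := fun t => (b (t + l) - b t) / l)) => //.
  have sbl : sm (fun z : E => b (crd i z + l)).
    have := sm_affine 1 (l *: edir R i) (sb i); congr sm; apply/funext => z.
    by rewrite scale1r crdD crdZ crd_edir eqxx mulr1.
  rewrite (_ : (fun _ => _) = fun z => cst l^-1 z * (b (crd i z + l) + cst (-1) z * b (crd i z))).
    apply: sm_mul; first exact: sm_cst.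
    by apply: sm_add => //; apply: sm_mul => //; exact: sm_cst.
  by apply/funext => z /=; rewrite mulrC mulN1r.
have mb : measurable_fun setT (b : measurableTypeR R -> R).
  exact: continuous_measurable_fun.
have ma : measurable_fun setT (a : measurableTypeR R -> R).
  apply: continuous_measurable_fun => t; apply: differentiable_continuous.
  by apply/derivable1_diffP; have [] := da t.
pose fK i := if i == e then a else b.
exists (kprod (fun=> b)), (kprod fK); split.
- exact: sm_prod.
- by apply: sm_prod => i; rewrite /fK; case: ifP.
- exact: (@kprod_avg _ _ c).
- apply: (@kprod_avg _ _ c); rewrite ?addr_gt0//.
  + by move=> i; rewrite /fK; case: ifP.
  + by move=> i t; rewrite /fK; case: ifP.
  + by move=> i; rewrite /fK; case: ifP.
  + move=> i t; rewrite /fK; case: ifP => // _; first exact: ar.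
    by move=> /br tr; rewrite (lt_trans tr)// ltrDl.
move=> z; pose G (z : E) := \prod_(i | i != e) b (crd i z).
have KE : kprod fK = (fun z => a (crd e z)) * G :> (E -> R).
  apply/funext => y; rewrite /kprod (bigD1 e)//= /fK eqxx; congr (_ * _).
  by apply: eq_bigr => i /negbTE ->.
have kE y : kprod (fun=> b) y = b (crd e y) * G y by rewrite /kprod (bigD1 e).
have Gh h y : G (y + h *: edir R e) = G y.
  apply: eq_bigr => i /negbTE ie; rewrite crdD crdZ crd_edir ie mulr0 addr0//.
have sG : sm G by exact: sm_prod.
have DG : 'D_(edir R e) G z = 0.
  rewrite /derive; apply: cvg_lim => //; apply: cvg_near_cst; near=> h.
  by rewrite /= [_ *: _ + _]addrC Gh subrr scaler0.
rewrite KE deriveM; [|exact: sm_derivable|exact: sm_derivable].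
rewrite DG scaler0 add0r; have [_ ->] := diff_comp_crd e da z.
rewrite !kE Gh crdD crdZ !crd_edir eqxx !mulr1 mul1r /GRing.scale/=; ring.
Unshelve. all: by end_near. Qed.

End product_kernels.

(** * Weak derivatives and difference quotients *)

Section weak_derivatives.
Context (R : realType) (N : nat).
Local Notation E := ('rV[R]_N * R)%type.
Local Notation X := ('rV[R]_N * measurableTypeR R)%type.
Local Notation mu := (lam R N).

Lemma derive_affine (phi : E -> R) (a : R) (c v z : E) : sm phi ->
  'D_v (fun z => phi (a *: z + c)) z = a * 'D_v phi (a *: z + c).
Proof.
move=> /sm_diff[dphi _]; pose A := (a \*: (id : E -> E)) + cst c.
have dA : is_derive z v A (a *: v).
  apply: (is_derive_eq (is_deriveD (is_deriveZ a (is_derive_id z v)) (is_derive_cst c z v))).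
  by rewrite addr0.
have ddA : differentiable A z.
  apply: differentiableD; last exact: differentiable_cst.
  by apply: differentiableZ.
rewrite (_ : (fun z => _) = phi \o A) // deriveE; last exact: differentiable_comp.
rewrite diff_comp//= -(deriveE _ ddA) (@derive_val _ _ _ _ _ _ _ dA).
by rewrite linearZ/= -deriveE.
Qed.

Lemma sm_shift (phi : E -> R) (c : E) : sm phi -> sm (fun z => phi (z - c)).
Proof.
move=> sphi; have := sm_affine 1 (- c) sphi; congr sm.
by apply/funext => z; rewrite scale1r.
Qed.

Lemma derive_shift (phi : E -> R) (c v z : E) : sm phi ->
  'D_v (fun z => phi (z - c)) z = 'D_v phi (z - c).
Proof.
move=> sphi; have := derive_affine 1 (- c) v z sphi.
rewrite scale1r mul1r => <-; congr ('D_v _ z).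
by apply/funext => y; rewrite scale1r.
Qed.

Lemma sm_reflect (phi : E -> R) (c : E) : sm phi -> sm (fun z => phi (c - z)).
Proof.
move=> sphi; have := sm_affine (-1) c sphi; congr sm.
by apply/funext => z; rewrite scaleN1r addrC.
Qed.

Lemma derive_reflect (phi : E -> R) (c v z : E) : sm phi ->
  'D_v (fun z => phi (c - z)) z = - 'D_v phi (c - z).
Proof.
move=> sphi; have := derive_affine (-1) c v z sphi.
rewrite scaleN1r mulN1r [- z + c]addrC => <-; congr ('D_v _ z).
by apply/funext => y; rewrite scaleN1r addrC.
Qed.

Lemma measurable_sm (phi : E -> R) : sm phi -> measurable_fun setT (phi : X -> R).
Proof. by move=> /sm_continuous; exact: continuous_measurable_xt. Qed.

Lemma kernel_test (D : set E) (K : E -> R) (r : R) (z0 : E) : 0 < r ->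
  sm K -> avg_kernel r (K : X -> R) ->
  (forall z, (forall i, `|crd i (z - z0)| <= r) -> D z) ->
  test_function D (fun z => K (z - z0)).
Proof.
move=> r0 sK [_ _ _ Kr _] zD; apply: (test_function_box (sm_shift z0 sK) _ zD).
by move=> z /Kr zr i; have := (norm_crdP (z - z0) r0).1 zr i => /ltW.
Qed.

Lemma avg_kernel_bdd (K : X -> R) (r : R) : avg_kernel r K ->
  exists M : R, forall y, `|K y| <= M.
Proof. by move=> [_ K0 _ _ [M KM]]; exists M => y; rewrite ger0_norm. Qed.

Lemma nrm1_eq0 (f : X -> R) :
  (forall k : R, 0 < k -> (nrm1 mu f <= k%:E)%E) -> nrm1 mu f = 0%E.
Proof.
move=> h; apply/eqP; rewrite eq_le nrm1_ge0 andbT; apply/lee_addgt0Pr => k k0.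
by rewrite add0e; exact: h.
Qed.

(** The averages of [g] over small kernels vanish on [Q], and converge to [g] in
    mean. *)
Lemma du_bois_reymond (g : X -> R) (Q : set X) (rho : R) : measurable Q -> 0 < rho ->
  integ mu g ->
  (forall phi z0, Q z0 -> sm phi ->
    (forall z, phi z != 0 -> forall i, `|crd i (z - z0)| <= rho) ->
    \int[mu]_z (g z * phi z) = 0) ->
  nrm1 mu (fun z => g z * \1_Q z) = 0%E.
Proof.
move=> mQ rho0 ig h; apply: nrm1_eq0 => e e0.
have [d d0 gd] := tcont_integ ig e0; have /integP[mg _] := ig.
pose r := Num.min d rho; have r0 : 0 < r by rewrite lt_min rho0 d0.
have [k [_ [sk _ ak _ _]]] := kernel_pair (None : option 'I_N) r0 ltr01.
have [M kM] := avg_kernel_bdd ak.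
have mQ1 : measurable_fun setT (\1_Q : X -> R) by exact: measurable_indic.
have := @approx_identity R N g (\1_Q) k r e ig mQ1 ak.
have -> : (fun z => (conv g k z - g z) * \1_Q z) = fun z => -1 * (g z * \1_Q z).
  apply/funext => z0; rewrite indicE; have [zQ|zQ] := boolP (z0 \in Q); last by rewrite !mulr0.
  rewrite inE in zQ; rewrite -(conv_kernel (M := M))//; last exact: measurable_sm.
  rewrite (h (fun z => k (z - z0)) z0 zQ); first by rewrite sub0r mulNr mul1r !mulr1.
    exact: sm_shift.
  move=> z; have [_ _ _ kr _] := ak => /kr zr i.
  have := (norm_crdP (z - z0) r0).1 zr i => /ltW/le_trans; apply.
  by rewrite ge_min lexx orbT.
rewrite nrm1Z; last exact: measurable_funM.
rewrite normrN1 mul1e; apply => y yr.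
have yd : `|y| < d by rewrite (lt_le_trans yr)// ge_min lexx.
apply: le_trans (gd _ yd); apply: nrm1_le.
- by apply: measurable_funM => //; apply: measurable_funB => //; exact: measurable_shift_fun.
- by apply: measurable_funB => //; exact: measurable_shift_fun.
- by move=> z; rewrite normrM indicE; case: (_ \in _); rewrite ?normr1 ?mulr1// normr0 mulr0.
Qed.

(** Testing the weak derivative with the long kernel [K] of a pair turns it
    into a statement on difference quotients of averages over [k]. *)
Lemma diff_quotient (D : set E) (e : option 'I_N) (v w : X -> R) (Q : set X) (rho : R) :
  measurable Q -> 0 < rho -> integ mu v -> integ mu w ->
  (forall phi, sm phi -> test_function D phi ->
    \int[mu]_z (v z * 'D_(edir R e) phi z) = - \int[mu]_z (w z * phi z)) ->
  (forall z0, Q z0 -> forall z : E, (forall i, `|crd i (z - z0)| <= rho) -> D z) ->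
  forall k : R, 0 < k -> exists2 s0 : R, 0 < s0 & forall s, 0 < s -> s < s0 ->
  (nrm1 mu (fun z => \1_Q z *
     (s^-1 * (v z - translate (- (s *: edir R e)) v z) - w z))%R <= k%:E)%E.
Proof.
move=> mQ rho0 iv iw hw QD k k0; have k2 : 0 < k / 2 by rewrite divr_gt0.
have /integP[mv _] := iv; have /integP[mw _] := iw.
have [d d0 wd] := tcont_integ iw k2.
exists (Num.min d rho / 2); first by rewrite divr_gt0// lt_min d0.
move=> s s_gt0 ss0; have s2 : s + s < Num.min d rho by lra.
have sk4 : 0 < s * k / 4 by rewrite divr_gt0// mulr_gt0.
have [d' d'0 vd'] := tcont_integ iv sk4.
pose r := Num.min d' s; have r0 : 0 < r by rewrite lt_min d'0.
have rs : r <= s by rewrite ge_min lexx orbT.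
have [kk [K [skk sK akk aK DK]]] := kernel_pair e r0 s_gt0.
have rs0 : 0 < r + s by rewrite addr_gt0.
have [M kM] := avg_kernel_bdd akk; have [M' KM'] := avg_kernel_bdd aK.
have mkk := measurable_sm skk; have mK := measurable_sm sK.
have ikk := avg_kernel_integ akk; have iK := avg_kernel_integ aK.
pose y : E := - (s *: edir R e).
pose c1 z := conv v kk z - v z; pose c2 z := conv w K z - w z.
have mc1 : measurable_fun setT c1 by apply: measurable_funB => //; exact: measurable_conv.
have mc2 : measurable_fun setT c2 by apply: measurable_funB => //; exact: measurable_conv.
have n1 : (nrm1 mu c1 <= (s * k / 4)%:E)%E.
  apply: (conv_approx iv akk) => x xr; apply: vd'; rewrite (lt_le_trans xr)//.
  by rewrite ge_min lexx.
have n2 : (nrm1 mu c2 <= (k / 2)%:E)%E.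
  apply: (conv_approx iw aK) => x xr; apply: wd; rewrite (lt_trans xr)//.
  have : Num.min d rho <= d by rewrite ge_min lexx.
  by lra.
have key z0 : Q z0 -> s^-1 * (conv v kk z0 - conv v kk (transl y z0)) = conv w K z0.
  move=> Qz0.
  have tK : test_function D (fun z => K (z - z0)).
    apply: kernel_test rs0 sK aK _ => z zr; apply: (QD _ Qz0) => i.
    apply: le_trans (zr i) _.
    have : Num.min d rho <= rho by rewrite ge_min lexx orbT.
    by lra.
  have := hw _ (sm_shift z0 sK) tK.
  rewrite [X in _ = - X](conv_kernel z0 iw mK KM') => /(congr1 -%R); rewrite opprK => <-.
  have E1 z : 'D_(edir R e) (fun z => K (z - z0)) z =
      s^-1 * (kk (z - (transl y z0 : E)) - kk (z - z0)).
    rewrite derive_shift// DK mulrC; congr (_ * (kk _ - _)).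
    by rewrite /transl /y opprB addrCA addrC.
  rewrite -(conv_kernel z0 iv mkk kM) -(conv_kernel (transl y z0) iv mkk kM).
  have ikv c : integ mu (fun z => v z * kk (transl (- (c : E)) z)).
    rewrite (_ : (fun _ => _) = fun z => translate (- (c : E)) kk z * v z); last first.
      by apply/funext => z; rewrite mulrC.
    apply: (@integM_bdd _ _ _ _ _ _ M) => //; first exact: measurable_shift_fun.
    by move=> z; exact: kM.
  rewrite -RintegralB//; [|exact: ikv|exact: ikv].
  rewrite -RintegralZl//; last exact: (integB (ikv _) (ikv _)).
  rewrite -[RHS]mulN1r -RintegralZl//; last first.
    rewrite (_ : (EFin \o _) = EFin \o (fun z => s^-1 * (v z * kk (transl (- (transl y z0 : E)) z) -
       v z * kk (transl (- (z0 : E)) z)))).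
      exact: (integZ _ (integB (ikv _) (ikv _))).
    by apply/funext => z; rewrite /= E1 /transl; congr EFin; ring.
  by apply: eq_Rintegral => z _; rewrite E1 /transl; ring.
have mQ1 : measurable_fun setT (\1_Q : X -> R) by exact: measurable_indic.
pose f1 z := s^-1 * c1 z; pose f2 z := translate y f1 z.
have mf1 : measurable_fun setT f1 by exact: measurable_funM.
have mf2 : measurable_fun setT f2 by exact: measurable_shift_fun.
pose f12 z := `|f1 z| + `|f2 z|.
have mn (f : X -> R) : measurable_fun setT f -> measurable_fun setT (fun z : X => `|f z|).
  by move=> mf; exact: measurableT_comp.
have mf12 : measurable_fun setT f12 by apply: measurable_funD; exact: mn.
have nf1 : (nrm1 mu f1 <= (k / 4)%:E)%E.
  rewrite nrm1Z// gtr0_norm ?invr_gt0//.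
  apply: (@le_trans _ _ ((s^-1)%:E * (s * k / 4)%:E)%E).
    by apply: lee_wpmul2l => //; rewrite lee_fin invr_ge0 ltW.
  by rewrite -EFinM lee_fin !mulrA mulVf ?gt_eqF// mul1r.
apply: (@le_trans _ _ (nrm1 mu f12 + nrm1 mu c2)%E).
  apply: nrm1_leD => //.
    apply: measurable_funM => //; apply: measurable_funB => //.
    apply: measurable_funM => //; apply: measurable_funB => //.
    exact: measurable_shift_fun.
  move=> z; rewrite indicE; have [zQ|_] := boolP (z \in Q); last first.
    by rewrite mul0r normr0 addr_ge0.
  rewrite mul1r (ger0_norm (addr_ge0 (normr_ge0 (f1 z)) (normr_ge0 (f2 z)))).
  rewrite inE in zQ; have := key _ zQ => kz.
  rewrite (_ : s^-1 * _ - w z = - f1 z + f2 z + c2 z).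
    by rewrite (le_trans (ler_normD _ _))// lerD2r (le_trans (ler_normD _ _))// normrN.
  by rewrite /f2 /translate /f1 /c1 /c2 -kz -/(translate y v z) /translate; ring.
rewrite (splitr k) EFinD; apply: leeD => //.
apply: (@le_trans _ _ (nrm1 mu f1 + nrm1 mu f2)%E).
  by apply: nrm1_leD => // z; rewrite ger0_norm// addr_ge0.
rewrite (_ : k / 2 = k / 4 + k / 4); last by field.
by rewrite EFinD; apply: leeD => //; rewrite nrm1_shift.
Qed.

(** The margin is measured coordinatewise, as the supports of kernels are boxes. *)
Lemma compact_margin (D K : set E) : open D -> compact K -> K `<=` D ->
  exists2 rho : R, 0 < rho & forall z0, K z0 -> forall z : E,
    (forall i, `|crd i (z - z0)| <= rho) -> D z.
Proof.
move=> oD /compact_near_coveringP cK KD.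
have := cK R 0^'+ (fun s z0 => forall z : E, (forall i, `|crd i (z - z0)| <= s) -> D z).
case.
  move=> z0 Kz0; have /nbhs_ballP[s /= s0 zs] : nbhs z0 D by exact: open_nbhs_nbhs (conj oD (KD _ Kz0)).
  have s2 : 0 < s / 2 by rewrite divr_gt0.
  exists (ball z0 (s / 2), [set t | t < s / 2]) => /=.
    by split; [exact: nbhsx_ballx|exact: nbhs_right_lt].
  move=> [z1 t] /= [z01 ts] z zt; apply: zs; apply/ball_crdP => // i.
  rewrite (_ : z - z0 = (z - z1) + (z1 - z0)); last by rewrite addrA subrK.
  rewrite crdD (le_lt_trans (ler_normD _ _))// (splitr s) ltrD//.
    by rewrite (le_lt_trans (zt i)).
  by have := (ball_crdP z0 z1 s2).1 z01 i.
move=> s /= s0 h; exists (s / 2); first by rewrite divr_gt0.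
apply: (h (s / 2)); last by rewrite divr_gt0.
by rewrite /= sub0r normrN gtr0_norm ?divr_gt0//; rewrite /= in s0; lra.
Qed.

End weak_derivatives.

(** * The chain rule *)

Section dct.
Context d (T : measurableType d) (R : realType) (mu : {measure set T -> \bar R}).
Implicit Types f g : T -> R.

Lemma Rint_dct (f_ : nat -> T -> R) f g : (forall n, measurable_fun setT (f_ n)) ->
  integ mu g -> (forall z, f_ ^~ z @ \oo --> f z) ->
  (forall n z, `|f_ n z| <= g z) ->
  integ mu f /\ (\int[mu]_z f_ n z) @[n --> \oo] --> \int[mu]_z f z.
Proof.
move=> mf_ ig fc fg; have mf : measurable_fun setT f.
  by apply: (measurable_fun_cvg (h := f_)) => // z _; exact: fc.
have := @dominated_convergence _ T R mu setT measurableT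
  (fun n z => (f_ n z)%:E) (fun z => (f z)%:E) (fun z => (g z)%:E).
case.
- by move=> n; exact/measurable_EFinP.
- exact/measurable_EFinP.
- by apply: aeW => z _; apply: cvg_EFin; [exact: nearW|exact: fc].
- exact: ig.
- by apply: aeW => z n _; rewrite lee_fin.
move=> fi _ lim; split => //.
apply: fine_cvg; rewrite /Rintegral fineK//.
by apply: integrable_fin_num.
Qed.

End dct.

Section real_analysis.
Context (R : realType).

Lemma MVT_any (G G1 : R -> R) : (forall t, is_derive t (1 : R) G (G1 t)) ->
  forall a b, exists2 x, `|x - a| <= `|b - a| & G a - G b = G1 x * (a - b).
Proof.
move=> dG; have cG (a b : R) : {within `[a, b], continuous G}.
  apply: continuous_subspaceT => t; apply: differentiable_continuous.
  by apply/derivable1_diffP; have [] := dG t.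
move=> a b; have [ab|ba] := leP a b.
  have [x xab E] := MVT_segment ab (fun x _ => dG x) (cG a b).
  move: xab; rewrite in_itv/= => /andP[x1 x2]; exists x.
    by rewrite !ger0_norm ?subr_ge0// lerD2r.
  by rewrite -opprB E -mulrN opprB.
have [x xab E] := MVT_segment (ltW ba) (fun x _ => dG x) (cG b a).
move: xab; rewrite in_itv/= => /andP[x1 x2]; exists x => //.
by rewrite distrC [leRHS]distrC !ger0_norm ?subr_ge0 ?(ltW ba)// lerB.
Qed.

(** Uniform continuity of [G1] on a compact interval serves for close points, and
    its bound for distant ones. *)
Lemma modulus_bound (G1 : R -> R) (L M e : R) : continuous G1 -> 0 <= L ->
  (forall t, `|G1 t| <= L) -> 0 < e ->
  exists2 C : R, 0 <= C & forall a b, `|a| <= M ->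
    `|G1 b - G1 a| <= e + C * `|b - a|.
Proof.
move=> cG L0 GL e0.
have /compact_near_coveringP cK := @segment_compact R (- M) M.
have := cK R 0^'+ (fun s a => forall b, `|b - a| < s -> `|G1 b - G1 a| <= e).
case.
  move=> a0 Ka0; have e2 : 0 < e / 2 by rewrite divr_gt0.
  have /cvgrPdist_lt /(_ _ e2) /nbhs_ballP[s /= s0 sG] := cG a0.
  have s2 : 0 < s / 2 by rewrite divr_gt0.
  exists (ball a0 (s / 2), [set t | t < s / 2]) => /=.
    by split; [exact: nbhsx_ballx|exact: nbhs_right_lt].
  move=> [a t] /= [a01 ts] b bt; rewrite /ball /= in a01.
  have h1 : `|G1 a0 - G1 a| < e / 2.
    by apply: sG; rewrite /ball /= (lt_trans a01)//; lra.
  have h2 : `|G1 a0 - G1 b| < e / 2.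
    apply: sG; rewrite /ball /= (_ : a0 - b = (a0 - a) - (b - a)); last by ring.
    by rewrite (le_lt_trans (ler_normB _ _))// (splitr s) ltrD// (lt_trans bt).
  rewrite (_ : G1 b - G1 a = (G1 a0 - G1 a) - (G1 a0 - G1 b)); last by ring.
  by rewrite (le_trans (ler_normB _ _))// (splitr e) lerD// ltW.
move=> s /= s0 h; have s2 : 0 < s / 2 by rewrite divr_gt0.
exists (2 * L / (s / 2)); first by rewrite divr_ge0 ?mulr_ge0// ltW.
move=> a b aM; have [bs|bs] := ltP `|b - a| (s / 2).
  apply: le_trans (h (s / 2) _ _ _ _ _ bs) _ => //.
  - by rewrite /= sub0r normrN gtr0_norm//; lra.
  - by rewrite /= in_itv/= -ler_norml.
  by rewrite lerDl mulr_ge0// divr_ge0 ?mulr_ge0// ltW.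
apply: (@le_trans _ _ (2 * L)).
  by rewrite (le_trans (ler_normB _ _))// mulrDl mul1r lerD.
have h1 : 1 <= (s / 2)^-1 * `|b - a| by rewrite mulrC ler_pdivlMr// mul1r.
apply: ler_wpDl; first exact: ltW.
by rewrite -mulrA; apply: ler_peMr => //; exact: mulr_ge0.
Qed.

End real_analysis.

Section test_functions.
Context (R : realType) (N : nat).
Local Notation E := ('rV[R]_N * R)%type.

Lemma bounded_support (phi : E -> R) (S : set E) : compact S -> continuous phi ->
  (forall z, ~ S z -> phi z = 0) -> exists2 B : R, 0 <= B & forall z, `|phi z| <= B.
Proof.
move=> cS cphi h; have cw : {within S, continuous phi} by exact: continuous_subspaceT.
have [B [_ hB]] := compact_bounded (continuous_compact cw cS).
exists (`|B| + 1); first by rewrite addr_ge0.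
move=> z; have [Sz|nSz] := pselect (S z); last by rewrite h// normr0 addr_ge0.
by apply: (hB (`|B| + 1)); [rewrite ltr_pwDr// ler_norm|exists z].
Qed.

Lemma support_eq0 (phi : E -> R) (z : E) :
  ~ closure [set z | phi z != 0] z -> phi z = 0.
Proof.
by move=> nS; apply/eqP/negPn/negP => h; apply: nS; exact: subset_closure.
Qed.

Lemma derive_support (phi : E -> R) (v z : E) :
  ~ closure [set z | phi z != 0] z -> 'D_v phi z = 0.
Proof.
move=> nz; have [->|v0] := eqVneq v 0; first by rewrite derive0.
have oc : open (~` closure [set z | phi z != 0]) by exact: closed_openC (@closed_closure _ _).
have := open_nbhs_nbhs (conj oc nz) => nn.
rewrite (@near_eq_derive _ _ _ phi (cst 0) z v).
  exact: derive_cst.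
near=> y; have : (~` closure [set z | phi z != 0]) y by near: y.
by move=> ny; apply/eqP/negPn/negP => py; apply: ny; exact: subset_closure.
Unshelve. all: by end_near. Qed.

Lemma is_derive_line (phi : E -> R) (v z : E) : (forall z, derivable phi z v) ->
  forall t : R, is_derive t (1 : R) (fun t => phi (z + t *: v)) ('D_v phi (z + t *: v)).
Proof.
move=> dphi t.
have E1 : (fun h : R => h^-1 *: (phi (z + (h *: 1 + t) *: v) - phi (z + t *: v))) =
    (fun h => h^-1 *: (phi (h *: v + (z + t *: v)) - phi (z + t *: v))).
  apply/funext => h; congr (_ *: (phi _ - _)).
  by rewrite scalerDl /GRing.scale/= mulr1 addrCA.
have := dphi (z + t *: v); rewrite /derivable /= => dz.
apply: DeriveDef; first by rewrite /derivable /= E1.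
by rewrite /derive /= E1.
Qed.

Lemma derive_bound (phi : E -> R) (v : E) (B : R) : (forall z, derivable phi z v) ->
  (forall z, `|'D_v phi z| <= B) ->
  forall z (s : R), 0 < s -> `|s^-1 * (phi (z + s *: v) - phi z)| <= B.
Proof.
move=> dphi hB z s s0.
have [x _ h] := MVT_any (is_derive_line z dphi) s 0.
move: h; rewrite scale0r addr0 subr0 => ->.
by rewrite mulrCA mulVf ?gt_eqF// mulr1.
Qed.

Lemma derive_cvg (phi : E -> R) (v z : E) : derivable phi z v ->
  (fun n : nat => n.+1%:R * (phi (z + n.+1%:R^-1 *: v) - phi z)) @ \oo --> 'D_v phi z.
Proof.
move=> dz; pose q (h : R) := h^-1 *: (phi (h *: v + z) - phi z).
rewrite (_ : (fun n => _) = q \o (fun n : nat => n.+1%:R^-1)); last first.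
  by apply/funext => n; rewrite /q /= invrK [_ *: v + z]addrC.
apply: (@cvg_comp _ _ _ _ _ \oo 0^'); last exact: dz.
move=> A [e /= e0 eA]; have := near_infty_natSinv_lt (PosNum e0).
apply: filterS => n /= ne; apply: eA; last by rewrite invr_eq0.
by rewrite /= sub0r normrN gtr0_norm.
Qed.

Local Notation X := ('rV[R]_N * measurableTypeR R)%type.
Local Notation mu := (lam R N).

Lemma nrm1_RintM (f g : X -> R) (k : R) : integ mu f -> integ mu g ->
  (nrm1 mu (fun z => f z - g z)%R <= k%:E)%E ->
  `|\int[mu]_z f z - \int[mu]_z g z| <= k.
Proof.
move=> fi gi h; rewrite -lee_fin; apply: le_trans h.
by rewrite -RintegralB//; apply: Rint_le_nrm1; exact: integB.
Qed.

Lemma continuous_C1_measurable (G : R -> R) (f : X -> R) : continuous G ->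
  measurable_fun setT f -> measurable_fun setT (fun z => G (f z)).
Proof.
move=> cG mf; apply: (@measurableT_comp _ _ _ _ _ _ (G : measurableTypeR R -> R)) => //.
exact: continuous_measurable_fun.
Qed.

(** The chain rule rests on the convergence in mean of difference quotients:
    these commute with [G] up to the mean value theorem. *)
Lemma chain_rule (D : set E) (e : option 'I_N) (v w : X -> R) (G G1 : R -> R) (L : R) :
  open D -> integ mu v -> integ mu w ->
  (forall phi, sm phi -> test_function D phi ->
    \int[mu]_z (v z * 'D_(edir R e) phi z) = - \int[mu]_z (w z * phi z)) ->
  (forall t, is_derive t (1 : R) G (G1 t)) -> continuous G1 ->
  (forall t, `|G1 t| <= L) -> G 0 = 0 ->
  forall phi, test_function D phi ->
    \int[mu]_z (G (v z) * 'D_(edir R e) phi z) =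
    - \int[mu]_z (G1 (v z) * w z * phi z).
Proof.
move=> oD iv iw hw dG cG1 GL G00 phi [sphi cS SD].
have L0 : 0 <= L by apply: le_trans (GL 0).
have /integP[mv _] := iv; have /integP[mw _] := iw.
have cG : continuous G.
  move=> t; apply: differentiable_continuous; apply/derivable1_diffP.
  by have [] := dG t.
have [cphi dphi] := sphi [::]; have [cDphi _] := sphi [:: edir R e].
rewrite /= in cphi dphi cDphi.
set S := closure [set z | phi z != 0] in cS SD.
have phi0 := @support_eq0 phi.
have [B B0 hB] := bounded_support cS cphi phi0.
have [B' B'0 hB'] := bounded_support cS cDphi (@derive_support phi (edir R e)).
have [rho rho0 Srho] := compact_margin oD cS SD.
have mS := compact_measurable cS.
have mphi : measurable_fun setT (phi : X -> R) by exact: continuous_measurable_xt.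
have mDphi : measurable_fun setT ('D_(edir R e) phi : X -> R).
  exact: continuous_measurable_xt.
have Glip a b : `|G a - G b| <= L * `|a - b|.
  have [x _ ->] := MVT_any dG a b.
  by rewrite normrM ler_wpM2r.
have iGv : integ mu (fun z => G (v z)).
  apply: (@integ_le _ _ _ _ _ (fun z => L * v z)).
  - exact: continuous_C1_measurable.
  - exact: integZ.
  - by move=> z; rewrite -[G _]subr0 -G00 (le_trans (Glip _ _))// subr0 normrM ler_wpM2r// ler_norm.
have mG1v : measurable_fun setT (fun z => G1 (v z)) by exact: continuous_C1_measurable.
have iG1 : integ mu (fun z => G1 (v z) * w z * phi z).
  rewrite (_ : (fun z => _) = fun z => (G1 (v z) * phi z) * w z); last first.
    by apply/funext => z; ring.
  apply: (@integM_bdd _ _ _ _ _ _ (L * B)) => //; first exact: measurable_funM.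
  by move=> z; rewrite normrM ler_pM.
pose s n : R := n.+1%:R^-1.
have s0 n : 0 < s n by rewrite invr_gt0.
pose ee := edir R e.
pose q n (z : X) := (s n)^-1 * (v z - translate (- (s n *: ee)) v z).
pose rq n (z : X) := (s n)^-1 * (G (v z) - G (translate (- (s n *: ee)) v z)).
pose x n := \int[mu]_z (rq n z * phi z).
have xE n : x n = - \int[mu]_z (G (v z) * (n.+1%:R * (phi (z + s n *: ee) - phi z))).
  have i1 (c : E) : integ mu (fun z : X => G (v z) * phi (z + c)).
    rewrite (_ : (fun z => _) = fun z => translate c phi z * G (v z)); last first.
      by apply/funext => z; rewrite mulrC.
    apply: (@integM_bdd _ _ _ _ _ _ B) => //; first exact: measurable_shift_fun.
    by move=> z; exact: hB.
  have i2 : integ mu (fun z : X => G (v z) * phi z).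
    by have := i1 0; congr (integ mu _); apply/funext => z; rewrite addr0.
  have i3 : integ mu (fun z => translate (- (s n *: ee)) (fun z => G (v z)) z * phi z).
    rewrite (_ : (fun z => _) = fun z => phi z * translate (- (s n *: ee)) (fun z => G (v z)) z); last first.
      by apply/funext => z; rewrite mulrC.
    by apply: (@integM_bdd _ _ _ _ _ _ B) => //; exact: integ_shift.
  have E3 : \int[mu]_z (translate (- (s n *: ee)) (fun z => G (v z)) z * phi z) =
      \int[mu]_z (G (v z) * phi (z + s n *: ee)).
    rewrite -(@Rint_shift R N (- (s n *: ee)) _ (i1 (s n *: ee))).
    by apply: eq_Rintegral => z _; rewrite /translate /transl /= subrK.
  have -> : \int[mu]_z (G (v z) * (n.+1%:R * (phi (z + s n *: ee) - phi z))) =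
      n.+1%:R * (\int[mu]_z (G (v z) * phi (z + s n *: ee)) - \int[mu]_z (G (v z) * phi z)).
    rewrite -RintegralB//; [|exact: i1].
    rewrite -RintegralZl//; last exact: (integB (i1 _) i2).
    by apply: eq_Rintegral => z _; ring.
  rewrite -E3 -RintegralB// -[RHS]mulrN -[in RHS]mulN1r.
  rewrite -RintegralZl//; last exact: (integB i3 i2).
  rewrite -RintegralZl//; last exact: (integZ _ (integB i3 i2)).
  by apply: eq_Rintegral => z _; rewrite /rq /s invrK /translate; ring.
have lim1 : x n @[n --> \oo] --> - \int[mu]_z (G (v z) * 'D_ee phi z).
  rewrite (_ : x = fun n => - \int[mu]_z (G (v z) * (n.+1%:R * (phi (z + s n *: ee) - phi z)))).
    apply: cvgN.
    apply: (@Rint_dct _ _ _ _ _ _ (fun z => B' * `|G (v z)|) _ _ _ _).2.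
    - move=> n; apply: measurable_funM; first by have /integP[] := iGv.
      apply: measurable_funM => //; apply: measurable_funB => //.
      exact: measurable_shift_fun.
    - by apply: integZ; exact: integ_norm.
    - by move=> z; apply: cvgM; [exact: cvg_cst|exact: derive_cvg].
    - move=> n z; rewrite normrM mulrC ler_wpM2r//.
      by have := derive_bound (fun z => dphi z ee) hB' z (s0 n); rewrite /s invrK.
  by apply/funext => n; rewrite xE.
have lim2 : x n @[n --> \oo] --> \int[mu]_z (G1 (v z) * w z * phi z).
  apply/cvgrPdist_le => k k0.
  have k4 : 0 <= k / 4 by rewrite divr_ge0// ltW.
  have [c1 c2 c4] : [/\ 0 <= B * L, 0 <= B & 0 <= 2 * L * B] by rewrite !mulr_ge0.
  pose Wn := fine (nrm1 mu w).
  have WE : nrm1 mu w = Wn%:E.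
    by rewrite fineK// ge0_fin_numE ?nrm1_ge0//; have /integP[] := iw.
  have Wn0 : 0 <= Wn by rewrite -lee_fin -WE nrm1_ge0.
  pose P m : set X := [set z | m%:R < `|v z|] `|` [set z | m%:R < `|w z|].
  have mabs (f : X -> R) m : measurable_fun setT f -> measurable [set z : X | m%:R < `|f z|].
    move=> mf; have mnf : measurable_fun setT (fun z => `|f z|) by exact: measurableT_comp.
    have := mnf measurableT `]m%:R, +oo[%classic (measurable_itv _).
    by rewrite setTI preimage_itvoy.
  have mP m : measurable (P m) by apply: measurableU; exact: mabs.
  have e4 : 0 < k / 4 / (2 * L * B + 1) by rewrite !divr_gt0// ltr_wpDl.
  have Pz z : exists k0, forall k, (k0 <= k)%N -> ~ P k z.
    exists (Num.trunc (`|v z| + `|w z|)).+1 => m zm.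
    have mm : `|v z| + `|w z| <= m%:R.
      by rewrite (le_trans (ltW (truncnS_gt _)))// ler_nat.
    case=> /=; apply/negP; rewrite -leNgt (le_trans _ mm)//.
      by rewrite lerDl.
    by rewrite lerDr.
  have [M hM0] := nrm1_tail iw mP Pz e4; have hM := hM0 _ (leqnn _).
  pose eta := k / 4 / (B * Wn + 1).
  have eta0 : 0 < eta by rewrite /eta !divr_gt0// ltr_wpDl// mulr_ge0.
  have [C C0 hC] := modulus_bound M%:R cG1 L0 GL eta0.
  have c3 : 0 <= B * (C * M%:R) by rewrite !mulr_ge0.
  have e3 : 0 < k / 4 / (B * (C * M%:R) + 1) by rewrite !divr_gt0// ltr_wpDl.
  have [d3 d30 hd3] := tcont_integ iv e3.
  have e1 : 0 < k / 4 / (B * L + 1) by rewrite !divr_gt0// ltr_wpDl.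
  have [d1 d10 hd1] := diff_quotient mS rho0 iv iw hw Srho e1.
  have nee : 0 < `|ee| + 1 by rewrite ltr_wpDl.
  have dd0 : 0 < Num.min d1 (d3 / (`|ee| + 1)) by rewrite lt_min d10 divr_gt0.
  have := near_infty_natSinv_lt (PosNum dd0); apply: filterS => n /= nd.
  have sd1 : s n < d1 by rewrite (lt_le_trans nd)// ge_min lexx.
  have sd3 : `|- (s n *: ee)| < d3.
    rewrite normrN normrZ gtr0_norm//.
    have : s n < d3 / (`|ee| + 1) by rewrite (lt_le_trans nd)// ge_min lexx orbT.
    rewrite ltr_pdivlMr//; apply: le_lt_trans.
    by rewrite mulrDr mulr1 lerDl ltW.
  have irq : integ mu (fun z => rq n z * phi z).
    rewrite (_ : (fun z => _) = fun z => phi z * rq n z); last first.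
      by apply/funext => z; rewrite mulrC.
    apply: (@integM_bdd _ _ _ _ _ _ B) => //; apply: integZ; apply: integB => //.
    exact: (integ_shift _ iGv).
  rewrite distrC; apply: nrm1_RintM => //.
  have mq : measurable_fun setT (q n).
    apply: measurable_funM => //; apply: measurable_funB => //.
    exact: measurable_shift_fun.
  have mrq : measurable_fun setT (rq n).
    apply: measurable_funM => //; apply: measurable_funB; first by have /integP[] := iGv.
    by apply: continuous_C1_measurable => //; exact: measurable_shift_fun.
  have mS1 : measurable_fun setT (\1_S : X -> R) by exact: measurable_indic.
  have mP1 : measurable_fun setT (\1_(P M) : X -> R) by exact: measurable_indic.
  pose f1 z := \1_S z * (q n z - w z).
  pose f3 z := translate (- (s n *: ee)) v z - v z.
  pose f4 z := \1_(P M) z * w z.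
  have mf1 : measurable_fun setT f1 by apply: measurable_funM => //; exact: measurable_funB.
  have mf3 : measurable_fun setT f3 by apply: measurable_funB => //; exact: measurable_shift_fun.
  have mf4 : measurable_fun setT f4 by exact: measurable_funM.
  have mff : measurable_fun setT (fun z => rq n z * phi z - G1 (v z) * w z * phi z).
    apply: measurable_funB; apply: measurable_funM => //; exact: measurable_funM.
  apply: le_trans (@nrm1_le_sum _ _ _ mu _ [:: (fun z => B * L * f1 z);
    (fun z => B * eta * w z); (fun z => B * (C * M%:R) * f3 z);
    (fun z => 2 * L * B * f4 z)] mff _ _) _.
  - by move=> [|[|[|[|i]]]] /=; rewrite ?nth_nil//; exact: measurable_funM.
  - move=> z; rewrite !big_cons big_nil addr0.
    have [zS|zS] := pselect (S z); last first.
      by rewrite phi0// !mulr0 subrr normr0 !addr_ge0.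
    have S1 : \1_S z = 1 :> R by rewrite indicE mem_set.
    rewrite -mulrBl normrM mulrC.
    pose vt := translate (- (s n *: ee)) v z.
    have [x0 x0v GE] := MVT_any dG (v z) vt.
    have -> : rq n z - G1 (v z) * w z = G1 x0 * (q n z - w z) + (G1 x0 - G1 (v z)) * w z.
      rewrite /rq -/vt GE /q -/vt; ring.
    have t1 : `|G1 x0 * (q n z - w z)| <= L * `|f1 z|.
      by rewrite /f1 S1 mul1r normrM ler_wpM2r.
    have t2 : `|(G1 x0 - G1 (v z)) * w z| <=
        eta * `|w z| + C * M%:R * `|f3 z| + 2 * L * `|f4 z|.
      rewrite /f4 indicE; have [zP|zP] := boolP (z \in P M).
        rewrite mul1r; apply: ler_wpDl.
          by apply: addr_ge0; rewrite mulr_ge0 ?(ltW eta0)// mulr_ge0.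
        rewrite normrM ler_wpM2r//.
        by rewrite (le_trans (ler_normB _ _))// mulrDl mul1r lerD.
      rewrite mul0r normr0 mulr0 addr0.
      have [vM wM] : `|v z| <= M%:R /\ `|w z| <= M%:R.
        split; rewrite leNgt; apply: contra zP => h; apply/mem_set; [by left|by right].
      rewrite normrM; apply: (@le_trans _ _ ((eta + C * `|x0 - v z|) * `|w z|)).
        by rewrite ler_wpM2r// hC.
      rewrite mulrDl lerD2l -!mulrA ler_wpM2l// mulrC ler_pM//.
    apply: (@le_trans _ _ (B * (L * `|f1 z| + (eta * `|w z| + C * M%:R * `|f3 z| + 2 * L * `|f4 z|)))).
      apply: ler_pM => //; rewrite (le_trans (ler_normD _ _))//; exact: lerD.
    have cBe : 0 <= B * eta by rewrite mulr_ge0// ltW.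
    rewrite (normrM (B * L)) (normrM (B * eta)) (normrM (B * (C * M%:R))).
    rewrite (normrM (2 * L * B)) (ger0_norm c1) (ger0_norm cBe) (ger0_norm c3).
    rewrite (ger0_norm c4).
    by rewrite le_eqVlt; apply/orP; left; apply/eqP; ring.
  rewrite !big_cons big_nil adde0.
  have -> : k = k / 4 + (k / 4 + (k / 4 + k / 4)) by field.
  rewrite !EFinD; apply: leeD; [|apply: leeD; [|apply: leeD]].
  - by apply: nrm1Z_le => //; exact: hd1.
  - have cBe : 0 <= B * eta by rewrite mulr_ge0// ltW.
    rewrite nrm1Z// WE -EFinM lee_fin (ger0_norm cBe) /eta.
    rewrite (_ : B * _ * Wn = k / 4 * (B * Wn / (B * Wn + 1))); last first.
      by field; rewrite gt_eqF// ltr_wpDl// mulr_ge0.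
    apply: ler_piMr => //; rewrite ler_pdivrMr ?mul1r ?lerDl//.
    by rewrite ltr_wpDl// mulr_ge0.
  - by apply: nrm1Z_le => //; exact: hd3.
  - exact: nrm1Z_le.
by rewrite -(cvg_unique (@Rhausdorff R) lim1 lim2) opprK.
Qed.

End test_functions.

(** * Regularized powers *)

Section powers.
Context (R : realType).
Implicit Types (t a b Q dl c m : R).

Lemma powR_norm_sqr t a : a != 0 -> `|t| `^ (a - 2) * t * t = `|t| `^ a.
Proof.
move=> a0; have [->|t0] := eqVneq t 0; first by rewrite !mulr0 normr0 powR0.
have t'0 : 0 < `|t| by rewrite normr_gt0.
rewrite -mulrA -expr2 -(real_normK (num_real t)) -powR_mulrn//.
by rewrite -powRD ?subrK//; apply/implyP => _; rewrite gt_eqF.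
Qed.

Lemma is_derive_pow_norm t a : 1 < a ->
  is_derive t (1 : R) (fun t => `|t| `^ a) (a * (`|t| `^ (a - 2) * t)).
Proof.
move=> a1; have a0 : 0 < a by lra.
have pos (x : R) : 0 < x -> is_derive x (1 : R) (fun t => `|t| `^ a) (a * (`|x| `^ (a - 2) * x)).
  move=> x0; apply: (@near_eq_is_derive _ _ _ (fun t : R => t `^ a)).
    by near=> y; rewrite gtr0_norm//; near: y; exact: lt_nbhsr.
  apply: (is_derive_eq (is_derive1_powR a x0)).
  rewrite gtr0_norm//; congr (_ * _).
  rewrite -{3}(powRr1 (ltW x0)) -powRD; first by congr powR; ring.
  by apply/implyP => _; rewrite gt_eqF.
have [t0|t0|->] := ltgtP t 0.
- have nt : 0 < - t by lra.
  have E1 : (fun t => `|t| `^ a) = (fun t => `|t| `^ a) \o (-%R : R -> R) :> (R -> R).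
    by apply/funext => x /=; rewrite normrN.
  rewrite E1; apply: (is_derive_eq (is_derive1_comp (g := -%R) (pos _ nt) (is_deriveNid t 1))).
  by rewrite normrN; ring.
- exact: pos.
have d0 : h^-1 *: (((fun t : R => `|t| `^ a) \o shift (0 : R)) (h *: (1 : R)) - `|0 : R| `^ a) @[h --> (0 : R)^'] --> (0 : R).
  apply/cvgrPdist_le => e e0; near=> h.
  rewrite normr0 powR0 ?gt_eqF// sub0r normrN subr0 /= addr0 /GRing.scale/= mulr1.
  have h0 : h != 0 by near: h; exact: nbhs_dnbhs_neq.
  have hp : 0 < `|h| by rewrite normr_gt0.
  rewrite normrM normfV [X in _ * X]ger0_norm ?powR_ge0//.
  rewrite -[in X in X * _](powRr1 (normr_ge0 h)) -powR_inv1 ?powR_ge0//.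
  rewrite -powRrM mul1r -powRD; last by apply/implyP => _; rewrite gt_eqF.
  have -> : -1 + a = a - 1 by ring.
  have he : `|h| <= e `^ (a - 1)^-1.
    by near: h; apply: dnbhs0_le; rewrite powR_gt0.
  have a10 : 0 < a - 1 by lra.
  have := @ge0_ler_powR _ (a - 1) (ltW a10) `|h| (e `^ (a - 1)^-1).
  rewrite !nnegrE powR_ge0 => /(_ (normr_ge0 _) isT he).
  by rewrite -powRrM mulVf ?gt_eqF// powRr1// ltW.
rewrite !mulr0; apply: DeriveDef; first by apply/cvg_ex; exists 0.
exact: cvg_lim d0.
Unshelve. all: by end_near. Qed.

Lemma continuous_pow_norm a : 1 < a -> continuous (fun t : R => `|t| `^ a).
Proof.
move=> a1 t; apply: differentiable_continuous; apply/derivable1_diffP.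
by have [] := is_derive_pow_norm t a1.
Qed.

Lemma is_derive_spow t Q : 2 < Q ->
  is_derive t (1 : R) (fun t => spow t Q) (Q * `|t| `^ (Q - 1)).
Proof.
move=> Q2; have Q1 : 1 < Q - 1 by lra.
apply: (is_derive_eq (is_deriveM (is_derive_pow_norm t Q1) (is_derive_id t 1))).
rewrite /GRing.scale/= mulr1 -[in RHS](powR_norm_sqr t (a := Q - 1)) ?gt_eqF//; last by lra.
rewrite -[X in X + _](powR_norm_sqr t (a := Q - 1)) ?gt_eqF//; last by lra.
ring.
Qed.

(** A continuously differentiable surrogate of the power of exponent [b]: it
    vanishes to order [Q] at the origin, tends to the power as [dl] tends to
    zero when [c = 0], and is bounded by one when [c = 1]. *)
Definition rden dl c Q b t := dl + `|t| `^ (Q - b) + c * `|t| `^ Q.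
Definition reg dl c Q b t := spow t Q / rden dl c Q b t.
Definition reg' dl c Q b t :=
  `|t| `^ (Q - 1) * (Q * dl + b * `|t| `^ (Q - b)) / rden dl c Q b t ^+ 2.

Lemma norm_spow t m : m != 0 -> `|spow t m| = `|t| `^ m.
Proof.
move=> m0; rewrite /spow normrM ger0_norm ?powR_ge0//.
have [->|t0] := eqVneq t 0; first by rewrite normr0 mulr0 powR0.
have t'0 : 0 < `|t| by rewrite normr_gt0.
rewrite -{2}(powRr1 (normr_ge0 t)) -powRD ?subrK//.
by apply/implyP => _; rewrite gt_eqF.
Qed.

Lemma spow_spow t m Q : m != 0 -> spow (spow t m) Q = spow t (m * Q).
Proof.
move=> m0; rewrite {1}/spow norm_spow// -powRrM /spow.
have [->|t0] := eqVneq t 0; first by rewrite !mulr0.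
have t'0 : 0 < `|t| by rewrite normr_gt0.
rewrite mulrA -powRD; last by apply/implyP => _; rewrite gt_eqF.
by congr (_ `^ _ * _); ring.
Qed.

Lemma spow0 Q : spow 0 Q = 0 :> R.
Proof. by rewrite /spow mulr0. Qed.

(** The family is stable under composition with powers. Hence one and the same
    function of [u] is a differentiable function of every power of [u] whose
    derivative occurs in the equation. *)
Lemma reg_spow dl c Q b t m : m != 0 ->
  reg dl c Q b (spow t m) = reg dl c (m * Q) (m * b) t.
Proof.
move=> m0; rewrite /reg /rden spow_spow// norm_spow// -!powRrM.
by rewrite mulrBr.
Qed.

Section fixed.
Variables (dl c Q b : R).
Hypothesis ok : [/\ 0 < dl, 0 <= c, 2 < Q, 0 < b & 1 < Q - b].

Lemma rden_ge t : dl + `|t| `^ (Q - b) <= rden dl c Q b t.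
Proof. by have [_ c0 _ _ _] := ok; rewrite /rden lerDl mulr_ge0// powR_ge0. Qed.

Lemma rden_gt0 t : 0 < rden dl c Q b t.
Proof. by have [dl0 _ _ _ _] := ok; apply: lt_le_trans (rden_ge t); rewrite ltr_wpDr// powR_ge0. Qed.

Lemma is_derive_reg t : is_derive t (1 : R) (reg dl c Q b) (reg' dl c Q b t).
Proof.
have [dl0 c0 Q2 b0 Qb] := ok.
have Q1 : 1 < Q by lra.
have dden : is_derive t (1 : R) (rden dl c Q b)
   ((Q - b) * (`|t| `^ (Q - b - 2) * t) + c * (Q * (`|t| `^ (Q - 2) * t))).
  rewrite (_ : rden dl c Q b = cst dl + (fun t => `|t| `^ (Q - b)) + c \*: (fun t => `|t| `^ Q)); last first.
    by apply/funext => x.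
  apply: (is_derive_eq (is_deriveD (is_deriveD (is_derive_cst dl t 1)
    (is_derive_pow_norm t Qb)) (is_deriveZ c (is_derive_pow_norm t Q1)))).
  by rewrite add0r /GRing.scale/=.
have den0 := lt0r_neq0 (rden_gt0 t).
apply: (is_derive_eq (is_deriveM (is_derive_spow t Q2) (is_deriveV den0 dden))).
rewrite /GRing.scale /=.
have E1 : spow t Q * (`|t| `^ (Q - b - 2) * t) = `|t| `^ (Q - 1) * `|t| `^ (Q - b).
  rewrite /spow -(powR_norm_sqr t (a := Q - b)); first by ring.
  by rewrite gt_eqF//; lra.
have E2 : spow t Q * (`|t| `^ (Q - 2) * t) = `|t| `^ (Q - 1) * `|t| `^ Q.
  rewrite /spow -[in RHS](powR_norm_sqr t (a := Q)); first by ring.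
  by rewrite gt_eqF//; lra.
rewrite /reg'.
have -> : spow t Q * (- rden dl c Q b t ^- 2 * ((Q - b) * (`|t| `^ (Q - b - 2) * t) + c * (Q * (`|t| `^ (Q - 2) * t)))) =
  - rden dl c Q b t ^- 2 * ((Q - b) * (spow t Q * (`|t| `^ (Q - b - 2) * t)) + c * Q * (spow t Q * (`|t| `^ (Q - 2) * t))).
  by ring.
rewrite E1 E2.
have -> : (rden dl c Q b t)^-1 * (Q * `|t| `^ (Q - 1)) =
  Q * `|t| `^ (Q - 1) * rden dl c Q b t / rden dl c Q b t ^+ 2 by field.
rewrite {2}/rden; ring.
Qed.

Lemma reg'_ge0 t : 0 <= reg' dl c Q b t.
Proof.
have [dl0 c0 Q2 b0 Qb] := ok.
apply: divr_ge0; last by rewrite exprn_ge0// ltW// rden_gt0.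
apply: mulr_ge0; first exact: powR_ge0.
by apply: addr_ge0; apply: mulr_ge0; rewrite ?powR_ge0 ?ltW//; lra.
Qed.

Lemma continuous_reg' : continuous (reg' dl c Q b).
Proof.
have [dl0 c0 Q2 b0 Qb] := ok.
have cp a : 1 < a -> continuous (fun t : R => `|t| `^ a) by exact: continuous_pow_norm.
have cden : continuous (rden dl c Q b).
  move=> t; apply: cvgD; first by apply: cvgD; [exact: cvg_cst|exact: cp].
  by apply: cvgM; [exact: cvg_cst|apply: cp; lra].
move=> t; apply: cvgM; first apply: cvgM.
- by apply: cp; lra.
- by apply: cvgD; [exact: cvg_cst|apply: cvgM; [exact: cvg_cst|exact: cp]].
apply: cvgV; first by rewrite expf_neq0// gt_eqF// rden_gt0.
by apply: cvgM; exact: cden.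
Qed.

Lemma reg'_le t : reg' dl c Q b t <= Q * (`|t| `^ (Q - 1) / (dl + `|t| `^ (Q - b))).
Proof.
have [dl0 c0 Q2 b0 Qb] := ok.
have d0 : 0 < dl + `|t| `^ (Q - b) by rewrite ltr_wpDr// powR_ge0.
have P0 : 0 <= `|t| `^ (Q - 1) := powR_ge0 _ _.
have h1 : Q * dl + b * `|t| `^ (Q - b) <= Q * (dl + `|t| `^ (Q - b)).
  by rewrite mulrDr lerD2l ler_wpM2r ?powR_ge0//; lra.
rewrite /reg' -mulrA (mulrCA Q) ler_wpM2l//.
rewrite ler_pdivrMr ?exprn_gt0 ?rden_gt0// mulrAC ler_pdivlMr//.
apply: (@le_trans _ _ (Q * (dl + `|t| `^ (Q - b)) * (dl + `|t| `^ (Q - b)))).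
  by rewrite ler_wpM2r// ltW.
have Q0 : 0 <= Q by lra.
by rewrite -mulrA ler_wpM2l// expr2 ler_pM// ?(ltW d0)// rden_ge.
Qed.

Lemma reg'_le_pow t : t != 0 -> reg' dl c Q b t <= Q * `|t| `^ (b - 1).
Proof.
have [dl0 c0 Q2 b0 Qb] := ok.
move=> t0; apply: le_trans (reg'_le t) _.
have t'0 : 0 < `|t| by rewrite normr_gt0.
have d0 : 0 < dl + `|t| `^ (Q - b) by rewrite ltr_wpDr// powR_ge0.
rewrite ler_wpM2l//; first by lra.
rewrite ler_pdivrMr// mulrDr -powRD; last by apply/implyP => _; rewrite gt_eqF.
have -> : b - 1 + (Q - b) = Q - 1 by ring.
by rewrite lerDr mulr_ge0 ?powR_ge0// ltW.
Qed.

Lemma reg'_0 : reg' dl c Q b 0 = 0.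
Proof. by have [_ _ Q2 _ _] := ok; rewrite /reg' normr0 powR0 ?mul0r// gt_eqF//; lra. Qed.

Lemma reg_0 : reg dl c Q b 0 = 0.
Proof. by rewrite /reg spow0 mul0r. Qed.

Lemma reg'_bounded : b <= 1 -> exists L : R, forall t, `|reg' dl c Q b t| <= L.
Proof.
have [dl0 c0 Q2 b0 Qb] := ok.
move=> b1; exists (Q * (dl^-1 + 1)) => t; rewrite ger0_norm ?reg'_ge0//.
have [->|t0] := eqVneq t 0.
  rewrite reg'_0 mulr_ge0 ?addr_ge0 ?invr_ge0 ?ltW//; lra.
have t'0 : 0 < `|t| by rewrite normr_gt0.
have Q0 : 0 <= Q by lra.
have [t1|t1] := leP `|t| 1.
  apply: le_trans (reg'_le t) _; rewrite ler_wpM2l//.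
  have p1 : `|t| `^ (Q - 1) <= 1.
    by rewrite -[leRHS](powRr0 `|t|); apply: ger_powR; [rewrite t'0|lra].
  apply: ler_wpDr => //; rewrite ler_pdivrMr; last by rewrite ltr_wpDr// powR_ge0.
  apply: le_trans p1 _; rewrite mulrDr mulVf ?gt_eqF// lerDl.
  by rewrite mulr_ge0 ?powR_ge0// invr_ge0 ltW.
apply: le_trans (reg'_le_pow t0) _; rewrite ler_wpM2l//.
apply: ler_wpDl; first by rewrite invr_ge0 ltW.
by rewrite -[leRHS](powRr0 `|t|); apply: ler_powR; [exact: ltW|lra].
Qed.

Lemma reg_homo : {homo reg dl c Q b : x y / x <= y}.
Proof.
move=> x y xy; have [z _ E] := MVT_any is_derive_reg y x.
by rewrite -subr_ge0 E mulr_ge0 ?reg'_ge0// subr_ge0.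
Qed.

Lemma norm_regE t : `|reg dl c Q b t| = `|t| `^ Q / rden dl c Q b t.
Proof.
have [_ _ Q2 _ _] := ok; have Q0 : Q != 0 by rewrite gt_eqF//; lra.
by rewrite /reg normrM normfV norm_spow// (gtr0_norm (rden_gt0 t)).
Qed.

Lemma regN t : reg dl c Q b (- t) = - reg dl c Q b t.
Proof. by rewrite /reg /rden /spow normrN mulrN mulNr. Qed.

Lemma norm_reg_le1 t : c = 1 -> `|reg dl c Q b t| <= 1.
Proof.
have [dl0 _ _ _ _] := ok; move=> c1; rewrite norm_regE ler_pdivrMr ?rden_gt0// mul1r.
by rewrite /rden c1 mul1r lerDr addr_ge0 ?powR_ge0// ltW.
Qed.

Lemma norm_reg_le_pow t : `|reg dl c Q b t| <= `|t| `^ b.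
Proof.
have [dl0 c0 Q2 b0 Qb] := ok.
have [->|t0] := eqVneq t 0; first by rewrite reg_0 normr0 powR_ge0.
rewrite norm_regE ler_pdivrMr ?rden_gt0//.
have t'0 : 0 < `|t| by rewrite normr_gt0.
have -> : `|t| `^ Q = `|t| `^ b * `|t| `^ (Q - b).
  rewrite -powRD; last by apply/implyP => _; rewrite gt_eqF.
  by congr powR; ring.
rewrite ler_wpM2l ?powR_ge0//; apply: le_trans (rden_ge t).
by rewrite lerDr ltW.
Qed.

(** On the unit interval the denominator is of the size of its first two
    terms. *)
Lemma reg'_ge t : c = 1 -> `|t| <= 1 ->
  b / 4 * (`|t| `^ (Q - 1) / (dl + `|t| `^ (Q - b))) <= reg' dl c Q b t.
Proof.
have [dl0 c0 Q2 b0 Qb] := ok; move=> c1 t1.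
have P0 : 0 <= `|t| `^ (Q - 1) := powR_ge0 _ _.
set A := dl + `|t| `^ (Q - b).
have A0 : 0 < A by rewrite ltr_wpDr// powR_ge0.
have dA : rden dl c Q b t <= 2 * A.
  rewrite /rden c1 mul1r -/A mulr_natl mulr2n lerD2l /A.
  apply: (@le_trans _ _ (`|t| `^ (Q - b))); last by rewrite lerDr ltW.
  have [->|t0] := eqVneq t 0; first by rewrite normr0 powR0 ?powR_ge0// gt_eqF//; lra.
  by apply: ger_powR; [rewrite normr_gt0 t0|lra].
have nA : b * A <= Q * dl + b * `|t| `^ (Q - b).
  by rewrite /A mulrDr lerD2r ler_wpM2r ?ltW//; lra.
rewrite /reg'.
have -> : b / 4 * (`|t| `^ (Q - 1) / A) = `|t| `^ (Q - 1) * (b / 4 / A) by ring.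
rewrite -[leRHS]mulrA; apply: ler_wpM2l => //.
rewrite ler_pdivlMr ?exprn_gt0 ?rden_gt0//; apply: le_trans nA.
apply: (@le_trans _ _ (b / 4 / A * (2 * A) ^+ 2)).
  apply: ler_wpM2l; first by rewrite divr_ge0 ?(ltW A0)// divr_ge0// ltW.
  by rewrite ler_sqr ?nnegrE// ?(ltW (rden_gt0 t))// mulr_ge0// ltW.
by rewrite le_eqVlt; apply/orP; left; apply/eqP; field; rewrite gt_eqF.
Qed.

End fixed.

Definition nharm (n : nat) : R := n.+1%:R^-1.

Lemma nharm_gt0 n : 0 < nharm n. Proof. by rewrite invr_gt0. Qed.

Lemma nharm_cvg0 : nharm @ \oo --> (0 : R).
Proof. exact: cvg_harmonic. Qed.

Lemma cvg_den_pow Q b t : 0 < b -> t != 0 ->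
  (fun n => nharm n + `|t| `^ (Q - b)) @ \oo --> `|t| `^ (Q - b).
Proof.
move=> b0 t0; rewrite -[X in _ --> X]add0r.
by apply: cvgD; [exact: nharm_cvg0|exact: cvg_cst].
Qed.

Lemma cvg_quot_pow Q b t : 0 < b -> t != 0 ->
  (fun n => `|t| `^ (Q - 1) / (nharm n + `|t| `^ (Q - b))) @ \oo --> `|t| `^ (b - 1).
Proof.
move=> b0 t0; have t'0 : 0 < `|t| by rewrite normr_gt0.
have -> : `|t| `^ (b - 1) = `|t| `^ (Q - 1) / `|t| `^ (Q - b).
  rewrite -powRN -powRD; last by apply/implyP => _; rewrite gt_eqF.
  by congr powR; ring.
apply: cvgM; first exact: cvg_cst.
by apply: cvgV; [rewrite gt_eqF// powR_gt0|exact: cvg_den_pow].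
Qed.

Lemma cvg_reg0 Q b t : 2 < Q -> 0 < b -> 
  (fun n => reg (nharm n) 0 Q b t) @ \oo --> spow t b.
Proof.
move=> Q2 b0; have [->|t0] := eqVneq t 0.
  by rewrite spow0; apply: cvg_near_cst; near=> n; rewrite /reg spow0 mul0r.
have t'0 : 0 < `|t| by rewrite normr_gt0.
have -> : spow t b = spow t Q / `|t| `^ (Q - b).
  rewrite /spow -powRN mulrAC -powRD; last by apply/implyP => _; rewrite gt_eqF.
  by congr (_ `^ _ * _); ring.
rewrite (_ : (fun n => _) = fun n => spow t Q / (nharm n + `|t| `^ (Q - b))).
  apply: cvgM; first exact: cvg_cst.
  by apply: cvgV; [rewrite gt_eqF// powR_gt0|exact: cvg_den_pow].
by apply/funext => n; rewrite /reg /rden mul0r addr0.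
Unshelve. all: by end_near. Qed.

Lemma cvg_reg'0 Q b t : 2 < Q -> 0 < b ->
  (fun n => reg' (nharm n) 0 Q b t) @ \oo -->
    (if t == 0 then 0 else b * `|t| `^ (b - 1)).
Proof.
move=> Q2 b0; have [->|t0] := eqVneq t 0.
  apply: cvg_near_cst; near=> n.
  by rewrite /reg' normr0 powR0 ?mul0r// gt_eqF//; lra.
have t'0 : 0 < `|t| by rewrite normr_gt0.
rewrite (_ : (fun n => _) = fun n => `|t| `^ (Q - 1) / (nharm n + `|t| `^ (Q - b)) *
   ((Q * nharm n + b * `|t| `^ (Q - b)) / (nharm n + `|t| `^ (Q - b)))).
  rewrite [X in _ --> X]mulrC; apply: cvgM; first exact: cvg_quot_pow.
  have bE : b = (Q * 0 + b * `|t| `^ (Q - b)) / `|t| `^ (Q - b).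
    by rewrite mulr0 add0r mulfK// gt_eqF// powR_gt0.
  rewrite [X in _ --> X]bE; apply: cvgM.
    apply: cvgD; last exact: cvg_cst.
    by apply: cvgM; [exact: cvg_cst|exact: nharm_cvg0].
  by apply: cvgV; [rewrite gt_eqF// powR_gt0|exact: cvg_den_pow].
apply/funext => n; rewrite /reg' /rden mul0r addr0.
have n0 : nharm n + `|t| `^ (Q - b) != 0.
  by rewrite gt_eqF// addr_gt0 ?nharm_gt0 ?powR_gt0.
by field.
Unshelve. all: by end_near. Qed.

End powers.

Section convex_primitive.
Context (R : realType).
Local Notation leb := (@lebesgue_measure R).

(** The primitive of an odd nondecreasing function is even and convex, and the
    first inequality is that of its tangents. *)
Lemma convex_primitive (h : R -> R) : {homo h : x y / x <= y} ->
  (forall x, h (- x) = - h x) -> (forall x, `|h x| <= 1) ->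
  exists H : R -> R, [/\ forall a b, H a - H b <= h a * (a - b),
    forall a, 0 <= H a <= `|a| & continuous H].
Proof.
move=> hh hN h1.
have mh : measurable_fun setT (h : measurableTypeR R -> R).
  exact: nondecreasing_measurable.
have h0 : h 0 = 0 by have := hN 0; rewrite oppr0 => /eqP; rewrite -addr_eq0 -mulr2n mulrn_eq0 => /eqP.
have hge0 x : 0 <= x -> 0 <= h x by move=> /hh; rewrite h0.
have fin (i : interval R) : (leb [set` i] < +oo)%E -> leb.-integrable [set` i] (EFin \o h).
  move=> li; have mi : measurable ([set` i] : set (measurableTypeR R)) by exact: measurable_itv.
  apply: measurable_bounded_integrable => //; first exact: measurable_funTS.
  by exists 1; split=> // m m1 t _ /=; exact: le_trans (h1 t) (ltW m1).
have lebcc (a b : R) (x y : bool) : a <= b -> leb [set` Interval (BSide x a) (BSide y b)] = (b - a)%:E.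
  move=> ab; rewrite lebesgue_measure_itv/= lte_fin -EFinB; case: ltP => // ba.
  by rewrite (@le_anti _ _ a b) ?ab// subrr.
have ibd (a b : R) (x y : bool) : a <= b -> leb.-integrable [set` Interval (BSide x a) (BSide y b)] (EFin \o h).
  by move=> ab; apply: fin; rewrite lebcc// ltry.
pose F x := \int[leb]_(t in `[0, x]) h t.
have FB x y : 0 <= y -> y <= x -> h y * (x - y) <= F x - F y /\ F x - F y <= h x * (x - y).
  move=> y0 yx; have x0 := le_trans y0 yx.
  rewrite /F Rintegral_itvB ?bnd_simp//; last exact: ibd.
  have mi : measurable (`]y, x]%classic : set (measurableTypeR R)) by exact: measurable_itv.
  have ic (k : R) : leb.-integrable (`]y, x]%classic : set (measurableTypeR R)) (EFin \o cst k).
    apply: measurable_bounded_integrable => //; first by rewrite [X in (X < _)%E]lebcc// ltry.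
    by exists `|k|; split=> // m km t _ /=; exact: ltW.
  have cE (k : R) : \int[leb]_(t in `]y, x]) k = k * (x - y).
    by rewrite Rintegral_cst//= [X in fine X]lebcc.
  split; rewrite -cE; apply: le_Rintegral => //; try exact: ibd; try exact: ic.
    by move=> t; rewrite /= in_itv/= => /andP[yt _]; apply: hh; exact: ltW.
  by move=> t; rewrite /= in_itv/= => /andP[_ tx]; exact: hh.
have FBg x y : 0 <= x -> 0 <= y -> F x - F y <= h x * (x - y).
  move=> x0 y0; have [yx|xy] := leP y x; first by have [] := FB _ _ y0 yx.
  have [+ _] := FB _ _ x0 (ltW xy).
  by rewrite -lerN2 opprB -mulrN opprB.
have F0 : F 0 = 0 by rewrite /F set_itv1 Rintegral_set1.
pose H (x : R) := F `|x|.
have sub a b : H a - H b <= h a * (a - b).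
  apply: le_trans (FBg _ _ (normr_ge0 a) (normr_ge0 b)) _.
  have ha : h a * a = h `|a| * `|a|.
    by have [a0|a0] := leP 0 a; rewrite ?(ger0_norm a0)// ltr0_norm// hN mulrNN.
  have hab : h a * b <= h `|a| * `|b|.
    apply: le_trans (ler_norm _) _; rewrite normrM ler_wpM2r//.
    have [a0|a0] := leP 0 a; first by rewrite !(ger0_norm a0) ger0_norm ?hge0.
    have h'0 : 0 <= - h a by rewrite -hN hge0// oppr_ge0 ltW.
    by rewrite (ltr0_norm a0) hN ler0_norm// -oppr_ge0.
  by rewrite !mulrBr ha lerD2l lerN2.
have lip a b : H a - H b <= `|a - b|.
  apply: le_trans (sub a b) _; apply: le_trans (ler_norm _) _.
  by rewrite normrM ler_piMl.
exists H; split => //.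
- move=> a; apply/andP; split.
    have := FB _ _ (lexx 0) (normr_ge0 a); rewrite h0 mul0r F0 subr0.
    by case.
  by have := lip a 0; rewrite /H normr0 F0 !subr0.
move=> x; apply/cvgrPdist_le => e e0; near=> y.
have xy : `|x - y| <= e by near: y; apply: cvgr_dist_le.
apply: le_trans xy; rewrite ler_norml lip andbT.
by rewrite -lerN2 opprK opprB distrC lip.
Unshelve. all: by end_near. Qed.

End convex_primitive.

(** * The energy estimate *)

Section energy.
Context (R : realType) (N : nat).
Local Notation E := ('rV[R]_N * R)%type.
Local Notation X := ('rV[R]_N * measurableTypeR R)%type.
Local Notation mu := (lam R N).

Lemma Rint_mul_bdd (f phi : X -> R) (B k : R) : measurable_fun setT phi ->
  (forall z, `|phi z| <= B) -> integ mu f -> (nrm1 mu f <= k%:E)%E ->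
  `|\int[mu]_z (phi z * f z)| <= B * k.
Proof.
move=> mphi hB fi fk; have B0 : 0 <= B by apply: le_trans (hB 0).
have ii : integ mu (fun z => phi z * f z) by exact: (@integM_bdd _ _ _ _ _ _ B).
have /integP[mf _] := fi.
rewrite -lee_fin; apply: le_trans (Rint_le_nrm1 ii) _.
apply: (@le_trans _ _ (nrm1 mu (fun z => B * f z)%R)).
  apply: nrm1_le; [by have /integP[] := ii|exact: measurable_funM|].
  by move=> z; rewrite !normrM ler_wpM2r// (le_trans (hB z))// ler_norm.
by rewrite nrm1Z// ger0_norm// EFinM lee_wpmul2l.
Qed.

Lemma sm_derive_bdd (K : E -> R) (r : R) (v : E) : 0 < r -> sm K ->
  avg_kernel r (K : X -> R) -> exists M : R, forall y, `|'D_v K y| <= M.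
Proof.
move=> r0 sK aK.
have [_ cS _] := kernel_test (z0 := 0) r0 sK aK (D := setT) (fun _ _ => I).
have E0 : [set z : E | K (z - 0) != 0] = [set z | K z != 0].
  by apply/seteqP; split=> z; rewrite /= subr0.
rewrite E0 in cS.
have [B _ hB] := bounded_support cS (sm_continuous (sm_derive v sK))
  (@derive_support R N K v).
by exists B.
Qed.

Lemma test_function_mul (D : set E) (psi kap : E -> R) :
  test_function D psi -> sm psi -> sm kap ->
  test_function D (fun z => psi z * kap z).
Proof.
move=> [_ cS SD] spsi skap.
have sub : closure [set z | psi z * kap z != 0] `<=` closure [set z | psi z != 0].
  apply: closure_subset => z /=; apply: contra => /eqP ->; by rewrite mul0r.
split; first exact: sm_smooth (sm_mul spsi skap).
  by apply: subclosed_compact sub => //; exact: closed_closure.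
exact: subset_trans SD.
Qed.

Section one_direction.
Variables (D : set E) (e : option 'I_N) (v w : X -> R) (G G1 : R -> R) (L : R).
Variables (psi : E -> R).
Hypotheses (oD : open D) (iv : integ mu v) (iw : integ mu w).
Hypothesis hw : forall phi, sm phi -> test_function D phi ->
    \int[mu]_z (v z * 'D_(edir R e) phi z) = - \int[mu]_z (w z * phi z).
Hypotheses (dG : forall t, is_derive t (1 : R) G (G1 t)) (cG1 : continuous G1).
Hypotheses (GL : forall t, `|G1 t| <= L) (G00 : G 0 = 0).
Hypotheses (spsi : sm psi) (tpsi : test_function D psi).

(** The weak derivative of [psi * G v], by the chain and product rules. *)
Definition cut_derive (z : X) : R :=
  psi z * G1 (v z) * w z + G (v z) * 'D_(edir R e) psi z.

Lemma cutoff_bdd : exists2 B : R, 0 <= B & forall z, `|psi z| <= B /\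
  forall i, `|'D_(edir R i) psi z| <= B.
Proof.
have [_ cS _] := tpsi.
have [B B0 hB] := bounded_support cS (sm_continuous spsi) (@support_eq0 _ _ psi).
have /choice[b hb] i : exists b : R, 0 <= b /\ forall z, `|'D_(edir R i) psi z| <= b.
  have [b b0 hb] := bounded_support cS (sm_continuous (sm_derive (edir R i) spsi))
    (@derive_support R N psi (edir R i)).
  by exists b.
have sb0 : 0 <= \sum_i b i by apply: sumr_ge0 => i _; have [] := hb i.
exists (B + \sum_i b i) => [|z]; first exact: addr_ge0.
split; first by apply: ler_wpDr.
move=> i; have [b0 hi] := hb i; apply: le_trans (hi z) _.
apply: ler_wpDl => //; rewrite (bigD1 i)//= lerDl; apply: sumr_ge0 => k _.
by have [] := hb k.
Qed.

Lemma integ_Gv : integ mu (fun z => G (v z)).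
Proof.
have /integP[mv _] := iv.
apply: (@integ_le _ _ _ _ _ (fun z => L * v z)).
- apply: continuous_C1_measurable => // t.
  apply: differentiable_continuous; apply/derivable1_diffP.
  by have [] := dG t.
- exact: integZ.
- have L0 : 0 <= L by apply: le_trans (GL 0).
  move=> z; rewrite -[G _]subr0 -G00; have [x _ ->] := MVT_any dG (v z) 0.
  by rewrite subr0 !normrM ler_wpM2r// (le_trans (GL x))// ler_norm.
Qed.

Lemma measurable_G1v : measurable_fun setT (fun z => G1 (v z)).
Proof. by have /integP[mv _] := iv; exact: continuous_C1_measurable. Qed.

Lemma integ_cut_derive : integ mu cut_derive.
Proof.
have [B B0 hB] := cutoff_bdd.
have L0 : 0 <= L by apply: le_trans (GL 0).
apply: integD.
  apply: (@integM_bdd _ _ _ _ _ _ (B * L)) => //.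
    by apply: measurable_funM; [exact: measurable_sm|exact: measurable_G1v].
  by move=> z; rewrite normrM ler_pM//; have [] := hB z.
rewrite (_ : (fun z => _) = fun z => 'D_(edir R e) psi z * G (v z)); last first.
  by apply/funext => z; rewrite mulrC.
apply: (@integM_bdd _ _ _ _ _ _ B); [exact: measurable_sm (sm_derive _ spsi)|exact: integ_Gv|].
by move=> z; have [] := hB z.
Qed.

(** Multiplied by [psi], any [kap] becomes a test function on [D]; in particular
    [kap] may be a kernel centred anywhere. *)
Lemma weak_derive_cutoff (kap : E -> R) (B : R) : sm kap ->
  (forall z, `|kap z| <= B) -> (forall z, `|'D_(edir R e) kap z| <= B) ->
  \int[mu]_z (psi z * G (v z) * 'D_(edir R e) kap z) =
  - \int[mu]_z (cut_derive z * kap z).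
Proof.
move=> skap kB DkB.
have [Bp Bp0 hBp] := cutoff_bdd.
have B0 : 0 <= B by apply: le_trans (kB 0).
have L0 : 0 <= L by apply: le_trans (GL 0).
have ttest := test_function_mul tpsi spsi skap.
have := chain_rule oD iv iw hw dG cG1 GL G00 ttest.
have DE z : 'D_(edir R e) (fun z => psi z * kap z) z =
    psi z * 'D_(edir R e) kap z + kap z * 'D_(edir R e) psi z.
  by rewrite deriveM//; exact: sm_derivable.
have bddi (b : X -> R) (M : R) : measurable_fun setT b -> (forall z, `|b z| <= M) ->
    integ mu (fun z => b z * G (v z)).
  by move=> mb bM; apply: (@integM_bdd _ _ _ _ _ _ M) => //; exact: integ_Gv.
have mk := measurable_sm skap; have mp := measurable_sm spsi.
have mDk := measurable_sm (sm_derive (edir R e) skap).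
have mDp := measurable_sm (sm_derive (edir R e) spsi).
have i1 : integ mu (fun z => psi z * G (v z) * 'D_(edir R e) kap z).
  rewrite (_ : (fun z => _) = fun z => psi z * 'D_(edir R e) kap z * G (v z)); last first.
    by apply/funext => z; ring.
  apply: (bddi _ (Bp * B)) => [|z]; first exact: measurable_funM.
  by rewrite normrM ler_pM//; have [] := hBp z.
have i2 : integ mu (fun z => G (v z) * 'D_(edir R e) psi z * kap z).
  rewrite (_ : (fun z => _) = fun z => kap z * 'D_(edir R e) psi z * G (v z)); last first.
    by apply/funext => z; ring.
  apply: (bddi _ (B * Bp)) => [|z]; first exact: measurable_funM.
  by rewrite normrM ler_pM//; have [] := hBp z.
have i3 : integ mu (fun z => psi z * G1 (v z) * w z * kap z).
  rewrite (_ : (fun z => _) = fun z => psi z * G1 (v z) * kap z * w z); last first.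
    by apply/funext => z; ring.
  apply: (@integM_bdd _ _ _ _ _ _ (Bp * L * B)) => //.
    by apply: measurable_funM => //; apply: measurable_funM => //; exact: measurable_G1v.
  by move=> z; rewrite normrM ler_pM// normrM ler_pM//; have [] := hBp z.
have -> : \int[mu]_z (G (v z) * 'D_(edir R e) (fun z => psi z * kap z) z) =
    \int[mu]_z (psi z * G (v z) * 'D_(edir R e) kap z) +
    \int[mu]_z (G (v z) * 'D_(edir R e) psi z * kap z).
  by rewrite -RintegralD//; apply: eq_Rintegral => z _; rewrite DE; ring.
have -> : \int[mu]_z (cut_derive z * kap z) =
    \int[mu]_z (psi z * G1 (v z) * w z * kap z) +
    \int[mu]_z (G (v z) * 'D_(edir R e) psi z * kap z).
  by rewrite -RintegralD//; apply: eq_Rintegral => z _; rewrite /cut_derive; ring.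
have -> : \int[mu]_z (G1 (v z) * w z * (psi z * kap z)) =
    \int[mu]_z (psi z * G1 (v z) * w z * kap z).
  by apply: eq_Rintegral => z _; ring.
by move=> H; rewrite opprD -H; ring.
Qed.

(** Testing the flux term with a kernel and averaging against the cutoff of
    [G v] moves the derivative from the kernel onto [G v]. *)
Lemma flux_kernel (A : X -> R) (K : E -> R) (r : R) : integ mu A -> 0 < r -> sm K ->
  avg_kernel r (K : X -> R) ->
  \int[mu]_z0 (psi z0 * G (v z0) *
     \int[mu]_z (A z * 'D_(edir R e) K (transl (- (z0 : E)) z))) =
  \int[mu]_z (cut_derive z * conv A K z).
Proof.
move=> iA r0 sK aK.
have [M KM] := avg_kernel_bdd aK.
have [M' KM'] := sm_derive_bdd (edir R e) r0 sK aK.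
have mK := measurable_sm sK; have mDK := measurable_sm (sm_derive (edir R e) sK).
have [Bp Bp0 hBp] := cutoff_bdd.
have ip : integ mu (fun z => psi z * G (v z)).
  apply: (@integM_bdd _ _ _ _ _ _ Bp); [exact: measurable_sm|exact: integ_Gv|].
  by move=> z; have [] := hBp z.
rewrite (kernel_fubini iA ip mDK KM').
transitivity (\int[mu]_z (A z * \int[mu]_z0 (cut_derive z0 * K (transl (- (z0 : E)) z)))).
  apply: eq_Rintegral => z _; congr (_ * _).
  have KB : forall z0 : E, `|K (z - z0)| <= Num.max M M'.
    by move=> z0; rewrite le_max KM.
  have DKB : forall z0 : E, `|'D_(edir R e) (fun z0 => K (z - z0)) z0| <= Num.max M M'.
    by move=> z0; rewrite derive_reflect// normrN le_max KM' orbT.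
  have := weak_derive_cutoff (sm_reflect z sK) KB DKB.
  have -> : \int[mu]_z0 (psi z0 * G (v z0) * 'D_(edir R e) (fun z0 => K (z - z0)) z0) =
      - \int[mu]_z0 (psi z0 * G (v z0) * 'D_(edir R e) K (transl (- (z0 : E)) z)).
    rewrite -[RHS]mulN1r -RintegralZl//; last first.
      rewrite (_ : (EFin \o _) = EFin \o (fun z0 => 'D_(edir R e) K (z - z0) * (psi z0 * G (v z0)))).
        apply: (@integM_bdd _ _ _ _ _ _ M') => //.
        exact: measurable_sm (sm_reflect z (sm_derive _ sK)).
      by apply/funext => z0 /=; rewrite mulrC.
    by apply: eq_Rintegral => z0 _; rewrite derive_reflect// /transl; ring.
  by move/oppr_inj.
rewrite -(kernel_fubini iA integ_cut_derive mK KM).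
by apply: eq_Rintegral => z0 _; rewrite (conv_kernel z0 iA mK KM).
Qed.

(** The flux is integrable to the exponent dual to that of [w] only, whence the
    convergence of its averages is in duality with [w]. *)
Lemma flux_limit (A : X -> R) (p q k : R) : 0 < p -> 0 < q -> q^-1 + p^-1 = 1 ->
  integ mu A -> integ mu (fun z => `|A z| `^ q) ->
  integ mu (fun z => `|w z| `^ p) -> (forall z, `|G (v z)| <= 1) -> 0 < k ->
  integ mu (fun z => A z * cut_derive z) /\
  exists2 d : R, 0 < d & forall (K : E -> R) (r : R), 0 < r -> r <= d ->
    avg_kernel r (K : X -> R) ->
    `|\int[mu]_z (cut_derive z * conv A K z) - \int[mu]_z (A z * cut_derive z)| <= k.
Proof.
move=> p0 q0 pq iA iAq iwp G1le k0.
have [B B0 hB] := cutoff_bdd; have L0 : 0 <= L by apply: le_trans (GL 0).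
have /integP[mA _] := iA; have /integP[mw _] := iw.
have /integP[mGv _] := integ_Gv; have /integP[mcd _] := integ_cut_derive.
have mG1 := measurable_G1v; have mp := measurable_sm spsi.
have mDp := measurable_sm (sm_derive (edir R e) spsi).
have iAw := integ_dual_mul p0 q0 pq iA iw iAq iwp.
have c1B z : `|psi z * G1 (v z)| <= B * L by rewrite normrM ler_pM//; have [] := hB z.
have c2B z : `|G (v z) * 'D_(edir R e) psi z| <= B.
  rewrite normrM; apply: le_trans (_ : 1 * `|'D_(edir R e) psi z| <= _).
    by rewrite ler_wpM2r.
  by rewrite mul1r; have [] := hB z.
have iAc : integ mu (fun z => A z * cut_derive z).
  rewrite (_ : (fun z => _) = fun z => psi z * G1 (v z) * (A z * w z) +
      G (v z) * 'D_(edir R e) psi z * A z); last first.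
    by apply/funext => z; rewrite /cut_derive; ring.
  apply: integD.
    by apply: (@integM_bdd _ _ _ _ _ _ (B * L)) => //; exact: measurable_funM.
  by apply: (@integM_bdd _ _ _ _ _ _ B) => //; exact: measurable_funM.
split => //.
have BL0 : 0 <= B * L by rewrite mulr_ge0.
have k1 : 0 < k / 2 / (B * L + 1) by rewrite !divr_gt0// ltr_wpDl.
have k2 : 0 < k / 2 / (B + 1) by rewrite !divr_gt0// ltr_wpDl.
have [d1 d10 hd1] := shift_dual_mul p0 q0 pq iA iw iAq iwp k1.
have [d2 d20 hd2] := tcont_integ iA k2.
exists (Num.min d1 d2); first by rewrite lt_min d10.
move=> K r r0 rd aK.
have mdiff y : measurable_fun setT (fun z => translate y A z - A z).
  by apply: measurable_funB => //; exact: measurable_shift_fun.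
have key : (nrm1 mu (fun z => (conv A K z - A z) * cut_derive z)%R <= k%:E)%E.
  apply: (approx_identity iA mcd aK) => y yr.
  have yd : `|y| < Num.min d1 d2 by exact: lt_le_trans rd.
  move: yd; rewrite lt_min => /andP[y1 y2].
  pose f1 z := B * L * ((translate y A z - A z) * w z).
  pose f2 z := B * (translate y A z - A z).
  apply: le_trans (@nrm1_leD _ _ _ mu _ f1 f2 _ _ _ _) _.
  - exact: measurable_funM.
  - by apply: measurable_funM => //; exact: measurable_funM.
  - exact: measurable_funM.
  - move=> z; rewrite /f1 /f2 /cut_derive mulrDr (le_trans (ler_normD _ _))//; apply: lerD.
      rewrite mulrCA (normrM (psi z * _)) (normrM (B * L)); apply: ler_wpM2r => //.
      by rewrite (le_trans (c1B z))// ler_norm.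
    rewrite mulrC normrM (normrM B); apply: ler_wpM2r => //.
    by rewrite (le_trans (c2B z))// ler_norm.
  rewrite (splitr k) EFinD; apply: leeD; apply: nrm1Z_le => //.
  - by rewrite divr_ge0// ltW.
  - exact: measurable_funM.
  - exact: hd1.
  - by rewrite divr_ge0// ltW.
  - exact: hd2.
have mc : measurable_fun setT (conv A K).
  by apply: measurable_conv => //; exact: avg_kernel_integ aK.
have ic : integ mu (fun z => (conv A K z - A z) * cut_derive z).
  apply/integP; split; last by apply: le_lt_trans key _; rewrite ltry.
  by apply: measurable_funM => //; exact: measurable_funB.
apply: nrm1_RintM => //.
  rewrite (_ : (fun z => _) = fun z => (conv A K z - A z) * cut_derive z + A z * cut_derive z).
    exact: integD.
  by apply/funext => z; ring.
by move: key; congr (nrm1 mu _ <= _)%E; apply/funext => z; ring.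
Qed.

End one_direction.

(** Convexity bounds the integrand below by the increment of [H u], and a change
    of variable moves the increment onto [psi]. *)
Lemma time_term (u : X -> R) (psi : E -> R) (h H : R -> R) (B l : R) :
  integ mu u -> sm psi -> (forall z, 0 <= psi z <= B) ->
  (forall z, `|'D_(edir R None) psi z| <= B) ->
  continuous h -> (forall t, `|h t| <= 1) ->
  (forall a b, H a - H b <= h a * (a - b)) -> (forall a, 0 <= H a <= `|a|) ->
  continuous H -> 0 < l ->
  - (l * B * fine (nrm1 mu u)) <=
  \int[mu]_z (psi z * h (u z) * (u z - translate (- (l *: edir R None)) u z)).
Proof.
move=> iu spsi psiB DpsiB ch h1 subg H0 cH l0.
have /integP[mu_ _] := iu.
set y : E := l *: edir R None.
have B0 : 0 <= B by apply: le_trans (DpsiB 0).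
have nB z : `|psi z| <= B by have /andP[p0 pB] := psiB z; rewrite ger0_norm.
have mp := measurable_sm spsi.
have iH : integ mu (fun z => H (u z)).
  apply: (@integ_le _ _ _ _ _ u) => //; first exact: continuous_C1_measurable.
  by move=> z; have /andP[h0 hle] := H0 (u z); rewrite ger0_norm.
have iHs : integ mu (translate (- y) (fun z => H (u z))) by exact: integ_shift.
have ipH : integ mu (fun z => psi z * H (u z)) by exact: (@integM_bdd _ _ _ _ _ _ B).
have ipHs : integ mu (fun z => psi z * translate (- y) (fun z => H (u z)) z).
  exact: (@integM_bdd _ _ _ _ _ _ B).
have ipyH : integ mu (fun z => translate y psi z * H (u z)).
  apply: (@integM_bdd _ _ _ _ _ _ B) => //; first exact: measurable_shift_fun.
  by move=> z; exact: nB.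
have ius : integ mu (fun z => u z - translate (- y) u z).
  by apply: integB => //; exact: integ_shift.
have ph : forall z, `|psi z * h (u z)| <= B.
  move=> z; rewrite normrM; apply: le_trans (_ : `|psi z| * 1 <= _).
    by rewrite ler_wpM2l.
  by rewrite mulr1.
apply: (@le_trans _ _ (\int[mu]_z (psi z * H (u z) - psi z * translate (- y) (fun z => H (u z)) z))).
  rewrite RintegralB//.
  have -> : \int[mu]_z (psi z * translate (- y) (fun z => H (u z)) z) =
      \int[mu]_z (translate y psi z * H (u z)).
    rewrite -(Rint_shift (- y) ipyH); apply: eq_Rintegral => z _.
    by rewrite /translate /transl /= subrK.
  rewrite -RintegralB//.
  have -> : \int[mu]_z (psi z * H (u z) - translate y psi z * H (u z)) =
      - \int[mu]_z ((translate y psi z - psi z) * H (u z)).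
    rewrite -[RHS]mulN1r -RintegralZl//; last first.
      rewrite (_ : EFin \o _ = EFin \o (fun z => translate y psi z * H (u z) - psi z * H (u z))).
        exact: integB.
      by apply/funext => z /=; rewrite mulrBl.
    by apply: eq_Rintegral => z _; ring.
  rewrite lerN2; apply: le_trans (ler_norm _) _.
  rewrite -mulrA mulrA; apply: Rint_mul_bdd => //.
  - by apply: measurable_funB => //; exact: measurable_shift_fun.
  - have dp z : derivable psi z (edir R None) by exact: sm_derivable.
    move=> z; have := derive_bound dp DpsiB z l0.
    rewrite normrM normfV (gtr0_norm l0) ler_pdivrMl//.
  - rewrite nrm1_fineK//; apply: nrm1_le => //.
      by have /integP[] := iH.
    by move=> z; have /andP[h0 hle] := H0 (u z); rewrite ger0_norm.
apply: le_Rintegral => //.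
- exact: (integB ipH ipHs).
- apply: (@integM_bdd _ _ _ _ _ _ B) => //.
  by apply: measurable_funM => //; exact: continuous_C1_measurable.
move=> z _; have /andP[p0 _] := psiB z.
by rewrite -mulrBr -mulrA ler_wpM2l//; exact: subg.
Qed.

End energy.

Section energy_estimate.
Context (R : realType) (N : nat).
Local Notation E := ('rV[R]_N * R)%type.
Local Notation X := ('rV[R]_N * measurableTypeR R)%type.
Local Notation mu := (lam R N).

Lemma integ_bdd_ball (f : X -> R) (r M : R) : 0 < r -> measurable_fun setT f ->
  (forall z, `|f z| <= M) -> (forall z : E, f z != 0 -> `|z| < r) -> integ mu f.
Proof.
move=> r0 mf fM fr; have mb := measurable_ball_xt (0 : E) r.
apply: (@integ_le _ _ _ _ _ (fun z => M * \1_(ball (0 : E) r : set X) z)) => //.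
  by apply: integZ; apply: integ_indic => //; exact: lam_ball_lty.
move=> z; have [->|fz] := eqVneq (f z) 0; first by rewrite normr0.
rewrite indicE mem_set ?mulr1; first by rewrite (le_trans (fM z))// ler_norm.
by rewrite -ball_normE /ball_/= sub0r normrN; exact: fr.
Qed.

Lemma integ_derive_kernel (K : E -> R) (r : R) (v : E) : 0 < r -> sm K ->
  avg_kernel r (K : X -> R) -> integ mu ('D_v K : X -> R).
Proof.
move=> r0 sK aK.
have [M KM] := sm_derive_bdd v r0 sK aK.
pose D : set E := [set z | forall i, `|crd i (z - 0)| <= r].
have [_ _ SD] := kernel_test (z0 := 0) r0 sK aK (D := D) (fun _ h => h).
have r1 : 0 < r + 1 by rewrite ltr_wpDr.
apply: (@integ_bdd_ball _ (r + 1) M) => //.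
  exact: measurable_sm (sm_derive _ sK).
move=> z Dz; apply/norm_crdP => // i.
suff /(_ i) : D z by rewrite subr0 => h; rewrite (le_lt_trans h)// ltrDl.
apply: SD; apply: contrapT => nz; move/eqP: Dz; apply.
apply: derive_support => c; apply: nz; move: c; congr (closure _ z).
by apply/seteqP; split=> y; rewrite /= subr0.
Qed.

Lemma conv_bdd (a K : X -> R) (M : R) (z : X) : integ mu a ->
  measurable_fun setT K -> (forall y, `|K y| <= M) ->
  `|conv a K z| <= M * fine (nrm1 mu a).
Proof.
move=> ia mK KM.
have -> : conv a K z = \int[mu]_y (K y * translate z a y).
  by apply: eq_Rintegral => y _; rewrite mulrC.
apply: Rint_mul_bdd => //; first exact: integ_shift.
by have /integP[ma _] := ia; rewrite nrm1_shift// nrm1_fineK.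
Qed.

Lemma integ_conv (a K : X -> R) (r k : R) : integ mu a -> avg_kernel r K ->
  (forall y : E, `|y| < r -> (nrm1 mu (fun z => translate y a z - a z)%R <= k%:E)%E) ->
  integ mu (conv a K) /\ (nrm1 mu (conv a K) <= (fine (nrm1 mu a) + k)%:E)%E.
Proof.
move=> ia aK hk; have cu := conv_approx ia aK hk.
have /integP[ma _] := ia; have iK := avg_kernel_integ aK.
have mc : measurable_fun setT (conv a K) by exact: measurable_conv.
have le : (nrm1 mu (conv a K) <= (fine (nrm1 mu a) + k)%:E)%E.
  rewrite addrC EFinD nrm1_fineK//.
  apply: le_trans (@nrm1_leD _ _ _ mu _ (fun z => conv a K z - a z) a _ _ _ _) _ => //.
  - exact: measurable_funB.
  - by move=> z; rewrite -{1}(subrK (a z) (conv a K z)) ler_normD.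
  - exact: leeD.
by split => //; apply/integP; split => //; apply: le_lt_trans le _; rewrite ltry.
Qed.

Lemma integ_sum_Rint (I : Type) (s : seq I) (F : I -> X -> R) :
  (forall i, integ mu (F i)) -> integ mu (fun z => \sum_(i <- s) F i z) /\
  \sum_(i <- s) \int[mu]_z F i z = \int[mu]_z (\sum_(i <- s) F i z).
Proof.
move=> iF; elim: s => [|i s [IH1 IH2]].
  split; last by under [RHS]eq_Rintegral do rewrite big_nil; rewrite big_nil Rintegral_cst//= mul0r.
  rewrite (_ : (fun z => _) = fun z => 0); last by apply/funext => z; rewrite big_nil.
  exact: integrable0.
have E1 : (fun z => \sum_(j <- i :: s) F j z) = fun z => F i z + \sum_(j <- s) F j z.
  by apply/funext => z; rewrite big_cons.
rewrite big_cons IH2; split; first by rewrite E1; exact: integD.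
rewrite -(RintegralD measurableT (iF i) IH1).
exact: (esym (congr1 (fun g : X -> R => \int[mu]_z g z) E1)).
Qed.

Lemma integ_sum_fin (I : finType) (F : I -> X -> R) : (forall i, integ mu (F i)) ->
  integ mu (fun z => \sum_i F i z).
Proof. by move=> /(integ_sum_Rint (index_enum I))[]. Qed.

Lemma Rint_sum_fin (I : finType) (F : I -> X -> R) : (forall i, integ mu (F i)) ->
  \sum_i \int[mu]_z F i z = \int[mu]_z (\sum_i F i z).
Proof. by move=> /(integ_sum_Rint (index_enum I))[]. Qed.

Section equation.
Variables (D : set E) (u f : X -> R) (v w A : 'I_N -> X -> R) (p q L : 'I_N -> R).
Variables (h : R -> R) (G G1 : 'I_N -> R -> R) (psi : E -> R) (B : R).
Hypotheses (oD : open D) (iu : integ mu u) (if_ : integ mu f).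
Hypotheses (iv : forall j, integ mu (v j)) (iw : forall j, integ mu (w j)).
Hypotheses (iA : forall j, integ mu (A j)).
Hypotheses (p0 : forall j, 0 < p j) (q0 : forall j, 0 < q j).
Hypothesis pq : forall j, (q j)^-1 + (p j)^-1 = 1.
Hypothesis iwp : forall j, integ mu (fun z => `|w j z| `^ p j).
Hypothesis iAq : forall j, integ mu (fun z => `|A j z| `^ q j).
Hypothesis hw : forall j phi, sm phi -> test_function D phi ->
  \int[mu]_z (v j z * 'D_(edir R (Some j)) phi z) = - \int[mu]_z (w j z * phi z).
Hypothesis heq : forall phi, sm phi -> test_function D phi ->
  \sum_j \int[mu]_z (A j z * 'D_(edir R (Some j)) phi z) -
  \int[mu]_z (u z * 'D_(edir R None) phi z) = \int[mu]_z (f z * phi z).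
Hypothesis dG : forall j t, is_derive t (1 : R) (G j) (G1 j t).
Hypothesis cG1 : forall j, continuous (G1 j).
Hypothesis GL : forall j t, `|G1 j t| <= L j.
Hypothesis G00 : forall j, G j 0 = 0.
Hypothesis Gh : forall j z, G j (v j z) = h (u z).
Hypotheses (hh : {homo h : x y / x <= y}) (hN : forall t, h (- t) = - h t).
Hypotheses (h1 : forall t, `|h t| <= 1) (ch : continuous h).
Hypotheses (spsi : sm psi) (tpsi : test_function D psi).
Hypothesis psiB : forall z, 0 <= psi z <= B.
Hypothesis DpsiB : forall i z, `|'D_(edir R i) psi z| <= B.

Let cd j := cut_derive (Some j) (v j) (w j) (G j) (G1 j) psi.

(** Testing with [psi * h u]. This is not a smooth function, and [u] has no
    time derivative: the equation is tested with translates of a kernel [K]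
    and integrated against [psi * h u] instead. In space the derivative of [K]
    passes to [psi * h u]; in time it is a difference quotient. *)
Lemma energy_cutoff :
  \sum_j \int[mu]_z (A j z * cd j z) <= B * (fine (nrm1 mu u) + fine (nrm1 mu f)).
Proof.
have B0 : 0 <= B by have /andP[a b] := psiB 0; exact: le_trans b.
apply/ler_addgt0Pr => e e0.
(* Each direction costs an error k, the time term 2 B k and the source B k. *)
pose c := N%:R + 3 * B + 1.
have N0 : 0 <= N%:R :> R by [].
have c0 : 0 < c by rewrite /c; lra.
pose k := e / c; have k0 : 0 < k by rewrite divr_gt0.
have Gb j z : `|G j (v j z)| <= 1 by rewrite Gh.
have fl j := flux_limit (Some j) (iv j) (iw j) (dG j) (@cG1 j) (GL j) (G00 j)
  spsi tpsi (p0 j) (q0 j) (pq j) (iA j) (iAq j) (iwp j) (Gb j) k0.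
have /choice[dj hdj] j : exists d : R, 0 < d /\ forall (K : E -> R) (r : R),
    0 < r -> r <= d -> avg_kernel r (K : X -> R) ->
    `|\int[mu]_z (cd j z * conv (A j) K z) - \int[mu]_z (A j z * cd j z)| <= k.
  by have [_ [d d0 hd]] := fl j; exists d.
have [df df0 hdf] := tcont_integ if_ k0.
have [sps cS SD] := tpsi.
have [rho rho0 Srho] := compact_margin oD cS SD.
(* Kernels of radius below dm fit in the margin of the cutoff and average well. *)
pose dm := \big[Num.min/Num.min df rho]_j dj j.
have dm0 : 0 < dm.
  apply: (big_ind (fun x => 0 < x)) => [|x y x0 y0|j _].
  - by rewrite lt_min df0.
  - by rewrite lt_min x0.
  - by have [] := hdj j.
have dmj j : dm <= dj j by apply: bigmin_le_cond.
have dmfr : dm <= Num.min df rho by apply: bigmin_le_id.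
have [dmf dmr] : dm <= df /\ dm <= rho by move: dmfr; rewrite le_min => /andP[].
pose l := dm / 2; have l0 : 0 < l by rewrite divr_gt0.
have lk : 0 < l * k by rewrite mulr_gt0.
have [du du0 hdu] := tcont_integ iu lk.
(* The radius r is chosen after the length l, as the error of the averages of u
   is divided by l. *)
pose r := Num.min du l; have r0 : 0 < r by rewrite lt_min du0.
have rl : r <= l by rewrite ge_min lexx orbT.
have [kk [K [skk sK akk aK DK]]] := kernel_pair (None : option 'I_N) r0 l0.
have rl0 : 0 < r + l by rewrite addr_gt0.
have rldm : r + l <= dm by rewrite [leRHS](splitr dm) lerD2r.
have [M kM] := avg_kernel_bdd akk; have [M' KM'] := avg_kernel_bdd aK.
have mkk := measurable_sm skk; have mK := measurable_sm sK.
have ikk := avg_kernel_integ akk; have iK := avg_kernel_integ aK.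
pose y : E := l *: edir R None.
pose phi0 z := psi z * h (u z).
have /integP[mu_ _] := iu.
have mp := measurable_sm spsi.
have mphi0 : measurable_fun setT phi0.
  by apply: measurable_funM => //; exact: continuous_C1_measurable.
have phi0B z : `|phi0 z| <= B.
  have /andP[a b] := psiB z; rewrite normrM (ger0_norm a).
  apply: le_trans (_ : psi z * 1 <= _); last by rewrite mulr1.
  by rewrite ler_wpM2l.
have iphi0 : integ mu phi0.
  have [R0 [_ hR]] := compact_bounded cS.
  have r1 : 0 < `|R0| + 2 by rewrite ltr_wpDl.
  apply: (@integ_bdd_ball _ (`|R0| + 2) B) => // z pz.
  apply: (@le_lt_trans _ _ (`|R0| + 1)); first last.
    by rewrite ltrD2l ltr1n.
  apply: hR; first by rewrite (le_lt_trans (ler_norm _))// ltrDl.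
  apply: subset_closure => /=; apply: contra pz => /eqP p00.
  by rewrite /phi0 p00 mul0r.
have hu x : `|x| < r -> (nrm1 mu (fun z => translate x u z - u z)%R <= (l * k)%:E)%E.
  by move=> xr; apply: hdu; rewrite (lt_le_trans xr)// ge_min lexx.
have hf x : `|x| < r + l -> (nrm1 mu (fun z => translate x f z - f z)%R <= k%:E)%E.
  by move=> xr; apply: hdf; rewrite (lt_le_trans xr)// (le_trans rldm).
have [icu _] := integ_conv iu akk hu.
have [icf ncf] := integ_conv if_ aK hf.
have eqz z0 : phi0 z0 * (\sum_j \int[mu]_z (A j z * 'D_(edir R (Some j)) K (transl (- (z0 : E)) z))) =
    phi0 z0 * conv f K z0 -
    l^-1 * (phi0 z0 * (conv u kk z0 - translate (- y) (conv u kk) z0)).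
  have [p00|p00] := eqVneq (psi z0) 0; first by rewrite /phi0 p00 !mul0r mulr0 subrr.
  have Sz0 : closure [set z | psi z != 0] z0 by exact: subset_closure.
  have tK : test_function D (fun z => K (z - z0)).
    apply: kernel_test rl0 sK aK _ => z zr; apply: (Srho _ Sz0) => i.
    by rewrite (le_trans (zr i))// (le_trans rldm).
  have E1 z : 'D_(edir R None) (fun z => K (z - z0)) z =
      l^-1 * (kk (z - (transl (- y) z0 : E)) - kk (z - z0)).
    rewrite derive_shift// DK mulrC; congr (_ * (kk _ - _)).
    by rewrite /transl /y opprB addrCA addrC.
  have ikv x : integ mu (fun z => u z * kk (transl (- (x : E)) z)).
    rewrite (_ : (fun _ => _) = fun z => translate (- (x : E)) kk z * u z); last first.
      by apply/funext => z; rewrite mulrC.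
    apply: (@integM_bdd _ _ _ _ _ _ M) => //; first exact: measurable_shift_fun.
    by move=> z; exact: kM.
  have EU : \int[mu]_z (u z * 'D_(edir R None) (fun z => K (z - z0)) z) =
      l^-1 * (translate (- y) (conv u kk) z0 - conv u kk z0).
    rewrite -(conv_kernel z0 iu mkk kM) /translate -(conv_kernel (transl (- y) z0) iu mkk kM).
    rewrite -RintegralB//; [|exact: ikv|exact: ikv].
    rewrite -RintegralZl//; last exact: (integB (ikv _) (ikv _)).
    by apply: eq_Rintegral => z _; rewrite E1 /transl; ring.
  have EA : \sum_j \int[mu]_z (A j z * 'D_(edir R (Some j)) K (transl (- (z0 : E)) z)) =
      conv f K z0 + l^-1 * (translate (- y) (conv u kk) z0 - conv u kk z0).
    have H := heq (sm_shift z0 sK) tK.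
    rewrite [X in _ = X](conv_kernel z0 if_ mK KM') in H.
    move/eqP: H; rewrite subr_eq => /eqP H.
    transitivity (conv f K z0 + \int[mu]_z (u z * 'D_(edir R None) (fun z => K (z - z0)) z)).
      rewrite -H; apply: eq_bigr => j _; apply: eq_Rintegral => z _.
      by rewrite (derive_shift z0 (edir R (Some j)) z sK).
    by rewrite EU.
  rewrite EA; ring.
have iAK j : integ mu (fun z0 => phi0 z0 *
    \int[mu]_z (A j z * 'D_(edir R (Some j)) K (transl (- (z0 : E)) z))).
  have [M2 KM2] := sm_derive_bdd (edir R (Some j)) rl0 sK aK.
  have mDK := measurable_sm (sm_derive (edir R (Some j)) sK).
  rewrite (_ : (fun z0 => _) = fun z0 => conv (A j) ('D_(edir R (Some j)) K : X -> R) z0 * phi0 z0); last first.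
    by apply/funext => z0; rewrite mulrC (conv_kernel z0 (iA j) mDK KM2).
  apply: (@integM_bdd _ _ _ _ _ _ (M2 * fine (nrm1 mu (A j)))) => //.
    by apply: measurable_conv => //; exact: (integ_derive_kernel _ rl0 sK aK).
  by move=> z; exact: conv_bdd.
have ius : integ mu (fun z => conv u kk z - translate (- y) (conv u kk) z).
  by apply: integB => //; exact: integ_shift.
have iuu : integ mu (fun z => u z - translate (- y) u z).
  by apply: integB => //; exact: integ_shift.
have iphi (g : X -> R) : integ mu g -> integ mu (fun z => phi0 z * g z).
  by move=> ig; exact: (@integM_bdd _ _ _ _ _ _ B).
have total : \sum_j \int[mu]_z (cd j z * conv (A j) K z) =
    \int[mu]_z (phi0 z * conv f K z) -
    l^-1 * \int[mu]_z (phi0 z * (conv u kk z - translate (- y) (conv u kk) z)).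
  rewrite -RintegralZl//; last exact: iphi.
  rewrite -RintegralB//; [|exact: iphi|by apply: integZ; exact: iphi].
  transitivity (\sum_j \int[mu]_z0 (phi0 z0 *
      \int[mu]_z (A j z * 'D_(edir R (Some j)) K (transl (- (z0 : E)) z)))).
    apply: eq_bigr => j _.
    rewrite -(flux_kernel oD (iv j) (iw j) (@hw j) (dG j) (@cG1 j) (GL j) (G00 j) spsi tpsi (iA j) rl0 sK aK).
    by apply: eq_Rintegral => z0 _; rewrite Gh.
  rewrite Rint_sum_fin//.
  by apply: eq_Rintegral => z0 _; rewrite -eqz mulr_sumr.
have ft : `|\int[mu]_z (phi0 z * conv f K z)| <= B * (fine (nrm1 mu f) + k).
  exact: Rint_mul_bdd.
have [H [subg H0 cH]] := convex_primitive hh hN h1.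
have tt := time_term iu spsi psiB (DpsiB None) ch h1 subg H0 cH l0.
rewrite -/y in tt.
have td : `|\int[mu]_z (phi0 z * (conv u kk z - translate (- y) (conv u kk) z)) -
    \int[mu]_z (phi0 z * (u z - translate (- y) u z))| <= B * (l * k + l * k).
  rewrite -RintegralB//; [|exact: iphi|exact: iphi].
  pose du1 z := conv u kk z - u z.
  have mdu1 : measurable_fun setT du1.
    by apply: measurable_funB => //; exact: measurable_conv.
  set W := (X in `|X|).
  have -> : W = \int[mu]_z (phi0 z * (du1 z - translate (- y) du1 z)).
    by apply: eq_Rintegral => z _; rewrite /du1 /translate; ring.
  have ndu : (nrm1 mu du1 <= (l * k)%:E)%E by exact: (conv_approx iu akk hu).
  apply: Rint_mul_bdd => //.
    by apply: integB; [exact: integB|apply: integ_shift; exact: integB].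
  apply: le_trans (@nrm1_leD _ _ _ mu _ du1 (translate (- y) du1) _ _ _ _) _ => //.
  - by apply: measurable_funB => //; exact: measurable_shift_fun.
  - exact: measurable_shift_fun.
  - by move=> z; rewrite ler_normB.
  - by rewrite nrm1_shift// EFinD leeD.
have S1 : \sum_j \int[mu]_z (A j z * cd j z) <=
    \sum_j (\int[mu]_z (cd j z * conv (A j) K z) + k).
  apply: ler_sum => j _; have [_ hj] := hdj j.
  have := hj K (r + l) rl0 (le_trans rldm (dmj j)) aK.
  by rewrite ler_distl => /andP[]; rewrite lerBlDr.
apply: le_trans S1 _; rewrite big_split /= total sumr_const card_ord.
move: ft tt td; set FF := \int[mu]_z (phi0 z * conv f K z).
set TT := \int[mu]_z (phi0 z * (conv u kk z - _)).
rewrite -/phi0; set UU := \int[mu]_z (_ * (u z - _)).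
move=> ft tt; rewrite ler_distl => /andP[td _].
have TT1 : l * (- (B * fine (nrm1 mu u)) - 2 * B * k) <= TT.
  apply: le_trans td; rewrite lerBrDr; apply: le_trans tt.
  by rewrite le_eqVlt; apply/orP; left; apply/eqP; ring.
have TT2 : - (B * fine (nrm1 mu u)) - 2 * B * k <= l^-1 * TT.
  by rewrite ler_pdivlMl.
have FF1 := le_trans (ler_norm _) ft.
have kc : k * N%:R + 3 * B * k <= e.
  have -> : e = k * c by rewrite /k divfK// gt_eqF.
  have -> : k * c = k * N%:R + 3 * B * k + k by rewrite /c; ring.
  by rewrite lerDl ltW.
rewrite -mulr_natr; lra.
Qed.

End equation.
End energy_estimate.

(** * Integrability of the derivative of the power *)

Section power_regularity.
Context (R : realType) (N : nat).
Local Notation E := ('rV[R]_N * R)%type.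
Local Notation X := ('rV[R]_N * measurableTypeR R)%type.
Local Notation mu := (lam R N).

Lemma powR_le1D (x a b : R) : 0 <= x -> 0 <= a -> a <= b -> x `^ a <= 1 + x `^ b.
Proof.
move=> x0 a0 ab; have [x1|x1] := leP x 1.
  apply: ler_wpDr; first exact: powR_ge0.
  have [->|xn0] := eqVneq x 0.
    by have [->|a1] := eqVneq a 0; [rewrite powRr0|rewrite powR0].
  by rewrite -[leRHS](powRr0 x); apply: ger_powR => //; rewrite lt_def xn0 x0.
by apply: ler_wpDl => //; apply: ler_powR => //; exact: ltW.
Qed.

Lemma measurable_pow_norm (f : X -> R) (a : R) : measurable_fun setT f ->
  measurable_fun setT (fun z => `|f z| `^ a).
Proof.
move=> mf; apply: (measurableT_comp (measurable_powR a)).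
exact: measurableT_comp.
Qed.

Lemma measurable_spow (f : X -> R) (a : R) : measurable_fun setT f ->
  measurable_fun setT (fun z => spow (f z) a).
Proof. by move=> mf; apply: measurable_funM => //; exact: measurable_pow_norm. Qed.

(** The derivative of the power [k] of [v], when [w] is that of [v]. On the zero
    set of [v] the power [k - 1] makes no sense, and the value zero is the limit
    of the derivatives of the regularizations. *)
Definition dpow (k : R) (v w : X -> R) (z : X) : R :=
  if v z == 0 then 0 else k * `|v z| `^ (k - 1) * w z.

Lemma measurable_dpow (k : R) (v w : X -> R) : measurable_fun setT v ->
  measurable_fun setT w -> measurable_fun setT (dpow k v w).
Proof.
move=> mv mw; apply: measurable_fun_ifT.
- by apply: measurable_fun_eqr => //; exact: measurable_cst.
- exact: measurable_cst.
- by apply: measurable_funM => //; apply: measurable_funM => //; exact: measurable_pow_norm.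
Qed.

Lemma nrm1_fatou (f_ : nat -> X -> R) (f : X -> R) (C : R) :
  (forall n, measurable_fun setT (f_ n)) ->
  (forall n, nrm1 mu (f_ n) <= C%:E)%E -> (forall z, f_ ^~ z @ \oo --> f z) ->
  integ mu f.
Proof.
move=> mf_ nf_ ff.
have mf : measurable_fun setT f.
  apply: (measurable_fun_cvg (h := f_)) => // z _; exact: ff.
apply/integP; split => //; apply: (@le_lt_trans _ _ C%:E); last by rewrite ltry.
have := @fatou _ _ _ mu setT measurableT (fun n z => (`|f_ n z|)%:E)
  (fun n => measurable_normE (mf_ n)) (fun n z _ => normr_ge0 (f_ n z)).
have lE z : limn_einf (fun n => (`|f_ n z|)%:E) = (`|f z|)%:E.
  suff /cvg_limn_einf_sup[] : (`|f_ n z|)%:E @[n --> \oo] --> (`|f z|)%:E by [].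
  by apply/fine_cvgP; split; [exact: nearW|exact: cvg_norm (ff z)].
rewrite (eq_integral (fun z => (`|f z|)%:E)) => [h|z _]; last exact: lE.
apply: le_trans h _; rewrite limn_einf_lim; apply: lime_le.
  exact: is_cvg_einfs.
near=> n; apply: le_trans (nf_ n); apply: ereal_inf_lbound.
by exists n => //=; rewrite leqnn.
Unshelve. all: by end_near. Qed.

Lemma nrm1_Rint (g : X -> R) : integ mu g -> (forall z, 0 <= g z) ->
  nrm1 mu g = (\int[mu]_z g z)%:E.
Proof.
move=> ig g0; rewrite /Rintegral fineK; last exact: (integrable_fin_num measurableT ig).
by apply: eq_integral => z _; rewrite ger0_norm.
Qed.

Section equation.
Variables (D : set E) (u f : X -> R) (w alpha : 'I_N -> X -> R).
Variables (p ms : 'I_N -> R) (lo hi m be : R).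
Hypotheses (oD : open D) (finD : (mu (D : set X) < +oo)%E).
Hypotheses (iu : integ mu u) (if_ : integ mu f).
Let v j z := spow (u z) (ms j).
Hypotheses (iv : forall j, integ mu (v j)) (iw : forall j, integ mu (w j)).
Hypothesis iwp : forall j, integ mu (fun z => `|w j z| `^ p j).
Hypotheses (u0 : forall z, ~ D z -> u z = 0) (w0 : forall j z, ~ D z -> w j z = 0).
Hypotheses (malpha : forall j, measurable_fun setT (alpha j)) (lo0 : 0 < lo).
Hypothesis alphaB : forall j z, lo <= alpha j z <= hi.
Hypotheses (p1 : forall j, 1 < p j) (m1 : 1 <= m) (mms : forall j, m <= ms j).
Hypotheses (be0 : 0 < be) (bems : forall j, be <= ms j - (ms j - m) * p j).
Let A j z := alpha j z * (`|w j z| `^ (p j - 2) * w j z).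
Hypothesis hw : forall j phi, sm phi -> test_function D phi ->
  \int[mu]_z (v j z * 'D_(edir R (Some j)) phi z) = - \int[mu]_z (w j z * phi z).
Hypothesis heq : forall phi, sm phi -> test_function D phi ->
  \sum_j \int[mu]_z (A j z * 'D_(edir R (Some j)) phi z) -
  \int[mu]_z (u z * 'D_(edir R None) phi z) = \int[mu]_z (f z * phi z).

Let mD : measurable (D : set X). Proof. exact: open_measurable_xt. Qed.
Let mu_ : measurable_fun setT u. Proof. by have /integP[] := iu. Qed.
Let mw j : measurable_fun setT (w j). Proof. by have /integP[] := iw j. Qed.
Let mv j : measurable_fun setT (v j). Proof. by have /integP[] := iv j. Qed.

Let m0 : 0 < m. Proof. exact: lt_le_trans ltr01 m1. Qed.
Let ms0 j : 0 < ms j. Proof. exact: lt_le_trans (mms j). Qed.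

Let iD : integ mu (\1_D : X -> R). Proof. exact: integ_indic. Qed.

Let normA j z : `|A j z| <= hi * `|w j z| `^ (p j - 1).
Proof.
have /andP[al ah] := alphaB j z; have al0 : 0 < alpha j z := lt_le_trans lo0 al.
rewrite /A normrM gtr0_norm//.
have -> : `|w j z| `^ (p j - 2) * w j z = spow (w j z) (p j - 1).
  by rewrite /spow; congr (_ `^ _ * _); ring.
by rewrite norm_spow ?subr_eq0 ?gt_eqF// ler_wpM2r// powR_ge0.
Qed.

Let mA j : measurable_fun setT (A j).
Proof. by do 2 apply: measurable_funM => //; exact: measurable_pow_norm. Qed.

Let hi0 (j : 'I_N) : 0 <= hi.
Proof.
have /andP[al ah] := alphaB j 0.
by rewrite (le_trans (ltW lo0))// (le_trans al).
Qed.

Lemma integ_flux j : integ mu (A j).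
Proof.
apply: (@integ_le _ _ _ _ _ (fun z => hi * ((\1_D : X -> R) z + `|w j z| `^ p j))) => //.
  by apply: integZ; exact: integD.
move=> z; apply: le_trans (normA j z) _; apply: le_trans _ (ler_norm _).
rewrite ler_wpM2l ?(hi0 j)//.
have [Dz|nDz] := pselect (D z).
  by rewrite indicE mem_set// powR_le1D//; have := p1 j; lra.
rewrite w0// normr0 powR0; last by rewrite subr_eq0 gt_eqF.
by rewrite addr_ge0 ?powR_ge0.
Qed.

Let iA := integ_flux.

Let q j := conj_exp (p j).
Let q0 j : 0 < q j. Proof. by have := p1 j; rewrite /q /conj_exp => h; rewrite divr_gt0//; lra. Qed.
Let pq j : (q j)^-1 + (p j)^-1 = 1.
Proof.
have h := p1 j; rewrite /q /conj_exp; field.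
by apply/andP; split; rewrite ?subr_eq0 gt_eqF//; lra.
Qed.

Let iAq j : integ mu (fun z => `|A j z| `^ q j).
Proof.
apply: (@integ_le _ _ _ _ _ (fun z => hi `^ q j * `|w j z| `^ p j)) => //.
- exact: measurable_pow_norm.
- exact: integZ.
move=> z; rewrite (ger0_norm (powR_ge0 _ _)) (ger0_norm (mulr_ge0 (powR_ge0 hi _) (powR_ge0 _ _))).
apply: le_trans (_ : (hi * `|w j z| `^ (p j - 1)) `^ q j <= _).
  apply: ge0_ler_powR; [exact: ltW|by rewrite nnegrE| |exact: normA].
  by rewrite nnegrE mulr_ge0 ?(hi0 j)// powR_ge0.
rewrite powRM ?(hi0 j) ?powR_ge0// -powRrM.
have -> : (p j - 1) * q j = p j; last by [].
by rewrite /q /conj_exp mulrC divfK// subr_eq0 gt_eqF.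
Qed.

(* Both M and M - be must stay large after division by any of the exponents
   [ms j], for the regularized power to be a C^1 function of each [v j]. *)
Let M := 3 * \sum_j ms j.
Let Mms j : 3 * ms j <= M.
Proof.
rewrite ler_pM2l//; rewrite (bigD1 j)//= lerDl; apply: sumr_ge0 => k _.
exact: ltW.
Qed.
Let bms j : be <= ms j.
Proof.
apply: le_trans (bems j) _; rewrite gerBl mulr_ge0// ?subr_ge0//.
by have := p1 j; lra.
Qed.
Let Q j := M / ms j.
Let b j := be / ms j.
Let Q3 j : 3 <= Q j. Proof. by rewrite ler_pdivlMr. Qed.
Let b0 j : 0 < b j. Proof. exact: divr_gt0. Qed.
Let b1 j : b j <= 1. Proof. by rewrite ler_pdivrMr ?mul1r. Qed.
Let okj j (dl : R) : 0 < dl -> [/\ 0 < dl, (0 : R) <= 1, 2 < Q j, 0 < b j & 1 < Q j - b j].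
Proof. by move=> dl0; split => //; have := Q3 j; have := b1 j; lra. Qed.

Let regE j dl z : reg dl 1 (Q j) (b j) (v j z) = reg dl 1 M be (u z).
Proof.
rewrite reg_spow ?gt_eqF// /Q /b mulrC divfK ?gt_eqF// mulrC divfK// gt_eqF//.
Qed.

Section cutoff.
Variable (psi : E -> R) (B : R).
Hypotheses (spsi : sm psi) (tpsi : test_function D psi).
Hypothesis psiB : forall z, 0 <= psi z <= B.
Hypothesis DpsiB : forall i z, `|'D_(edir R i) psi z| <= B.

Let C := B * (fine (nrm1 mu u) + fine (nrm1 mu f)) + B * \sum_j fine (nrm1 mu (A j)).

Let eb dl j z := psi z * reg' dl 1 (Q j) (b j) (v j z) * `|w j z| `^ p j.

Let meb dl j : 0 < dl -> measurable_fun setT (eb dl j).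
Proof.
move=> dl0; apply: measurable_funM; last exact: measurable_pow_norm.
apply: measurable_funM; first exact: measurable_sm.
by apply: continuous_C1_measurable => //; exact: continuous_reg' (okj j dl0).
Qed.

(** The flux is coercive, and the terms where the derivative falls on the cutoff
    are bounded because the regularized power is bounded by one. The bound does
    not involve [dl]. *)
Lemma energy_bound dl j : 0 < dl -> (nrm1 mu (eb dl j) <= (C / lo)%:E)%E.
Proof.
move=> dl0; have ok i := okj i dl0.
have B0 : 0 <= B by have /andP[x y] := psiB 0; exact: le_trans y.
have okM : [/\ 0 < dl, (0 : R) <= 1, 2 < M, 0 < be & 1 < M - be].
  have h1 := mms j; have h2 := Mms j; have h3 := bms j.
  have h4 := m1.
  by split => //; lra.
have /choice[L hL] i : exists L : R, forall t, `|reg' dl 1 (Q i) (b i) t| <= L.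
  exact: reg'_bounded (ok i) (b1 i).
have ch : continuous (reg dl 1 M be).
  move=> t; apply: differentiable_continuous; apply/derivable1_diffP.
  by have [] := is_derive_reg okM t.
have e := energy_cutoff oD iu if_ iv iw iA (fun j => lt_trans ltr01 (p1 j)) q0 pq
  iwp iAq hw heq (fun i t => is_derive_reg (ok i) t) (fun i => continuous_reg' (ok i))
  hL (fun i => reg_0 dl 1 (Q i) (b i)) (fun i z => regE i dl z) (reg_homo okM)
  (regN dl 1 M be) (fun t => norm_reg_le1 okM t erefl) ch spsi tpsi psiB DpsiB.
pose cd i := cut_derive (Some i) (v i) (w i) (reg dl 1 (Q i) (b i)) (reg' dl 1 (Q i) (b i)) psi.
have ieb i : integ mu (eb dl i).
  apply: (@integM_bdd _ _ _ _ _ _ (B * L i)) => //.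
    apply: measurable_funM; first exact: measurable_sm.
    by apply: continuous_C1_measurable => //; exact: continuous_reg' (ok i).
  move=> z; have /andP[x y] := psiB z.
  by rewrite normrM ler_pM// ger0_norm.
have eb0 i z : 0 <= eb dl i z.
  have /andP[x y] := psiB z.
  by rewrite mulr_ge0 ?powR_ge0// mulr_ge0// (reg'_ge0 (ok i)).
have G1le i z : `|reg dl 1 (Q i) (b i) (v i z)| <= 1 by exact: norm_reg_le1 (ok i) _ erefl.
have [iAcd _] : (forall i, integ mu (fun z => A i z * cd i z)) /\ True.
  split=> // i.
  have [] := flux_limit (Some i) (iv i) (iw i) (is_derive_reg (ok i))
    (continuous_reg' (ok i)) (hL i) (reg_0 dl 1 (Q i) (b i)) spsi tpsi
    (lt_trans ltr01 (p1 i)) (q0 i) (pq i) (iA i) (iAq i) (iwp i) (G1le i) ltr01.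
  by [].
have pt i z : lo * eb dl i z - B * `|A i z| <= A i z * cd i z.
  have -> : A i z * cd i z = alpha i z * eb dl i z +
      A i z * (reg dl 1 (Q i) (b i) (v i z) * 'D_(edir R (Some i)) psi z).
    rewrite /cd /cut_derive mulrDr; congr (_ + _).
    by rewrite /A /eb -(powR_norm_sqr (w i z) (a := p i)) ?gt_eqF ?(lt_trans ltr01)//; ring.
  have /andP[al _] := alphaB i z.
  apply: lerD; first by rewrite ler_wpM2r.
  rewrite lerNl; apply: le_trans (ler_norm _) _; rewrite normrN normrM mulrC.
  rewrite ler_wpM2r// normrM -[leRHS]mul1r.
  exact: ler_pM.
have int_i i : lo * \int[mu]_z eb dl i z - B * fine (nrm1 mu (A i)) <=
    \int[mu]_z (A i z * cd i z).
  have -> : fine (nrm1 mu (A i)) = \int[mu]_z `|A i z| by [].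
  have iAn := integ_norm (iA i).
  rewrite -(RintegralZl lo measurableT (ieb i)) -(RintegralZl B measurableT iAn).
  rewrite -RintegralB//; [|exact: integZ|exact: (integZ _ iAn)].
  apply: le_Rintegral => //; [|exact: iAcd].
  by apply: (integB (integZ _ (ieb i)) (integZ _ iAn)).
rewrite nrm1_Rint// lee_fin ler_pdivlMr// mulrC.
have eb0' i : 0 <= \int[mu]_z eb dl i z by apply: Rintegral_ge0.
apply: (@le_trans _ _ (\sum_i lo * \int[mu]_z eb dl i z)).
  rewrite (bigD1 j)//= lerDl; apply: sumr_ge0 => i _.
  by rewrite mulr_ge0// ltW.
rewrite /C -lerBlDr mulr_sumr -sumrB; apply: le_trans e.
exact: ler_sum.
Qed.

Let k j := m / ms j.
Let k0 j : 0 < k j. Proof. exact: divr_gt0. Qed.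
Let k1 j : k j <= 1. Proof. by rewrite ler_pdivrMr ?mul1r. Qed.

(** As the regularization is removed, the energy controls the derivative of
    [u] to the power [m] where [u] is small; where [u] is large the power [k]
    has a bounded derivative. *)
Lemma energy_dpow j :
  integ mu (fun z => psi z * `|dpow (k j) (v j) (w j) z| `^ p j).
Proof.
have b4 : 0 < b j / 4 by rewrite divr_gt0.
pose fl n z := if `|v j z| <= 1 then psi z * (b j / 4 *
   (`|v j z| `^ (Q j - 1) / (nharm R n + `|v j z| `^ (Q j - b j)))) * `|w j z| `^ p j
  else 0.
pose fl_ z := if `|v j z| <= 1 then psi z * (b j / 4 *
   (if v j z == 0 then 0 else `|v j z| `^ (b j - 1))) * `|w j z| `^ p j else 0.
have mn : measurable_fun setT (fun z : X => `|v j z|) by exact: measurableT_comp.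
have mp := measurable_sm spsi.
have mfl n : measurable_fun setT (fl n).
  apply: measurable_fun_ifT => //; first exact: measurable_fun_ler.
  apply: measurable_funM; last exact: measurable_pow_norm.
  apply: measurable_funM => //; apply: measurable_funM => //.
  apply: measurable_funM; first exact: measurable_pow_norm.
  apply: (@continuous_C1_measurable _ _ (fun t => (nharm R n + `|t| `^ (Q j - b j))^-1)) => // t.
  have Qb : 1 < Q j - b j by have h1 := Q3 j; have h2 := b1 j; lra.
  apply: cvgV; first by rewrite gt_eqF// ltr_wpDr ?powR_ge0// nharm_gt0.
  by apply: cvgD; [exact: cvg_cst|exact: continuous_pow_norm].
(* Fatou's lemma, along dl = 1 / (n + 1). *)
have ifl : integ mu fl_.
  apply: (@nrm1_fatou fl fl_ (C / lo)) => // [n|z].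
    apply: le_trans (energy_bound j (nharm_gt0 R n)); apply: nrm1_le => //.
      exact: meb (nharm_gt0 R n).
    move=> z; have /andP[pz _] := psiB z.
    have rg0 : 0 <= reg' (nharm R n) 1 (Q j) (b j) (v j z).
      exact: reg'_ge0 (okj j (nharm_gt0 R n)) _.
    rewrite /fl /eb; case: ifPn => [v1|_]; last by rewrite normr0.
    rewrite normrM [leRHS]normrM ler_wpM2r// normrM [leRHS]normrM ler_wpM2l//.
    rewrite (ger0_norm rg0) ger0_norm; last first.
      rewrite mulr_ge0 ?(ltW b4)// divr_ge0 ?powR_ge0//.
      by rewrite addr_ge0 ?powR_ge0// ltW// nharm_gt0.
    by apply: reg'_ge => //; exact: okj (nharm_gt0 R n).
  rewrite /fl /fl_; case: ifPn => _; last exact: cvg_cst.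
  apply: cvgM; last exact: cvg_cst.
  apply: cvgM; first exact: cvg_cst.
  apply: cvgM; first exact: cvg_cst.
  case: eqP => [->|/eqP v0]; last exact: cvg_quot_pow.
  rewrite normr0 powR0; last by rewrite gt_eqF//; have := Q3 j; lra.
  by under eq_fun do rewrite mul0r; exact: cvg_cst.
have B0 : 0 <= B by have /andP[x y] := psiB 0; exact: le_trans y.
apply: (@integ_le _ _ _ _ _ (fun z => 4 / b j * fl_ z + B * `|w j z| `^ p j)).
- apply: measurable_funM => //; apply: measurable_pow_norm; exact: measurable_dpow.
- by apply: integD; exact: integZ.
have pj0 : 0 < p j := lt_trans ltr01 (p1 j).
move=> z; have /andP[pz pB] := psiB z.
apply: le_trans _ (ler_norm _); rewrite ger0_norm; last by rewrite mulr_ge0 ?powR_ge0.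
have P0 : 0 <= `|w j z| `^ p j := powR_ge0 _ _.
have f0 : 0 <= fl_ z.
  rewrite /fl_; case: ifP => // _; rewrite mulr_ge0// mulr_ge0//.
  by rewrite mulr_ge0 ?(ltW b4)//; case: ifP => // _; exact: powR_ge0.
have c0 : 0 <= 4 / b j by rewrite divr_ge0// ltW.
rewrite /dpow; have [vz|vz] := eqVneq (v j z) 0.
  by rewrite normr0 powR0 ?gt_eqF// mulr0 addr_ge0// mulr_ge0.
have v0 : 0 < `|v j z| by rewrite normr_gt0.
have kp1 : k j `^ p j <= 1.
  rewrite -[leRHS](powRr0 (k j)); apply: ger_powR; last exact: ltW.
  by rewrite k0 k1.
have -> : `|k j * `|v j z| `^ (k j - 1) * w j z| `^ p j =
    k j `^ p j * `|v j z| `^ ((k j - 1) * p j) * `|w j z| `^ p j.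
  rewrite normrM normrM (ger0_norm (powR_ge0 _ _)) (gtr0_norm (k0 j)).
  have x0 : 0 <= k j * `|v j z| `^ (k j - 1) by rewrite mulr_ge0 ?powR_ge0// ltW.
  rewrite (powRM _ x0 (normr_ge0 _)) (powRM _ (ltW (k0 j)) (powR_ge0 _ _)).
  by rewrite -powRrM.
apply: (@le_trans _ _ (psi z * (`|v j z| `^ ((k j - 1) * p j)) * `|w j z| `^ p j)).
  rewrite -[leRHS]mulrA ler_wpM2l// ler_wpM2r//.
  by apply: ler_piMl => //; exact: powR_ge0.
have [v1|v1] := leP `|v j z| 1.
  apply: ler_wpDr; first by rewrite mulr_ge0.
  rewrite /fl_ v1 (negbTE vz).
  have -> : 4 / b j * (psi z * (b j / 4 * `|v j z| `^ (b j - 1)) * `|w j z| `^ p j) =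
      psi z * `|v j z| `^ (b j - 1) * `|w j z| `^ p j.
    by field; rewrite gt_eqF.
  rewrite ler_wpM2r// ler_wpM2l//; apply: ger_powR; first by rewrite v0.
  rewrite /b /k -(ler_pM2r (ms0 j)) mulrAC !mulrBl !divfK ?gt_eqF// !mul1r.
  by have := bems j; rewrite mulrBl; lra.
apply: ler_wpDl; first by rewrite mulr_ge0.
rewrite ler_wpM2r//; apply: le_trans pB; apply: ler_piMr => //.
rewrite -[leRHS](powRr0 `|v j z|); apply: ler_powR; first exact: ltW.
by rewrite mulr_le0_ge0// ?(ltW pj0)// subr_le0.
Qed.

End cutoff.

Let k j := m / ms j.
Let k0 j : 0 < k j. Proof. exact: divr_gt0. Qed.
Let k1 j : k j <= 1. Proof. by rewrite ler_pdivrMr ?mul1r. Qed.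

(** Finitely many bumps cover [K], each bounded below on a box of half its size. *)
Lemma integ_dpow_compact j (K : set E) : compact K -> K `<=` D ->
  integ mu (fun z => (\1_K : X -> R) z * `|dpow (k j) (v j) (w j) z| `^ p j).
Proof.
move=> cK KD.
have [rho rho0 Krho] := compact_margin oD cK KD.
have mK := compact_measurable cK.
pose psi (c : E) (z : E) := \prod_i hat rho (crd i z - crd i c).
have spsi c : sm (psi c).
  apply: sm_prod => i; rewrite /hat; apply: sm_mul.
    rewrite (_ : (fun z => _) = fun z => flat (1 : {poly R}) (- rho^-1 * crd i z + (1 + rho^-1 * crd i c))).
      exact: sm_flat.
    by apply/funext => z; congr flat; ring.
  rewrite (_ : (fun z => _) = fun z => flat (1 : {poly R}) (rho^-1 * crd i z + (1 - rho^-1 * crd i c))).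
    exact: sm_flat.
  by apply/funext => z; congr flat; ring.
have psi01 c z : 0 <= psi c z <= 1.
  apply/andP; split; first by apply: prodr_ge0 => i _; exact: hat_ge0.
  by apply: prodr_ile1 => i _; rewrite hat_ge0 hat_le1.
have tpsi c : K c -> test_function D (psi c).
  move=> Kc; apply: (test_function_box (c := c) (r := rho)) => //; last exact: Krho.
  move=> z pz i; rewrite crdB; apply: ltW; apply: hat_supp => //.
  by move: pz; apply: contra => /eqP h; rewrite /psi (bigD1 i)//= h mul0r.
pose g z := `|dpow (k j) (v j) (w j) z| `^ p j.
have ipsi c : K c -> integ mu (fun z => psi c z * g z).
  move=> Kc; have [B B0 hB] := cutoff_bdd (spsi c) (tpsi _ Kc).
  apply: (@energy_dpow (psi c) (Num.max 1 B)) => //; [exact: tpsi| |].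
    by move=> z; have /andP[-> h] := psi01 c z; rewrite le_max h.
  by move=> i z; rewrite le_max; have [_ ->] := hB z; rewrite orbT.
have r2 : 0 < rho / 2 by rewrite divr_gt0.
(* The space with a base point, for the finite covering property. *)
pose PE : ptopologicalType := HB.pack E (isPointed.Build E 0).
have : cover_compact (K : set PE) by rewrite -(@compact_cover PE).
move=> /(_ _ K (fun c => ball c (rho / 2))).
case=> [c _|z Kz|F FK KF]; first exact: ball_open.
  by exists z => //; exact: ballxx.
have mg : measurable_fun setT g.
  by apply: measurable_pow_norm; exact: measurable_dpow.
pose c0 : R := (flat (1 : {poly R}) (1 / 2) ^+ 2) ^+ #|{: option 'I_N}|.
have c00 : 0 < c0 by rewrite !exprn_gt0// flat1_gt0// divr_gt0.
apply: (@integ_le _ _ _ _ _ (fun z : X => c0^-1 * \sum_(c <- F) psi c z * g z)).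
- by apply: measurable_funM => //; exact: measurable_indic.
- apply: integZ; have : forall c, c \in enum_fset F -> K c by move=> c cF; have := FK c cF; rewrite inE.
  elim: (enum_fset F) => [|c s IH] h.
    rewrite (_ : (fun z => _) = fun z => 0); first exact: integrable0.
    by apply/funext => z; rewrite big_nil.
  rewrite (_ : (fun z => _) = fun z => psi c z * g z + \sum_(c <- s) psi c z * g z).
    apply: integD; first by apply: ipsi; apply: h; exact: mem_head.
    by apply: IH => x xs; apply: h; rewrite inE xs orbT.
  by apply/funext => z; rewrite big_cons.
move=> z; have g0 : 0 <= g z := powR_ge0 _ _.
have s0 (s : seq E) : 0 <= \sum_(c <- s) psi c z * g z.
  by apply: sumr_ge0 => c _; have /andP[x _] := psi01 c z; rewrite mulr_ge0.
rewrite indicE; have [zK|_] := boolP (z \in K); last by rewrite mul0r normr0.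
rewrite mul1r; apply: le_trans _ (ler_norm _); rewrite ger0_norm//.
rewrite inE in zK; have [c cF zc] := KF _ zK.
rewrite -ler_pdivrMl ?invr_gt0// invrK (big_rem c)//=.
apply: ler_wpDr => //; rewrite ler_wpM2r// /c0 -prodr_const.
apply: ler_prod => i _; rewrite exprn_ge0 ?flat1_ge0//=; apply: hat_ge => //.
by rewrite -crdB ltW//; exact: (ball_crdP c z r2).1 zc i.
Qed.

Lemma integ_dpow_compact1 j (K : set E) : compact K -> K `<=` D ->
  integ mu (fun z => (\1_K : X -> R) z * dpow (k j) (v j) (w j) z).
Proof.
move=> cK KD.
have mK := compact_measurable cK.
apply: (@integ_le _ _ _ _ _ (fun z => (\1_D : X -> R) z +
  (\1_K : X -> R) z * `|dpow (k j) (v j) (w j) z| `^ p j)).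
- apply: measurable_funM; first exact: measurable_indic.
  exact: measurable_dpow.
- by apply: integD => //; exact: integ_dpow_compact.
move=> z; apply: le_trans _ (ler_norm _).
rewrite !indicE; have [zK|_] := boolP (z \in K).
  rewrite inE in zK; rewrite mem_set; last exact: KD.
  rewrite !mul1r -[leLHS]powRr1//; apply: powR_le1D => //; exact: ltW.
by rewrite !mul0r normr0 addr0.
Qed.

(** The chain rule for a power of exponent at most one, which need not be
    differentiable at the origin: pass to the limit in the regularizations. *)
Lemma weak_derive_power j phi : test_function D phi ->
  \int[mu]_z (spow (u z) m * 'D_(edir R (Some j)) phi z) =
  - \int[mu]_z (dpow (k j) (v j) (w j) z * phi z).
Proof.
move=> tphi; have [sphi cS SD] := tphi.
have [cphi dphi] := sphi [::]; have [cDphi _] := sphi [:: edir R (Some j)].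
rewrite /= in cphi dphi cDphi.
set S := closure [set z | phi z != 0] in cS SD.
have phi0 := @support_eq0 _ _ phi.
have [B B0 hB] := bounded_support cS cphi phi0.
have [B' B'0 hB'] := bounded_support cS cDphi (@derive_support R N phi (edir R (Some j))).
have mphi : measurable_fun setT (phi : X -> R) by exact: continuous_measurable_xt.
have mDphi : measurable_fun setT ('D_(edir R (Some j)) phi : X -> R).
  exact: continuous_measurable_xt.
have ok0 n : [/\ 0 < nharm R n, (0 : R) <= 0, 2 < (4 : R), 0 < k j & 1 < 4 - k j].
  by have h := k1 j; split; rewrite ?nharm_gt0//; lra.
pose G n := reg (nharm R n) 0 4 (k j); pose G1 n := reg' (nharm R n) 0 4 (k j).
have cr n : \int[mu]_z (G n (v j z) * 'D_(edir R (Some j)) phi z) =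
    - \int[mu]_z (G1 n (v j z) * w j z * phi z).
  have [L hL] := reg'_bounded (ok0 n) (k1 j).
  exact: (chain_rule oD (iv j) (iw j) (@hw j) (is_derive_reg (ok0 n))
    (continuous_reg' (ok0 n)) hL (reg_0 _ _ _ _) tphi).
have mG n : measurable_fun setT (fun z => G n (v j z)).
  apply: continuous_C1_measurable => // t.
  apply: differentiable_continuous; apply/derivable1_diffP.
  by have [] := is_derive_reg (ok0 n) t.
have mG1 n : measurable_fun setT (fun z => G1 n (v j z)).
  by apply: continuous_C1_measurable => //; exact: continuous_reg' (ok0 n).
have lim1 : (\int[mu]_z (G n (v j z) * 'D_(edir R (Some j)) phi z)) @[n --> \oo] -->
    \int[mu]_z (spow (u z) m * 'D_(edir R (Some j)) phi z).
  apply: (@Rint_dct _ _ _ mu _ _ (fun z => B' * ((\1_D : X -> R) z + `|v j z|)) _ _ _ _).2.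
  - by move=> n; exact: measurable_funM.
  - by apply: integZ; apply: integD => //; exact: integ_norm.
  - move=> z; apply: cvgM; last exact: cvg_cst.
    have -> : spow (u z) m = spow (v j z) (k j).
      by rewrite /v spow_spow ?gt_eqF// /k mulrC divfK// gt_eqF.
    by apply: cvg_reg0 => //; lra.
  - move=> n z; rewrite normrM mulrC; apply: ler_pM => //.
    apply: le_trans (norm_reg_le_pow (ok0 n) _) _.
    have [Dz|nDz] := pselect (D z).
      rewrite indicE mem_set// -[X in _ + X]powRr1//; apply: powR_le1D => //; exact: ltW.
    rewrite /v u0// spow0 normr0 powR0 ?gt_eqF// addr0; exact: indic_ge0.
have lim2 : (\int[mu]_z (G1 n (v j z) * w j z * phi z)) @[n --> \oo] -->
    \int[mu]_z (dpow (k j) (v j) (w j) z * phi z).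
  apply: (@Rint_dct _ _ _ mu _ _ (fun z => B * (4 / k j) *
      `|(\1_S : X -> R) z * dpow (k j) (v j) (w j) z|) _ _ _ _).2.
  - by move=> n; apply: measurable_funM => //; exact: measurable_funM.
  - by apply: integZ; apply: integ_norm; exact: integ_dpow_compact1.
  - move=> z; apply: cvgM; last exact: cvg_cst.
    rewrite /dpow.
    have -> : (if v j z == 0 then 0 else k j * `|v j z| `^ (k j - 1) * w j z) =
      (if v j z == 0 then 0 else k j * `|v j z| `^ (k j - 1)) * w j z.
      by case: ifP => // _; rewrite mul0r.
    by apply: cvgM; [apply: cvg_reg'0 => //; lra|exact: cvg_cst].
  - move=> n z; have [Sz|nS] := pselect (S z); last first.
      rewrite phi0// mulr0 normr0; apply: mulr_ge0 => //.
      by apply: mulr_ge0 => //; rewrite divr_ge0// ltW.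
    rewrite indicE mem_set// mul1r /dpow.
    have [vz|vz] := eqVneq (v j z) 0.
      by rewrite vz /G1 (reg'_0 (ok0 n)) !mul0r normr0 mulr0.
    rewrite normrM mulrC -mulrA; apply: ler_pM => //.
    rewrite normrM (ger0_norm (reg'_ge0 (ok0 n) _)).
    rewrite normrM normrM (gtr0_norm (k0 j)) (ger0_norm (powR_ge0 _ _)).
    have -> (x y : R) : 4 / k j * (k j * x * y) = 4 * x * y by field; rewrite gt_eqF.
    by rewrite ler_wpM2r//; exact: reg'_le_pow (ok0 n) _ vz.
have lim1' : (\int[mu]_z (G n (v j z) * 'D_(edir R (Some j)) phi z)) @[n --> \oo] -->
    - \int[mu]_z (dpow (k j) (v j) (w j) z * phi z).
  rewrite (_ : (fun n => _) = fun n => - \int[mu]_z (G1 n (v j z) * w j z * phi z)).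
    exact: cvgN.
  by apply/funext => n.
exact: cvg_unique lim1 lim1'.
Qed.

Theorem power_regularity : exists g : 'I_N -> X -> R, forall j,
  [/\ measurable_fun setT (g j),
   forall z, u z = 0 -> g j z = 0,
   forall K, compact K -> K `<=` D ->
     integ mu (fun z => (\1_K : X -> R) z * `|g j z| `^ p j) /\
     integ mu (fun z => (\1_K : X -> R) z * g j z) &
   forall phi, test_function D phi ->
     \int[mu]_z (spow (u z) m * 'D_(edir R (Some j)) phi z) =
     - \int[mu]_z (g j z * phi z)].
Proof.
exists (fun j => dpow (k j) (v j) (w j)) => j; split.
- exact: measurable_dpow.
- by move=> z uz; rewrite /dpow /v uz spow0 eqxx.
- move=> K cK KD; split; first exact: integ_dpow_compact.
  exact: integ_dpow_compact1.
- exact: weak_derive_power.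
Qed.

End equation.
End power_regularity.

(** * The completed measure *)

Lemma countable_bigcup_measurable d (T : measurableType d) (I : countType)
    (P : set I) (F : I -> set T) :
  (forall i, P i -> measurable (F i)) -> measurable (\bigcup_(i in P) F i).
Proof.
move=> mF; rewrite bigcup_mkcond; apply: countable_bigcupT_measurable => [|i].
  exact: countableP.
by case: ifPn => // /set_mem; exact: mF.
Qed.

Section completion.
Context (R : realType) (N : nat).
Local Notation E := ('rV[R]_N * R)%type.
Local Notation X := ('rV[R]_N * measurableTypeR R)%type.
Local Notation mu := (lam R N).
Local Notation LM := (lebesgue_xt R N).
Local Notation LS := (leb_space R N).

Lemma borel_leb (A : set X) : measurable A -> measurable (A : set LS).
Proof.
move=> mA; apply: (@sub_caratheodory _ _ R (borel_lebesgue_xt R N)).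
exact: sub_sigma_algebra.
Qed.

Lemma lebesgue_xtE (A : set X) : measurable A -> LM A = mu A.
Proof. by move=> mA; exact: (measurable_mu_extE (borel_lebesgue_xt R N)). Qed.

Lemma borel_hull (S : set X) : (LM S < +oo)%E ->
  exists F : set X, [/\ measurable F, S `<=` F & (mu F <= LM S)%E].
Proof.
move=> Sfin.
have S0 : (0 <= LM S)%E by exact: mu_ext_ge0.
have Sf : LM S \is a fin_num by rewrite ge0_fin_numE.
have /choice[F hF] (m : nat) : exists F : set X, [/\ measurable F, S `<=` F &
    (mu F <= LM S + (m.+1%:R^-1)%:E)%E].
  have m0 : 0 < m.+1%:R^-1 :> R by rewrite invr_gt0.
  have [_ [A [mA SA] <-] Alt] := lb_ereal_inf_adherent m0 Sf.
  exists (\bigcup_k A k); split => //; first exact: bigcupT_measurable.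
  apply: le_trans (ltW Alt).
  by apply: (measure_sigma_subadditive mu mA) => //; exact: bigcupT_measurable.
exists (\bigcap_m F m); split.
- by apply: bigcapT_measurable => m; have [] := hF m.
- by move=> z Sz m _; have [_ + _] := hF m; exact.
apply/lee_addgt0Pr => e e0.
have [m me] : exists m : nat, m.+1%:R^-1 <= e.
  have [m _ hm] := near_infty_natSinv_lt (PosNum e0).
  by exists m; apply: ltW; exact: hm (leqnn m).
have [mF _ hm] := hF m.
apply: (@le_trans _ _ (mu (F m))).
  apply: le_measure; rewrite ?inE//.
    by apply: bigcapT_measurable => k; have [] := hF k.
  by move=> z; exact.
by apply: le_trans hm _; rewrite leeD2l// lee_fin.
Qed.

(** On a ball, a measurable set differs from its Borel hull by a set of measure
    zero, which lies in a Borel set of measure zero. *)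
Lemma borel_diff_null (A : set X) : measurable (A : set LS) ->
  exists2 M : set X, measurable M /\ mu M = 0%E & measurable (A `\` M).
Proof.
move=> mA; pose B n := (ball (0 : E) n.+1%:R : set X).
have mB n : measurable (B n) by exact: measurable_ball_xt.
have /choice[M hM] n : exists M : set X, (measurable M /\ mu M = 0%E) /\
    measurable ((A `&` B n) `\` M).
  have mAB : measurable (A `&` B n : set LS) by apply: measurableI => //; exact: borel_leb.
  have ABfin : (LM (A `&` B n) < +oo)%E.
    apply: (@le_lt_trans _ _ (LM (B n))).
      by apply: le_mu_ext => z [].
    by rewrite lebesgue_xtE//; exact: lam_ball_lty.
  have [F [mF ABF Fle]] := borel_hull ABfin.
  have FAB0 : LM (F `\` (A `&` B n)) = 0%E.
    have Ffin : (LM F < +oo)%E by rewrite lebesgue_xtE//; exact: le_lt_trans ABfin.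
    have := @measureD _ _ _ LM _ _ (borel_leb mF) mAB Ffin.
    move=> ->.
    rewrite (_ : F `&` _ = A `&` B n); last by apply/seteqP; split=> z; [case|move=> h; split => //; exact: ABF].
    have e : LM F = LM (A `&` B n).
      apply/eqP; rewrite eq_le lebesgue_xtE// Fle /= -lebesgue_xtE//.
      exact: le_mu_ext.
    apply: (@eq_trans _ _ (LM (A `&` B n) - LM (A `&` B n))%E).
      by congr (_ - _)%E; exact: e.
    by rewrite subee// ge0_fin_numE// mu_ext_ge0.
  have [M [mM FM M0]] := borel_hull (S := F `\` (A `&` B n)) (eq_ind_r (fun x => (x < +oo)%E) (ltry 0) FAB0).
  exists M; split.
    by split=> //; apply/eqP; rewrite eq_le measure_ge0 andbT -FAB0.
  rewrite (_ : _ `\` M = F `\` M); first exact: measurableD.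
  apply/seteqP; split=> z [h1 h2]; split => //; first exact: ABF.
  by apply: contrapT => h; apply: h2; apply: FM.
exists (\bigcup_n M n).
  split; first by apply: bigcupT_measurable => n; have [[]] := hM n.
  have : mu.-negligible (\bigcup_n M n).
    by apply: negligible_bigcup => n; exists (M n); split=> //; have [[]] := hM n.
  by move/negligibleP; apply; apply: bigcupT_measurable => n; have [[]] := hM n.
rewrite (_ : A `\` _ = (\bigcup_n ((A `&` B n) `\` M n)) `\` \bigcup_n M n).
  by apply: measurableD; apply: bigcupT_measurable => n; have [[]] := hM n.
apply/seteqP; split=> z.
  move=> [Az nM]; split => //.
  have Bz : B (Num.trunc `|z|) z.
    by rewrite /B -ball_normE /ball_ /= sub0r normrN; exact: truncnS_gt.
  by exists (Num.trunc `|z|) => //; split => // h; apply: nM; exists (Num.trunc `|z|).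
by move=> [[n _ [[Az _] _]] nM].
Qed.

(** Measurability of a real function for the completed measure is
    measurability outside a null set of the Borel sigma-algebra: it is enough
    to remove a null set for each of countably many superlevel sets. *)
Lemma borel_off_null (g : E -> R) : measurable_fun (setT : set LS) g ->
  exists2 M : set X, measurable M /\ mu M = 0%E &
    measurable_fun setT (g \_ (~` M) : X -> R).
Proof.
move=> mg.
have /choice[M hM] (m : nat) : exists M : set X, (measurable M /\ mu M = 0%E) /\
    forall q : rat, @choice.unpickle rat m = Some q -> measurable ([set z : X | ratr q < g z] `\` M).
  case: (@choice.unpickle rat m) => [q|]; last by exists set0.
  have mq : measurable ([set z : X | ratr q < g z] : set LS).
    have := mg measurableT `]ratr q, +oo[%classic (measurable_itv _).
    by rewrite setTI preimage_itvoy.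
  have [M hM1 hM2] := borel_diff_null mq.
  by exists M; split => // _ [<-].
have mM n : measurable (M n) by have [[]] := hM n.
exists (\bigcup_n M n).
  split; first exact: bigcupT_measurable.
  have : mu.-negligible (\bigcup_n M n).
    by apply: negligible_bigcup => n; exists (M n); split=> //; have [[]] := hM n.
  by move/negligibleP; apply; exact: bigcupT_measurable.
set MM := \bigcup_n M n.
have mMM : measurable MM by exact: bigcupT_measurable.
apply: (measurability _ (RGenOInfty.measurableE R)) => //.
move=> _ [_ [x ->] <-]; rewrite setTI.
rewrite (_ : _ @^-1` _ = (if x < 0 then MM else set0) `|`
  \bigcup_(q in [set q : rat | x < ratr q]) ([set z : X | ratr q < g z] `\` MM)).
  apply: measurableU.
    by case: ifP.
  apply: countable_bigcup_measurable => q _.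
  have [_ /(_ q (choice.pickleK q)) h] := hM (choice.pickle q).
  rewrite (_ : _ `\` MM = ([set z : X | ratr q < g z] `\` M (choice.pickle q)) `\` MM).
    exact: measurableD.
  apply/seteqP; split=> z [h1 h2]; last by split => //; case: h1.
  by split => //; split => // h3; apply: h2; exists (choice.pickle q).
apply/seteqP; split=> z /=; rewrite in_itv/= andbT.
  rewrite patchE; case: ifPn => [|].
    rewrite inE => nM xg; right.
    have [q] := rat_in_itvoo xg; rewrite in_itv/= => /andP[xq qg].
    by exists q.
  by rewrite notin_setE /= => /contrapT hM0 x0; left; rewrite x0.
case=> [|[q xq [qg nM]]].
  by case: ifP => // x0 zM; rewrite patchE memNset//; exact.
by rewrite patchE mem_set// (lt_trans xq).
Qed.

Lemma borel_off_larger (g : E -> R) (M M' : set X) : measurable M' -> M `<=` M' ->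
  measurable_fun setT (g \_ (~` M) : X -> R) ->
  measurable_fun setT (g \_ (~` M') : X -> R).
Proof.
move=> mM' MM' mg.
rewrite (_ : g \_ (~` M') = ((g \_ (~` M) : X -> R) \_ (~` M') : X -> R)).
  have [+ _] := measurable_restrictT (g \_ (~` M) : X -> R) (measurableC mM').
  by apply; exact: measurable_funTS.
apply/funext => z; rewrite !patchE; case: ifPn => // zM'.
by rewrite mem_set// => zM; move: zM'; rewrite inE; apply; exact: MM'.
Qed.

Lemma measurable_leb (g : X -> R) : measurable_fun setT g ->
  measurable_fun (setT : set LS) (g : LS -> R).
Proof.
by move=> mg _ B mB; rewrite setTI; apply: borel_leb; rewrite -[_ @^-1` _]setTI; exact: mg.
Qed.

Lemma measurable_leb_id : measurable_fun (setT : set LS) (idfun : LS -> X).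
Proof. by move=> _ B mB; rewrite setTI; exact: borel_leb. Qed.

Lemma ge0_integral_xt (F : X -> \bar R) : measurable_fun setT F ->
  (forall z, 0 <= F z)%E -> (\int[LM]_z F z = \int[mu]_z F z)%E.
Proof.
move=> mF F0.
have := ge0_integral_pushforward measurable_leb_id LM measurableT mF (fun z _ => F0 z).
rewrite preimage_setT => <-.
pose M' : {measure set X -> \bar R} :=
  measure_function_pushforward__canonical__measure_function_Measure LM measurable_leb_id.
rewrite -[LHS]/(\int[M']_z F z)%E.
by apply: eq_measure_integral => A mA _; apply: (etrans _ (lebesgue_xtE mA)).
Qed.

Lemma ae_leb (g : E -> R) (M : set X) : measurable M -> mu M = 0%E ->
  ae_eq LM (setT : set LS) (g : LS -> R) (g \_ (~` M)).
Proof.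
move=> mM M0; exists M; split; first exact: borel_leb.
  by rewrite -M0; exact: lebesgue_xtE.
move=> z /=; apply: contra_notP => nM _; rewrite patchE mem_set//.
Qed.

Lemma Rint_xt (g : E -> R) (M : set X) : measurable M -> mu M = 0%E ->
  measurable_fun (setT : set LS) g -> measurable_fun setT (g \_ (~` M) : X -> R) ->
  (\int[LM]_z g z)%R = (\int[mu]_z (g \_ (~` M)) z)%R.
Proof.
move=> mM M0 mg mgM; rewrite /Rintegral; congr fine.
have ae : ae_eq LM (setT : set LS) (EFin \o g) (EFin \o (g \_ (~` M))).
  have [A [mA A0 h]] := ae_leb g mM M0.
  by exists A; split => // z nz; apply: h => gz; apply: nz => zT /=; rewrite gz.
transitivity (\int[LM]_z (EFin \o (g \_ (~` M))) z)%E.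
  have m1 : measurable_fun (setT : set LS) (EFin \o g) by exact/measurable_EFinP.
  have m2 : measurable_fun (setT : set LS) (EFin \o (g \_ (~` M))).
    by apply/measurable_EFinP; exact: measurable_leb.
  exact: (ae_eq_integral _ _ measurableT m1 m2 ae).
rewrite [LHS]integralE [RHS]integralE; congr (_ - _)%E.
  apply: ge0_integral_xt => //; apply: measurable_funepos.
  exact/measurable_EFinP.
apply: ge0_integral_xt => //; apply: measurable_funeneg.
exact/measurable_EFinP.
Qed.

Lemma integral_norm_xt (g : E -> R) (q : R) (M : set X) : measurable M -> mu M = 0%E ->
  measurable_fun (setT : set LS) g -> measurable_fun setT (g \_ (~` M) : X -> R) ->
  (\int[LM]_z (`|g z| `^ q)%:E = \int[mu]_z (`|(g \_ (~` M)) z| `^ q)%:E)%E.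
Proof.
move=> mM M0 mg mgM.
have ae : ae_eq LM (setT : set LS) (fun z => (`|g z| `^ q)%:E) (fun z => (`|(g \_ (~` M)) z| `^ q)%:E).
  have [A [mA A0 h]] := ae_leb g mM M0.
  by exists A; split => // z nz; apply: h => gz; apply: nz => zT /=; rewrite gz.
have mp (f : LS -> R) : measurable_fun setT f -> measurable_fun setT (fun z => (`|f z| `^ q)%:E : \bar R).
  move=> mf; apply/measurable_EFinP; apply: (measurableT_comp (measurable_powR q)).
  exact: measurableT_comp.
transitivity (\int[LM]_z (`|(g \_ (~` M)) z| `^ q)%:E)%E.
  exact: (ae_eq_integral _ _ measurableT (mp _ mg) (mp _ (measurable_leb mgM)) ae).
apply: ge0_integral_xt; last by move=> z; rewrite lee_fin powR_ge0.
apply/measurable_EFinP; exact: measurable_pow_norm.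
Qed.

Lemma Lfun_of_integrable (g : LS -> R) (q : R) : 0 < q -> measurable_fun setT g ->
  (\int[LM]_z (`|g z| `^ q)%:E < +oo)%E -> g \in Lfun LM q%:E.
Proof.
move=> q0 mg gq; rewrite inE; apply/andP; split; rewrite inE//=.
rewrite /finite_norm unlock poweR_lty//.
Qed.

Lemma Lfun_measurable (g : LS -> R) (q : \bar R) : g \in Lfun LM q -> measurable_fun setT g.
Proof. by rewrite inE => /andP[/[!inE]]. Qed.

Lemma Lfun_lty (g : LS -> R) (q : R) : 1 <= q -> g \in Lfun LM q%:E ->
  (\int[LM]_z (`|g z| `^ q)%:E < +oo)%E.
Proof.
move=> q1 /(Lfun_integrable q1) /integrableP[_].
rewrite (eq_integral (fun z => (`|g z| `^ q)%:E))// => z _.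
by rewrite abse_EFin ger0_norm// powR_ge0.
Qed.

End completion.

(** * Uniqueness of weak derivatives *)

(** A Lipschitz function is the infimum of the cones standing on its graph at
    rational points, hence composition with it is measurable. *)
Lemma lipschitz_coef_measurable d (T : measurableType d) (R : realType) (D : set T)
    (a : T -> R -> R) (g : T -> R) (c : R) :
  measurable D -> 0 < c -> measurable_fun setT g ->
  (forall v, measurable_fun D (a ^~ v)) ->
  (forall z v v', D z -> `|a z v - a z v'| <= c * `|v - v'|) ->
  measurable_fun D (fun z => a z (g z)).
Proof.
move=> mD c0 mg ma la mD'.
apply: (measurability _ (RGenInftyO.measurableE R)) => //.
move=> _ [_ [x ->] <-].
rewrite (_ : D `&` _ = \bigcup_(q in [set: rat])
    (D `&` (fun z => a z (ratr q) + c * `|g z - ratr q|) @^-1` `]-oo, x[)).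
  apply: countable_bigcup_measurable => q _.
  have mq : measurable_fun D (fun z => a z (ratr q) + c * `|g z - ratr q|).
    apply: measurable_funD => //; apply: measurable_funM => //.
    apply: measurableT_comp => //; apply: measurable_funB => //.
    exact: measurable_funTS.
  exact: mq.
apply/seteqP; split=> z.
  case=> Dz /=; rewrite in_itv/= => ax.
  pose e := (x - a z (g z)) / (2 * c).
  have e0 : 0 < e by rewrite divr_gt0 ?mulr_gt0// subr_gt0.
  have ge : g z < g z + e by rewrite ltrDl.
  have [q] := rat_in_itvoo ge.
  rewrite in_itv/= => /andP[gq qe]; exists q => //; split => //=; rewrite in_itv/=.
  have qg : `|g z - ratr q| < e.
    by rewrite distrC gtr0_norm ?subr_gt0//; lra.
  have := la _ (ratr q) (g z) Dz; rewrite distrC => /(le_trans (ler_norm _)).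
  have aq : a z (ratr q) - a z (g z) <= c * `|g z - ratr q|.
    apply: le_trans (ler_norm _) _; rewrite [X in _ <= c * X]distrC; exact: la.
  have ce : 2 * (c * `|g z - ratr q|) < x - a z (g z).
    have -> : x - a z (g z) = 2 * (c * e) by rewrite /e; field; rewrite gt_eqF.
    by rewrite !ltr_pM2l.
  move=> _; lra.
case=> q _ [Dz /=]; rewrite !in_itv/= => h; split => //; apply: le_lt_trans h.
rewrite -lerBlDl; apply: le_trans (ler_norm _) _; exact: la.
Qed.

Section uniqueness.
Context (R : realType) (N : nat).
Local Notation E := ('rV[R]_N * R)%type.
Local Notation X := ('rV[R]_N * measurableTypeR R)%type.
Local Notation mu := (lam R N).
Local Notation LS := (leb_space R N).

Definition mkpoint (f : option 'I_N -> R) : E := (\row_j f (Some j), f None).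

Lemma crd_mkpoint f i : crd i (mkpoint f) = f i.
Proof. by case: i => [j|] //=; rewrite mxE. Qed.

(** Take the cells of the grids of mesh [1 / (n + 1)] for which the box of twice the
    size and the same centre lies in [D]. *)
Lemma compact_exhaustion (D : set E) : open D ->
  exists Q K : nat -> set E, exists rho : nat -> R,
  (forall m, [/\ compact (Q m), compact (K m), K m `<=` D,
     0 < rho m & forall z0, Q m z0 -> forall z : E,
       (forall i, `|crd i (z - z0)| <= rho m) -> K m z]) /\
  D `<=` \bigcup_m Q m.
Proof.
move=> oD.
pose I := (nat * {ffun option 'I_N -> int})%type.
pose rho (nk : I) : R := nk.1.+1%:R^-1.
have rho0 nk : 0 < rho nk by rewrite invr_gt0.
pose ctr (nk : I) : E := mkpoint (fun i => rho nk * ((nk.2 i)%:~R + 1 / 2)).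
pose box (s : R) (nk : I) : set E := [set z | forall i, `|crd i (z - ctr nk)| <= s * rho nk].
pose good m := if @choice.unpickle I m is Some nk then
  if `[< box 1 nk `<=` D >] then Some nk else None else None.
exists (fun m => if good m is Some nk then box (1 / 2) nk else set0).
exists (fun m => if good m is Some nk then box 1 nk else set0).
exists (fun m => if good m is Some nk then rho nk / 2 else 1).
split=> [m|z Dz].
  rewrite /good; case: choice.unpickle => [nk|]; last by split => //; exact: compact0.
  case: asboolP => [bD|_]; last by split => //; exact: compact0.
  split => //; [exact: compact_box|exact: compact_box|by rewrite divr_gt0|].
  move=> z0 Qz0 z zz0 i; rewrite (_ : z - ctr nk = (z - z0) + (z0 - ctr nk)); last by rewrite addrA subrK.
  rewrite crdD (le_trans (ler_normD _ _))//.
  have -> : 1 * rho nk = rho nk / 2 + 1 / 2 * rho nk by field.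
  by apply: lerD; [exact: zz0|exact: Qz0].
have /nbhs_ballP[r /= r0 zr] : nbhs (z : E) D by exact: open_nbhs_nbhs (conj oD Dz).
have r2 : 0 < r / 2 by rewrite divr_gt0.
have [n _ hn] := near_infty_natSinv_lt (PosNum r2).
have nr : n.+1%:R^-1 < r / 2 by exact: hn (leqnn n).
have n0 : 0 < n.+1%:R :> R by [].
pose nk : I := (n, [ffun i => Num.floor (n.+1%:R * crd i z)]).
have zc i : `|crd i (z - ctr nk)| <= 1 / 2 * rho nk.
  rewrite crdB crd_mkpoint ffunE /rho /=.
  have /andP[f1 f2] := floor_itv (n.+1%:R * crd i z).
  set q := n.+1%:R in f1 f2 n0 *; set fl := (Num.floor _)%:~R in f1 f2 *.
  have -> : crd i z - q^-1 * (fl + 1 / 2) = q^-1 * (q * crd i z - fl - 1 / 2).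
    by field; rewrite gt_eqF.
  rewrite normrM gtr0_norm ?invr_gt0// mulrC ler_wpM2r ?invr_ge0 ?(ltW n0)//.
  rewrite ler_norml; apply/andP; split; first by lra.
  by move: f2; rewrite intrD => f2; lra.
have bD : box 1 nk `<=` D.
  move=> y yc; apply: zr; apply/ball_crdP => // i.
  rewrite (_ : y - z = (y - ctr nk) - (z - ctr nk)); last first.
    by rewrite opprB addrA subrK.
  rewrite crdB (le_lt_trans (ler_normB _ _))//.
  have h1 := yc i; have h2 := zc i; have h3 : rho nk < r / 2 := nr.
  have h4 := rho0 nk; move: h1 h2 h3 h4; move: (rho nk) => x h1 h2 h3 h4; lra.
by exists (choice.pickle nk) => //; rewrite /good choice.pickleK asboolT.
Qed.

(** The local statement [du_bois_reymond] applies in each box of an exhaustion,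
    after cutting [g] to the larger box to make it integrable. *)
Lemma annihilator_null (D : set E) (g : X -> R) : open D -> measurable_fun setT g ->
  (forall K, compact K -> K `<=` D -> integ mu (fun z => (\1_K : X -> R) z * g z)) ->
  (forall phi, sm phi -> test_function D phi -> \int[mu]_z (g z * phi z) = 0) ->
  mu (D `&` [set z : X | g z != 0]) = 0%E.
Proof.
move=> oD mg ig hg.
have [Q [K [rho [QK DQ]]]] := compact_exhaustion oD.
have mg0 : measurable [set z : X | g z != 0].
  rewrite (_ : [set z | g z != 0] = ~` (g @^-1` [set 0])).
    by apply: measurableC; rewrite -[_ @^-1` _]setTI; exact: mg.
  by apply/seteqP; split=> z /= /eqP.
have null m : mu.-negligible ((Q m : set X) `&` [set z : X | g z != 0]).
  have [cQ cK KD rho0 mar] := QK m.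
  have QKm : Q m `<=` K m.
    by move=> z Qz; apply: (mar z) => // i; rewrite subrr crd0 normr0 ltW.
  have ifK := ig _ cK KD.
  have mQ := compact_measurable cQ; have mK := compact_measurable cK.
  have n0 : nrm1 mu (fun z => (\1_(K m) : X -> R) z * g z * \1_(Q m : set X) z) = 0%E.
    apply: (du_bois_reymond mQ rho0 ifK) => phi z0 Qz0 sphi phi_supp.
    have supp z : phi z != 0 -> K m z by move=> pz; apply: (mar z0) => //; exact: phi_supp.
    have tphi : test_function D phi.
      apply: (test_function_box sphi phi_supp) => z zz0; apply: KD.
      exact: (mar z0).
    rewrite -[RHS](hg _ sphi tphi); apply: eq_Rintegral => z _.
    have [pz|pz] := eqVneq (phi z) 0; first by rewrite pz !mulr0.
    by rewrite indicE mem_set ?mul1r//; exact: supp.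
  have mf : measurable_fun setT (fun z => (\1_(K m) : X -> R) z * g z * \1_(Q m : set X) z).
    apply: measurable_funM; last exact: measurable_indic.
    by apply: measurable_funM => //; exact: measurable_indic.
  have mef : measurable_fun setT (EFin \o (fun z => (\1_(K m) : X -> R) z * g z * \1_(Q m : set X) z)).
    exact/measurable_EFinP.
  have [+ _] := ae_eq_integral_abs mu measurableT mef.
  move=> /(_ n0) [A [mA A0 hA]].
  exists A; split => // z [Qz gz]; apply: hA => /= h.
  have := h Logic.I; rewrite !indicE !mem_set//; last exact: QKm.
  by rewrite mul1r mulr1 => -[gz0]; move: gz; rewrite /= gz0 eqxx.
have /negligibleP : mu.-negligible ((D : set X) `&` [set z : X | g z != 0]).
  apply: (@negligibleS _ _ _ mu (\bigcup_m ((Q m : set X) `&` [set z : X | g z != 0]))).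
    by move=> z [Dz gz]; have [m _ Qm] := DQ _ Dz; exists m.
  exact: negligible_bigcup.
by apply; apply: measurableI => //; exact: open_measurable_xt.
Qed.

End uniqueness.

(** * Borel representatives *)

Lemma measurable_fun_exhaust d (T : measurableType d) (R : realType) (D : set T)
    (Q : nat -> set T) (f : T -> R) : measurable D -> (forall m, measurable (Q m)) ->
  (forall m, Q m `<=` D) -> D `<=` \bigcup_m Q m ->
  (forall m, measurable_fun setT (f \_ (Q m))) -> measurable_fun setT (f \_ D).
Proof.
move=> mD mQ QD DQ mf; apply/(measurable_restrictT f mD).
have -> : D = \bigcup_m Q m.
  by apply/seteqP; split => // z [m _]; exact: QD.
apply/measurable_fun_bigcup => // m.
by apply/(measurable_restrictT f (mQ m)).
Qed.

Section transfer.
Context (R : realType) (N : nat).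
Local Notation E := ('rV[R]_N * R)%type.
Local Notation X := ('rV[R]_N * measurableTypeR R)%type.
Local Notation mu := (lam R N).
Local Notation LM := (lebesgue_xt R N).
Local Notation LS := (leb_space R N).

Definition null_set (M : set X) := measurable M /\ mu M = 0%E.

Lemma null_bigcup (M : nat -> set X) : (forall n, null_set (M n)) ->
  null_set (\bigcup_n M n).
Proof.
move=> hM; have mU : measurable (\bigcup_n M n).
  by apply: bigcupT_measurable => n; have [] := hM n.
split=> //; have /negligibleP : mu.-negligible (\bigcup_n M n).
  by apply: negligible_bigcup => n; have [mM M0] := hM n; exists (M n); split.
exact.
Qed.

Lemma null_fin (I : finType) (M : I -> set X) : (forall i, null_set (M i)) ->
  exists2 M' : set X, null_set M' & forall i, M i `<=` M'.
Proof.
move=> hM; pose F n := if @choice.unpickle I n is Some i then M i else set0.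
exists (\bigcup_n F n) => [|i z Mz]; last first.
  by exists (choice.pickle i) => //; rewrite /F choice.pickleK.
apply: null_bigcup => n; rewrite /F; case: choice.unpickle => [i|]; first exact: hM.
by split; [exact: measurable0|exact: measure0].
Qed.

Lemma common_null (I : finType) (F : I -> E -> R) :
  (forall i, measurable_fun (setT : set LS) (F i)) ->
  exists2 M : set X, null_set M &
    forall i, measurable_fun setT (F i \_ (~` M) : X -> R).
Proof.
move=> mF.
have /choice[M hM] i : exists M : set X, null_set M /\
    measurable_fun setT (F i \_ (~` M) : X -> R).
  by have [M hM mM] := borel_off_null (mF i); exists M.
have [M' nM' MM'] := null_fin (fun i => (hM i).1).
exists M' => // i; apply: (borel_off_larger _ (MM' i)) => //; first by case: nM'.
exact: (hM i).2.
Qed.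

Lemma patch_patch (g : E -> R) (D M : set E) :
  (g \_ D) \_ (~` M) = g \_ (D `\` M) :> (E -> R).
Proof.
apply/funext => z; rewrite !patchE.
have [zM|zM] := pselect (M z).
  by rewrite memNset; [rewrite memNset// => -[]|exact].
rewrite mem_set//; have [zD|zD] := pselect (D z); first by rewrite !mem_set.
by rewrite !memNset// => -[].
Qed.

Lemma patchMr (g h : E -> R) (S : set E) :
  (fun z => g z * h z) \_ S = fun z => (g \_ S) z * h z.
Proof. by apply/funext => z; rewrite !patchE; case: ifP => // _; rewrite mul0r. Qed.

Lemma patch_spow (g : E -> R) (q : R) (S : set E) :
  (fun z => spow (g z) q) \_ S = fun z => spow ((g \_ S) z) q.
Proof. by apply/funext => z; rewrite !patchE; case: ifP => // _; rewrite spow0. Qed.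

Lemma patch_sub (g : E -> R) (K D M : set E) : K `<=` D ->
  g \_ (K `\` M) = fun z => \1_K z * (g \_ (D `\` M)) z.
Proof.
move=> KD; apply/funext => z; rewrite !patchE indicE.
have [zK|zK] := pselect (K z); last first.
  by rewrite (memNset zK) mul0r memNset// => -[].
rewrite (mem_set zK) mul1r; have [zM|zM] := pselect (M z).
  by rewrite !memNset// => -[].
by rewrite !mem_set//; split => //; exact: KD.
Qed.

(** By completeness, as subsets of null sets are measurable. *)
Lemma leb_of_borel (g : E -> R) (M : set X) : null_set M ->
  measurable_fun setT (g \_ (~` M) : X -> R) -> measurable_fun (setT : set LS) g.
Proof.
move=> [mM M0] mg _ B mB; rewrite setTI.
have -> : g @^-1` B = ((g \_ (~` M)) @^-1` B `\` M) `|` (g @^-1` B `&` M).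
  apply/seteqP; split=> z /=.
    move=> Bz; have [Mz|nM] := pselect (M z); [by right|left; split => //].
    by rewrite patchE mem_set.
  by case=> [[]|[]//]; rewrite patchE => + nM; rewrite mem_set.
apply: measurableU.
  by apply: borel_leb; apply: measurableD => //; rewrite -[_ @^-1` _]setTI; exact: mg.
have cpl := @measure_is_complete_caratheodory _ _
  (measure_extension_mu_ext__canonical__measure_extension_OuterMeasure (borel_lebesgue_xt R N)).
apply: cpl.
exists M; split; [exact: borel_leb| |by move=> z []].
by rewrite -M0; exact: lebesgue_xtE.
Qed.

Lemma integral_onE (D : set E) (h : E -> R) (M : set X) : open D -> null_set M ->
  measurable_fun setT (h \_ (D `\` M) : X -> R) ->
  integral_on D h = \int[mu]_z (h \_ (D `\` M)) z.
Proof.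
move=> oD nM mh; rewrite -patch_patch in mh *.
rewrite /integral_on Rintegral_mkcond.
have mg := leb_of_borel nM mh.
by have [mM M0] := nM; exact: Rint_xt.
Qed.

Lemma Lp_measurable (D : set E) (q : R) (g : E -> R) : Lp D q g ->
  measurable_fun (setT : set LS) (g \_ D).
Proof. exact: Lfun_measurable. Qed.

Lemma Lp_integ (D : set E) (q r : R) (g : E -> R) (M : set X) :
  measurable (D : set X) -> (mu (D : set X) < +oo)%E -> 1 <= q -> 0 < r -> r <= q ->
  null_set M -> measurable_fun setT (g \_ (D `\` M) : X -> R) ->
  Lp D q g -> integ mu (fun z => `|(g \_ (D `\` M)) z| `^ r).
Proof.
move=> mD finD q1 r0 rq nM mg Lg.
have iq : integ mu (fun z => `|(g \_ (D `\` M)) z| `^ q).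
  apply/integP; split; first exact: measurable_pow_norm.
  have := Lfun_lty q1 Lg; have [mM M0] := nM.
  have mg' : measurable_fun setT ((g \_ D) \_ (~` M) : X -> R) by rewrite patch_patch.
  rewrite (integral_norm_xt q mM M0 (Lp_measurable Lg) mg') patch_patch.
  congr (_ < _)%E; apply: eq_integral => z _.
  by rewrite [in RHS]ger0_norm// powR_ge0.
apply: (@integ_le _ _ _ _ _ (fun z => (\1_D : X -> R) z + `|(g \_ (D `\` M)) z| `^ q)).
- exact: measurable_pow_norm.
- by apply: integD => //; exact: integ_indic.
move=> z; apply: le_trans _ (ler_norm _); rewrite ger0_norm ?powR_ge0//.
have [Dz|nDz] := pselect (D z).
  by rewrite indicE mem_set//; apply: powR_le1D => //; exact: ltW.
rewrite patchE memNset; last by case.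
rewrite normr0 powR0 ?gt_eqF// addr_ge0 ?powR_ge0//; exact: indic_ge0.
Qed.

Lemma integ_pow1 (g : X -> R) : measurable_fun setT g ->
  integ mu (fun z => `|g z| `^ 1) -> integ mu g.
Proof.
by move=> mg h; apply: (integ_le mg h) => z; rewrite powRr1// normr_id.
Qed.

Lemma Lp_of_integ (K : set E) (q : R) (h : E -> R) (M : set X) : 0 < q -> null_set M ->
  measurable_fun setT (h \_ (K `\` M) : X -> R) ->
  integ mu (fun z => `|(h \_ (K `\` M)) z| `^ q) -> Lp K q h.
Proof.
move=> q0 nM mh ih; rewrite -patch_patch in mh ih.
have mg := leb_of_borel nM mh; have [mM M0] := nM.
apply: Lfun_of_integrable => //.
rewrite (integral_norm_xt q mM M0 mg mh).
have /integP[_] := ih; congr (_ < _)%E; apply: eq_integral => z _.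
by rewrite ger0_norm// powR_ge0.
Qed.

Lemma test_measurable (D : set E) (phi : E -> R) (v : E) : test_function D phi ->
  measurable_fun setT (phi : X -> R) /\ measurable_fun setT ('D_v phi : X -> R).
Proof.
move=> [sphi _ _]; have [c0 _] := sphi [::]; have [c1 _] := sphi [:: v].
by split; exact: continuous_measurable_xt.
Qed.

Section domain.
Variables (D : set E) (M : set X).
Hypotheses (oD : open D) (finD : (mu (D : set X) < +oo)%E) (nM : null_set M).

Let mD : measurable (D : set X). Proof. exact: open_measurable_xt. Qed.

Lemma weak_derive_borel (e : E) (v w : E -> R) :
  measurable_fun setT (v \_ (D `\` M) : X -> R) ->
  measurable_fun setT (w \_ (D `\` M) : X -> R) ->
  (forall phi, test_function D phi ->
    integral_on D (fun z => v z * 'D_e phi z) = - integral_on D (fun z => w z * phi z)) <->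
  (forall phi, test_function D phi ->
    \int[mu]_z ((v \_ (D `\` M)) z * 'D_e phi z) =
    - \int[mu]_z ((w \_ (D `\` M)) z * phi z)).
Proof.
move=> mv mw; split=> h phi tphi; have [mp mDp] := test_measurable e tphi.
  have := h _ tphi; rewrite !(integral_onE oD nM) ?patchMr//; exact: measurable_funM.
rewrite !(integral_onE oD nM) ?patchMr//; [exact: h|exact: measurable_funM|exact: measurable_funM].
Qed.

Lemma Lp_loc_integ (w : E -> R) (K : set E) :
  measurable_fun setT (w \_ (D `\` M) : X -> R) -> Lp_loc D 1 w ->
  compact K -> K `<=` D ->
  integ mu (fun z => (\1_K : X -> R) z * (w \_ (D `\` M)) z).
Proof.
move=> mw Lw cK KD; have mK := compact_measurable cK.
have mwK : measurable_fun setT (w \_ (K `\` M) : X -> R).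
  by rewrite (patch_sub w M KD); apply: measurable_funM => //; exact: measurable_indic.
have finK : (mu (K : set X) < +oo)%E.
  by apply: le_lt_trans finD; apply: le_measure; rewrite ?inE.
have := Lp_integ mK finK (lexx 1) ltr01 (lexx 1) nM mwK (Lw _ cK KD).
by move=> /(integ_pow1 mwK); rewrite (patch_sub w M KD).
Qed.

Lemma Lp_loc_of_integ (h : E -> R) (q : R) : 0 < q ->
  measurable_fun setT (h \_ (D `\` M) : X -> R) ->
  (forall K, compact K -> K `<=` D ->
    integ mu (fun z => (\1_K : X -> R) z * `|(h \_ (D `\` M)) z| `^ q)) ->
  Lp_loc D q h.
Proof.
move=> q0 mh ih K cK KD; have mK := compact_measurable cK.
have mhK : measurable_fun setT (h \_ (K `\` M) : X -> R).
  by rewrite (patch_sub h M KD); apply: measurable_funM => //; exact: measurable_indic.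
apply: (Lp_of_integ q0 nM mhK); have := ih _ cK KD.
congr (integ mu _); apply/funext => z; rewrite (patch_sub h M KD) indicE.
by case: (z \in K); rewrite ?mul1r// !mul0r normr0 powR0// gt_eqF.
Qed.

Lemma weak_derive_unique (e : E) (v w1 w2 : E -> R) :
  measurable_fun setT (v \_ (D `\` M) : X -> R) ->
  measurable_fun setT (w1 \_ (D `\` M) : X -> R) ->
  measurable_fun setT (w2 \_ (D `\` M) : X -> R) ->
  is_weak_derivative D e v w1 -> is_weak_derivative D e v w2 ->
  mu ((D : set X) `&` [set z : X | (w1 \_ (D `\` M)) z - (w2 \_ (D `\` M)) z != 0]) = 0%E.
Proof.
move=> mv m1 m2 [_ L1 h1] [_ L2 h2].
have {}h1 := (weak_derive_borel e mv m1).1 h1.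
have {}h2 := (weak_derive_borel e mv m2).1 h2.
apply: (@annihilator_null _ _ D (fun z => (w1 \_ (D `\` M)) z - (w2 \_ (D `\` M)) z)) => //.
- exact: measurable_funB.
- move=> K cK KD.
  rewrite (_ : (fun z => _) = fun z => (\1_K : X -> R) z * (w1 \_ (D `\` M)) z -
    (\1_K : X -> R) z * (w2 \_ (D `\` M)) z); last by apply/funext => z; rewrite mulrBr.
  by apply: integB; exact: Lp_loc_integ.
move=> phi _ tphi; have [mp _] := test_measurable e tphi.
have [sphi cS SD] := tphi; have [c0 _] := sphi [::].
set S := closure [set z | phi z != 0] in cS SD.
have phi0 := @support_eq0 _ _ phi.
have [B B0 hB] := bounded_support cS c0 phi0.
have iw (w : E -> R) : measurable_fun setT (w \_ (D `\` M) : X -> R) -> Lp_loc D 1 w ->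
    integ mu (fun z => (w \_ (D `\` M)) z * phi z).
  move=> mw Lw.
  rewrite (_ : (fun z => (w \_ (D `\` M)) z * phi z) = fun z => phi z * ((\1_S : X -> R) z * (w \_ (D `\` M)) z)).
    by apply: (@integM_bdd _ _ _ _ _ _ B) => //; exact: Lp_loc_integ.
  apply/funext => z; rewrite indicE; have [Sz|nS] := pselect (S z).
    by rewrite mem_set// mul1r mulrC.
  by rewrite phi0// mulr0 mul0r.
transitivity (\int[mu]_z ((w1 \_ (D `\` M)) z * phi z) - \int[mu]_z ((w2 \_ (D `\` M)) z * phi z)).
  rewrite -RintegralB//; [|exact: iw|exact: iw].
  by apply: eq_Rintegral => z _; rewrite mulrBl.
by apply/eqP; rewrite subr_eq0; apply/eqP/oppr_inj; rewrite -h1// -h2.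
Qed.

End domain.

Lemma Lp_loc_measurable (D : set E) (w : E -> R) : open D -> Lp_loc D 1 w ->
  measurable_fun (setT : set LS) (w \_ D).
Proof.
move=> oD Lw; have [Q [K [rho [QK DQ]]]] := compact_exhaustion oD.
have QD m : Q m `<=` D.
  have [_ _ KD rho0 mar] := QK m; move=> z Qz; apply: KD; apply: (mar z) => // i.
  by rewrite subrr crd0 normr0 ltW.
have mD := borel_leb (open_measurable_xt oD).
have mQ m : measurable (Q m : set LS).
  by apply: borel_leb; apply: compact_measurable; have [] := QK m.
have mw m : measurable_fun (setT : set LS) (w \_ (Q m)).
  by apply: Lp_measurable; apply: Lw (QD m); have [] := QK m.
exact: (measurable_fun_exhaust mD mQ QD DQ mw).
Qed.

End transfer.

(** * The theorem *)

Section cylinder.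
Context (R : realType) (n : nat) (Omega : set 'rV[R]_n.+1) (T : R).
Local Notation X := ('rV[R]_n.+1 * measurableTypeR R)%type.

Lemma cylinder_open : open Omega -> open (cylinder Omega T).
Proof.
move=> oO; rewrite openE => -[x t] [/= Ox Tt].
have o2 : open [set t : R | 0 < t < T].
  rewrite (_ : [set t | _] = `]0, T[%classic); first exact: interval_open.
  by apply/seteqP; split=> s /=; rewrite in_itv.
exists (Omega, [set t : R | 0 < t < T]) => //=.
split; exact: open_nbhs_nbhs.
Qed.

Lemma cylinder_lty : open Omega -> bounded_set Omega -> 0 < T ->
  (lam R n.+1 (cylinder Omega T : set X) < +oo)%E.
Proof.
move=> oO [r [_ hr]] T0; pose s := Num.max (`|r| + 2) (T + 1).
have s0 : 0 < s by rewrite lt_max ltr_wpDl.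
have mC : measurable (cylinder Omega T : set X).
  exact: open_measurable_xt (cylinder_open oO).
have mB := measurable_ball_xt (0 : 'rV[R]_n.+1 * R) s.
apply: le_lt_trans (lam_ball_lty (0 : 'rV[R]_n.+1 * R) s0).
apply: le_measure; rewrite ?inE//.
move=> [x t] [/= Ox /andP[t0 tT]]; rewrite -ball_normE /ball_ /= sub0r normrN.
have rx : r < `|r| + 1 by apply: (le_lt_trans (ler_norm r)); rewrite ltrDl.
have := hr _ rx _ Ox; rewrite /= => xr.
rewrite /Num.norm /= gt_max; apply/andP; split.
  apply: (le_lt_trans xr); rewrite lt_max; apply/orP; left.
  by rewrite ltrD2l ltr1n.
rewrite lt_max; apply/orP; right; rewrite gtr0_norm//; apply: (lt_trans tT).
by rewrite ltrDl.
Qed.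

End cylinder.

Section exponents.
Context (R : realType) (n : nat) (ms : 'I_n.+1 -> R).

Lemma min_exp_le j : min_exp ms <= ms j.
Proof. exact: bigmin_le_cond. Qed.

Lemma min_exp_ge1 : (forall j, 1 <= ms j) -> 1 <= min_exp ms.
Proof.
move=> h; rewrite /min_exp; apply: (big_ind (fun x => 1 <= x)) => // x y x1 y1.
by rewrite le_min x1.
Qed.

Lemma q_star_ge j : ms j <= q_star ms.
Proof. exact: le_bigmax_cond. Qed.

Lemma harm_mean_gt1 (p : 'I_n.+1 -> R) : (forall j, 1 < p j) -> 1 < harm_mean p.
Proof.
move=> p1; rewrite /harm_mean.
have p0 j : 0 < p j := lt_trans ltr01 (p1 j).
have s0 : 0 < \sum_(j < n.+1) (p j)^-1.
  rewrite big_ord_recl ltr_pwDl ?invr_gt0//; apply: sumr_ge0 => j _.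
  by rewrite invr_ge0 ltW.
have n0 : 0 < n.+1%:R :> R by [].
rewrite -[ltLHS]invr1 ltf_pV2 ?posrE ?mulr_gt0 ?invr_gt0//.
rewrite mulrC ltr_pdivrMr// mul1r.
have -> : n.+1%:R = \sum_(j < n.+1) (1 : R).
  by rewrite sumr_const card_ord.
apply: ltr_sum => //; first by apply/hasP; exists ord0; rewrite ?mem_index_enum.
by move=> j _; rewrite invf_lt1.
Qed.

Lemma source_exponent (p : 'I_n.+1 -> R) (sigma : R) : (forall j, 1 < p j) ->
  1 + n.+1%:R / harm_mean p < sigma -> 1 <= sigma * conj_exp (harm_mean p).
Proof.
move=> p1 hs; have h1 := harm_mean_gt1 p1; have h0 := lt_trans ltr01 h1.
have s1 : 1 <= sigma.
  apply: le_trans (ltW hs); rewrite lerDl divr_ge0// ltW//.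
apply: mulr_ege1 => //.
by rewrite /conj_exp ler_pdivlMr ?subr_gt0// mul1r gerBl.
Qed.

Lemma exists_gap (p : 'I_n.+1 -> R) : (forall j, 1 < p j) ->
  (forall j, ms j < conj_exp (p j) * min_exp ms) ->
  exists2 be : R, 0 < be & forall j, be <= ms j - (ms j - min_exp ms) * p j.
Proof.
move=> p1 hm.
exists (\big[Num.min/1]_j (ms j - (ms j - min_exp ms) * p j)); last first.
  by move=> j; exact: bigmin_le_cond.
apply: (big_ind (fun x => 0 < x)) => // [x y x0 y0|j _]; first by rewrite lt_min x0.
have := hm j; have h := p1 j; rewrite /conj_exp mulrAC ltr_pdivlMr ?subr_gt0//.
by move=> h2; rewrite mulrBr mulr1 in h2; rewrite mulrBl; lra.
Qed.

End exponents.

Theorem proposition4p3 (R : realType) (n : nat)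
    (Omega : set 'rV[R]_n.+1) (T : R)
    (p ms : 'I_n.+1 -> R) (Lam c sigma : R)
    (a : 'I_n.+1 -> 'rV[R]_n.+1 * R -> R -> R)
    (f u : 'rV[R]_n.+1 * R -> R) :
  open Omega -> bounded_set Omega -> 0 < T ->
  (forall j, 1 < p j) -> (forall j, 1 <= ms j) ->
  0 < Lam -> 0 < c -> admissible_coef (cylinder Omega T) Lam c a ->
  1 + n.+1%:R / harm_mean p < sigma ->
  (forall z, cylinder Omega T z -> 0 <= f z) ->
  Lp (cylinder Omega T) (sigma * conj_exp (harm_mean p)) f ->
  weak_solution (cylinder Omega T) p ms a f u ->
  (forall j, ms j < conj_exp (p j) * min_exp ms) ->
  exists g : 'I_n.+1 -> 'rV[R]_n.+1 * R -> R, forall j,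
    weak_partial (cylinder Omega T) j (fun z => spow (u z) (min_exp ms)) (g j) /\
    Lp_loc (cylinder Omega T) (p j) (g j).
Proof.
move=> oO bO T0 p1 ms1 Lam0 c0 [ma alim alip] hsig _ Lf [[Lu hV] [wS hwS heq]] hms.
have oD := @cylinder_open R n Omega T oO; have finD := @cylinder_lty R n Omega T oO bO T0.
set D := cylinder Omega T in ma alim alip Lf Lu hV hwS heq oD finD *.
have mD := open_measurable_xt oD; have mDL := borel_leb mD.
set m := min_exp ms.
have m1 : 1 <= m := min_exp_ge1 ms1.
have m0 : 0 < m := lt_le_trans ltr01 m1.
have mms j : m <= ms j := min_exp_le ms j.
have msq j : ms j <= q_star ms := q_star_ge ms j.
have q1 : 1 <= q_star ms := le_trans (ms1 ord0) (msq ord0).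
have [be be0 bems] := exists_gap p1 hms.
have /choice[w hw] j : exists w, weak_partial D j (fun z => spow (u z) (ms j)) w /\ Lp D (p j) w.
  by have [w h1 h2] := hV j; exists w.
have hwp j := (hw j).1; have Lw j := (hw j).2.
(* Less its lower bound, the coefficient may be continued by zero off D; with the
   bound added back it is elliptic everywhere. *)
pose aa j z := a j z (u z) - Lam^-1.
have maa j : measurable_fun (setT : set (leb_space R n.+1)) (aa j \_ D).
  apply/(measurable_restrictT (aa j : leb_space R n.+1 -> R) mDL).
  have mau := lipschitz_coef_measurable mDL c0 (Lp_measurable Lu) (ma j) (alip j).
  have mb := measurable_funB mau (measurable_cst (Lam^-1 : R)).
  apply: (eq_measurable_fun _ _ mb) => z; rewrite inE => Dz.
  by rewrite /aa /= patchE (mem_set Dz).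
pose F (i : 'I_n.+1 + 'I_n.+1 + 'I_n.+1 + bool) : 'rV[R]_n.+1 * R -> R :=
  match i with
  | inl (inl (inl j)) => w j \_ D
  | inl (inl (inr j)) => wS j \_ D
  | inl (inr j) => aa j \_ D
  | inr b => if b then u \_ D else f \_ D
  end.
have mF i : measurable_fun (setT : set (leb_space R n.+1)) (F i).
  case: i => [[[j|j]|j]|[]] /=.
  - exact: Lp_measurable (Lw j).
  - by apply: (Lp_loc_measurable oD); have [] := hwS j.
  - exact: maa.
  - exact: Lp_measurable Lu.
  - exact: Lp_measurable Lf.
(* One null set makes all the data Borel. *)
have [M0 nM0 hM0] := common_null mF.
have mS j : measurable_fun setT (wS j \_ (D `\` M0) : 'rV[R]_n.+1 * measurableTypeR R -> R).
  by have := hM0 (inl (inl (inr j))); rewrite /= patch_patch.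
have mW j : measurable_fun setT (w j \_ (D `\` M0) : 'rV[R]_n.+1 * measurableTypeR R -> R).
  by have := hM0 (inl (inl (inl j))); rewrite /= patch_patch.
have mU : measurable_fun setT (u \_ (D `\` M0) : 'rV[R]_n.+1 * measurableTypeR R -> R).
  by have := hM0 (inr true); rewrite /= patch_patch.
(* The derivatives in the equation are only known to be locally integrable; being
   unique, they agree almost everywhere with those in L^p. *)
have nS j : null_set (D `&` [set z | (wS j \_ (D `\` M0)) z - (w j \_ (D `\` M0)) z != 0]).
  have mv : measurable_fun setT ((fun z => spow (u z) (ms j)) \_ (D `\` M0) : 'rV[R]_n.+1 * measurableTypeR R -> R).
    by rewrite patch_spow; exact: measurable_spow.
  have h0 := weak_derive_unique oD finD nM0 mv (mS j) (mW j) (hwS j) (hwp j).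
  split => //; apply: measurableI => //.
  have mB : measurable_fun setT ((fun z => (wS j \_ (D `\` M0)) z - (w j \_ (D `\` M0)) z) : 'rV[R]_n.+1 * measurableTypeR R -> R).
    exact: measurable_funB.
  rewrite (_ : [set z | _] = ~` ((fun z => (wS j \_ (D `\` M0)) z - (w j \_ (D `\` M0)) z) @^-1` [set 0])).
    by apply: measurableC; rewrite -[_ @^-1` _]setTI; exact: mB.
  by apply/seteqP; split=> z /= /eqP.
pose MM (i : option 'I_n.+1) := if i is Some j then
  D `&` [set z | (wS j \_ (D `\` M0)) z - (w j \_ (D `\` M0)) z != 0] else M0.
have [M nM hM] : exists2 M, null_set M & forall i, MM i `<=` M.
  by apply: null_fin => -[j|]; [exact: nS|exact: nM0].
have mFM i : measurable_fun setT (F i \_ (~` M) : 'rV[R]_n.+1 * measurableTypeR R -> R).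
  by apply: (borel_off_larger nM.1 (hM None)); exact: hM0.
have wSw j z : D z -> ~ M z -> wS j z = w j z.
  move=> Dz nMz; apply/eqP; rewrite -subr_eq0; apply/negPn/negP => ne.
  have nM0z : ~ M0 z by move=> M0z; apply: nMz; exact: (hM None).
  by apply: nMz; apply: (hM (Some j)); split => //=; rewrite !patchE mem_set.
pose XR := ('rV[R]_n.+1 * measurableTypeR R -> R)%type.
pose u' : XR := u \_ (D `\` M); pose f' : XR := f \_ (D `\` M).
pose w' j : XR := w j \_ (D `\` M).
pose al j : XR := fun z => Lam^-1 + (aa j \_ (D `\` M)) z.
have mu' : measurable_fun setT u'.
  by have := mFM (inr true); rewrite /= patch_patch.
have mf' : measurable_fun setT f'.
  by have := mFM (inr false); rewrite /= patch_patch.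
have mw' j : measurable_fun setT (w' j).
  by have := mFM (inl (inl (inl j))); rewrite /= patch_patch.
have mal j : measurable_fun setT (al j).
  apply: measurable_funD => //.
  by have := mFM (inl (inr j)); rewrite /= patch_patch.
have iup r : 0 < r -> r <= q_star ms -> integ (lam R n.+1) (fun z => `|u' z| `^ r).
  by move=> r0 rq; exact: (Lp_integ mD finD q1 r0 rq nM mu' Lu).
have iu : integ (lam R n.+1) u' by apply: (integ_pow1 mu'); exact: iup.
have if' : integ (lam R n.+1) f'.
  apply: (integ_pow1 mf'); have sq := source_exponent p1 hsig.
  exact: (Lp_integ mD finD sq ltr01 sq nM mf' Lf).
have ivr r : 0 < r -> r <= q_star ms -> integ (lam R n.+1) (fun z => spow (u' z) r).
  move=> r0 rq; apply: (integ_le _ (iup r r0 rq)); first exact: measurable_spow.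
  by move=> z; rewrite norm_spow ?gt_eqF// ler_norm.
have ms0 j : 0 < ms j := lt_le_trans ltr01 (ms1 j).
have iwp j : integ (lam R n.+1) (fun z => `|w' j z| `^ p j).
  exact: (Lp_integ mD finD (ltW (p1 j)) (lt_trans ltr01 (p1 j)) (lexx _) nM (mw' j) (Lw j)).
have iw j : integ (lam R n.+1) (w' j).
  apply: (integ_pow1 (mw' j)).
  exact: (Lp_integ mD finD (ltW (p1 j)) ltr01 (ltW (p1 j)) nM (mw' j) (Lw j)).
have u0 z : ~ D z -> u' z = 0 by move=> nD; rewrite /u' patchE memNset// => -[].
have w0 j z : ~ D z -> w' j z = 0 by move=> nD; rewrite /w' patchE memNset// => -[].
have lo0 : 0 < Lam^-1 by rewrite invr_gt0.
have alB j z : Lam^-1 <= al j z <= Lam^-1 + Lam.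
  rewrite /al patchE; case: ifPn => [|_]; last by rewrite addr0 lexx lerDl ltW.
  rewrite inE => -[Dz _]; rewrite /aa addrC subrK.
  have /andP[-> h] := alim j z (u z) Dz.
  by rewrite (le_trans h)// lerDr ltW.
have weq j phi : test_function D phi ->
    \int[lam R n.+1]_z (spow (u' z) (ms j) * 'D_(space_dir R j) phi z) =
    - \int[lam R n.+1]_z (w' j z * phi z).
  have mv : measurable_fun setT ((fun z => spow (u z) (ms j)) \_ (D `\` M) : XR).
    by rewrite patch_spow; exact: measurable_spow.
  move=> tphi; have [_ _ h] := hwp j.
  have := (weak_derive_borel oD nM (space_dir R j) mv (mw' j)).1 h _ tphi.
  by rewrite patch_spow.
have iA j := integ_flux oD finD iw iwp w0 mal lo0 alB p1 j.
have eqn phi : sm phi -> test_function D phi ->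
    \sum_j \int[lam R n.+1]_z (al j z * (`|w' j z| `^ (p j - 2) * w' j z) * 'D_(edir R (Some j)) phi z) -
    \int[lam R n.+1]_z (u' z * 'D_(edir R None) phi z) = \int[lam R n.+1]_z (f' z * phi z).
  move=> sphi tphi.
  have [B B0 hB] := cutoff_bdd sphi tphi.
  have mp := measurable_sm sphi.
  have mDp i := measurable_sm (sm_derive (edir R i) sphi).
  have iAD j : integ (lam R n.+1)
      (fun z => al j z * (`|w' j z| `^ (p j - 2) * w' j z) * 'D_(edir R (Some j)) phi z).
    rewrite (_ : (fun z => _) = fun z => 'D_(edir R (Some j)) phi z *
        (al j z * (`|w' j z| `^ (p j - 2) * w' j z))); last first.
      by apply/funext => z; rewrite mulrC.
    by apply: (@integM_bdd _ _ _ _ _ _ B) => // z; have [] := hB z.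
  have iuD : integ (lam R n.+1) (fun z => u' z * 'D_(edir R None) phi z).
    rewrite (_ : (fun z => _) = fun z => 'D_(edir R None) phi z * u' z); last first.
      by apply/funext => z; rewrite mulrC.
    by apply: (@integM_bdd _ _ _ _ _ _ B) => // z; have [] := hB z.
  have iS : integ (lam R n.+1) (fun z => \sum_j (al j z * (`|w' j z| `^ (p j - 2) * w' j z) * 'D_(edir R (Some j)) phi z)).
    exact: integ_sum_fin.
  have E1 : (fun z => \sum_(j < n.+1) a j z (u z) * (`|wS j z| `^ (p j - 2) * wS j z)
                      * 'D_(space_dir R j) phi z
        - u z * 'D_(time_dir R n.+1) phi z) \_ (D `\` M) =
      fun z => \sum_j (al j z * (`|w' j z| `^ (p j - 2) * w' j z) * 'D_(edir R (Some j)) phi z)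
        - u' z * 'D_(edir R None) phi z.
    apply/funext => z; rewrite /u' /w' /al !patchE; case: ifPn => [|nDM].
      rewrite inE => -[Dz nMz]; congr (_ - _); apply: eq_bigr => j _.
      by rewrite !patchE mem_set// wSw// /aa (addrC Lam^-1) subrK.
    rewrite mul0r subr0 big1// => j _; rewrite !patchE (negbTE nDM).
    by rewrite mulr0 mulr0 mul0r.
  have := heq phi tphi.
  rewrite (integral_onE oD nM); last by rewrite E1; have /integP[] := integB iS iuD.
  rewrite (integral_onE oD nM); last by rewrite patchMr; exact: measurable_funM.
  rewrite E1 patchMr -/f' => <-.
  by rewrite (RintegralB measurableT iS iuD) Rint_sum_fin.
have [g hg] := power_regularity oD finD iu if' (fun j => ivr _ (ms0 j) (msq j)) iw iwp
  u0 w0 mal lo0 alB p1 m1 mms be0 bems (fun j phi _ => weq j phi) eqn.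
exists g => j; have [mg g0 gK gphi] := hg j.
have gE : g j \_ (D `\` M) = g j.
  apply/funext => z; rewrite patchE; case: ifPn => // nz; rewrite g0//.
  by rewrite /u' patchE (negbTE nz).
have mgE : measurable_fun setT (g j \_ (D `\` M) : XR) by rewrite gE.
have mv : measurable_fun setT ((fun z => spow (u z) m) \_ (D `\` M) : XR).
  by rewrite patch_spow; exact: measurable_spow.
have iv := ivr m m0 (le_trans (mms j) (msq j)).
split; last first.
  apply: (Lp_loc_of_integ nM (lt_trans ltr01 (p1 j)) mgE) => K cK KD.
  by rewrite gE; have [] := gK K cK KD.
have pow1 (h : XR) : (fun z => `|h z| `^ 1) = fun z => `|h z|.
  by apply/funext => z; rewrite powRr1.
split.
- apply: (Lp_loc_of_integ nM ltr01 mv) => K cK KD.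
  rewrite patch_spow; apply: (integ_le _ iv).
    apply: measurable_funM; last by apply: measurable_pow_norm; exact: measurable_spow.
    by apply: measurable_indic; exact: compact_measurable.
  move=> z; rewrite powRr1// normrM normr_id indicE.
  by case: (z \in K); rewrite ?normr1 ?normr0 ?mul1r ?mul0r.
- apply: (Lp_loc_of_integ nM ltr01 mgE) => K cK KD; rewrite gE.
  have [_ h] := gK K cK KD.
  apply: (integ_le _ h).
    apply: measurable_funM; last exact: measurable_pow_norm.
    by apply: measurable_indic; exact: compact_measurable.
  by move=> z; rewrite powRr1// !normrM normr_id.
apply: (weak_derive_borel oD nM (space_dir R j) mv mgE).2 => phi tphi.
by rewrite patch_spow gE; exact: gphi.
Qed.
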